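(* Let $(M,g,P)$ be a 4-dimensional paraHermitian manifold. Let $W^+$ be the self-dual part of the Weyl tensor and let $\theta$ be the Lee 1-form. The following conditions are equivalent: (a) The 2-form $d\theta$ is anti-self-dual, i.e. $d\theta^+=0$; (b) $W_2^+=0$; equivalently, the fundamental 2-form $F$ is an eigenform of $W^+$; (c) $(\delta W^+)^-=0$; equivalently, $(\delta W)(X^{1,0};Y^{1,0},Z^{1,0})=0$ for all vectors $X^{1,0},Y^{1,0},Z^{1,0}$ of type $(1,0)$.
   Context: A paraHermitian 4-manifold $(M,g,P)$ is a smooth 4-manifold with a $(1,1)$-tensor $P$ satisfying $P^2=\mathrm{id}$, whose $\pm1$-eigenbundles $T^\pm M$ both have rank 2, and a pseudo-Riemannian metric $g$ (necessarily of signature $(2,2)$) with $g(PX,Y)+g(X,PY)=0$, such that $P$ is integrable: $4N(X,Y)=[PX,PY]+[X,Y]-P[PX,Y]-P[X,PY]=0$. Vectors in $T^+M$ (resp. $T^-M$) are said to be of type $(1,0)$ (resp. $(0,1)$). The fundamental 2-form is $F(X,Y)=g(X,PY)$. In dimension 4 the Lee form $\theta$ determines $dF$ by $dF=\theta\wedge F$, and is the unique 1-form with this property. $M$ is oriented so that $F$ is self-dual: $\Lambda^2M=\Lambda^+M\oplus\Lambda^-M$ is the splitting into the $\pm1$-eigenbundles of the Hodge operator, $F$ is a section of $\Lambda^+M$, and $\alpha^+$ denotes the self-dual part of a 2-form $\alpha$. There is an orthogonal splitting $\Lambda^+M=\mathbb R F\oplus\Lambda^+_0M$, where $\Lambda^+_0M$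 consists of the 2-forms $\phi$ with $\phi(PX,PY)=\phi(X,Y)$. The self-dual Weyl tensor $W^+$ is a symmetric traceless endomorphism of $\Lambda^+M$ and decomposes as $W^+=W^+_1+W^+_2+W^+_3$, where $W^+_1$ preserves the splitting and acts by a multiple of the identity on each of the two factors (i.e. is a function times $\frac34F\otimes F-\frac12\mathrm{id}$), $W_2^+$ exchanges the two factors (i.e. is of the form $\frac12(F\otimes\phi+\phi\otimes F)$ with $\phi\in\Lambda^+_0M$), and $W^+_3$ preserves the splitting, vanishes on $\mathbb RF$ and is traceless on $\Lambda_0^+M$. $W$ denotes the Weyl tensor, and $\delta W$, $\delta W^+$ are the co-differentials with respect to the Levi-Civita connection $\nabla^g$ (divergences, $(\delta W)(X;Y,Z)=-\sum_i\epsilon_i(\nabla^g_{e_i}W)(e_i,X,Y,Z)$ up to sign convention, with $e_i$ an orthonormal frame and $\epsilon_i=g(e_i,e_i)$), viewed as $T^*M$-valued 2-forms $(X;Y,Z)\mapsto(\delta W)(X;Y,Z)$, skew in $Y,Z$. Writing a tensor $B(X;Y,Z)$ skew in $Y,Z$ as $g(X,B(Y,Z))$ with $B$ a $TM$-valued 2-form, $B$ is of type $(1,1)$ if $B(PX,PY)=-B(X,Y)$, of type $(0,2)$ if $B(PX,Y)=-PB(X,Y)$, and of type $(2,0)$ if $B(PX,Y)=PB(X,Y)$. Correspondingly $\delta W^+=(\delta W^+)^+\oplus(\delta W^+)^-$, where $(\delta W^+)^+$ is the part of type $(2,0)+(1,1)$ and $(\delta W^+)^-$ is the part of type $(0,2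)$.
   Formalization: The second form of (c) is stated as vanishing of δW on all triples of vectors of type (1,0) and also on all triples of type (0,1), because vanishing on type (1,0) alone does not imply (δW⁺)⁻=0. *)

(* Defs.v *)
From HB Require Import structures.
From mathcomp Require Import all_boot all_order all_algebra.
From mathcomp Require Import all_classical all_reals all_analysis.
Set Implicit Arguments.
Unset Strict Implicit.
Unset Printing Implicit Defensive.
Import Order.TTheory GRing.Theory Num.Theory numFieldNormedType.Exports.
Local Open Scope classical_set_scope.
Local Open Scope ring_scope.

(* Tensors are handled by their components in charts. A tangent vector is the
   row X = (X^i) : 'rV_4; a 2-tensor B is the matrix of the B(d_i, d_j); a
   (1,1)-tensor P acts on the right, P X = X *m P; a 2-form is a skew matrix. *)

Section Coordinates.
Variable R : realType.
Implicit Types (f : 'rV[R]_4 -> R) (U : set 'rV[R]_4) (x : 'rV[R]_4).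

Definition pderive (i : 'I_4) f : 'rV[R]_4 -> R :=
  fun x => 'D_(delta_mx 0 i) f x.

(* C^infinity on an open set U: all iterated partial derivatives are
   (Frechet) differentiable, hence continuous, at every point of U. *)
Definition smooth_on U f : Prop :=
  forall (s : seq 'I_4) x, U x -> differentiable (foldr pderive f s) x.

Definition smooth_vector_on U (X : 'rV[R]_4 -> 'rV[R]_4) : Prop :=
  forall k, smooth_on U (fun x => X x 0 k).

Definition smooth_matrix_on U (A : 'rV[R]_4 -> 'M[R]_4) : Prop :=
  forall i j, smooth_on U (fun x => A x i j).

Definition lie_bracket (X Y : 'rV[R]_4 -> 'rV[R]_4) : 'rV[R]_4 -> 'rV[R]_4 :=
  fun x => 'D_(X x) Y x - 'D_(Y x) X x.

Definition nijenhuis (P : 'rV[R]_4 -> 'M[R]_4) (X Y : 'rV[R]_4 -> 'rV[R]_4) :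
    'rV[R]_4 -> 'rV[R]_4 :=
  let act (Z : 'rV[R]_4 -> 'rV[R]_4) := fun y => Z y *m P y in
  fun x => 4^-1 *:
    (lie_bracket (act X) (act Y) x + lie_bracket X Y x
     - lie_bracket (act X) Y x *m P x - lie_bracket X (act Y) x *m P x).

End Coordinates.

Record manifold4 (R : realType) := Manifold4 {
  msort :> topologicalType;
  m_hausdorff : hausdorff_space msort;
  m_second_countable : @second_countable msort;
  chart : Type;
  cdom : chart -> set msort;
  cmap : chart -> msort -> 'rV[R]_4;
  cinv : chart -> 'rV[R]_4 -> msort;
  cdom_cover : forall p, exists a, cdom a p;
  cdom_open : forall a, open (cdom a);
  cimg_open : forall a, open (cmap a @` cdom a);
  cmapK : forall a p, cdom a p -> cinv a (cmap a p) = p;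
  cmap_continuous : forall a p, cdom a p -> {for p, continuous (cmap a)};
  cinv_continuous : forall a x, (cmap a @` cdom a) x ->
    {for x, continuous (cinv a)};
  transition_smooth : forall a b,
    smooth_vector_on (cmap a @` (cdom a `&` cdom b))
      (fun x => cmap b (cinv a x))
}.
Arguments chart {R} m.
Arguments cdom {R m} a _.
Arguments cmap {R m} a _.
Arguments cinv {R m} a _.

Section Charts.
Variables (R : realType) (M : manifold4 R).
Implicit Types (a b : chart M).

Definition cimg a : set 'rV[R]_4 := cmap a @` cdom a.

Definition overlap a b : set 'rV[R]_4 := cmap a @` (cdom a `&` cdom b).

Definition transition a b : 'rV[R]_4 -> 'rV[R]_4 := fun x => cmap b (cinv a x).

(* Holds at every point of M, in every chart around it. *)
Definition everywhere (Q : chart M -> 'rV[R]_4 -> Prop) : Prop :=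
  forall a x, cimg a x -> Q a x.

End Charts.

(* 'J f x is the transpose of the usual Jacobian matrix, so a vector with
   components X in the chart a has components X *m 'J (transition a b) x in the
   chart b. *)
Record paraHermitian (R : realType) (M : manifold4 R) := ParaHermitian {
  metric : chart M -> 'rV[R]_4 -> 'M[R]_4;
  para : chart M -> 'rV[R]_4 -> 'M[R]_4;
  metric_smooth : forall a, smooth_matrix_on (cimg a) (metric a);
  para_smooth : forall a, smooth_matrix_on (cimg a) (para a);
  metric_tensor : forall a b x, overlap a b x ->
    let J := 'J (transition a b) x in
    metric a x = J *m metric b (transition a b x) *m J^T;
  para_tensor : forall a b x, overlap a b x ->
    let J := 'J (transition a b) x in
    para a x *m J = J *m para b (transition a b x);
  metric_sym : everywhere (fun a x => (metric a x)^T = metric a x);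
  metric_nondegenerate : everywhere (fun a x => metric a x \in unitmx);
  para_involutive : everywhere (fun a x => para a x *m para a x = 1%:M);
  para_rank_plus : everywhere (fun a x => \rank (eigenspace (para a x) 1) = 2%N);
  para_rank_minus :
    everywhere (fun a x => \rank (eigenspace (para a x) (-1)) = 2%N);
  metric_para : everywhere (fun a x => forall X Y : 'rV[R]_4,
    (X *m para a x) *m metric a x *m Y^T
    + X *m metric a x *m (Y *m para a x)^T = 0);
  para_integrable : forall a (X Y : 'rV[R]_4 -> 'rV[R]_4),
    smooth_vector_on (cimg a) X -> smooth_vector_on (cimg a) Y ->
    forall x, cimg a x -> nijenhuis (para a) X Y x = 0
}.

Record oneForm (R : realType) (M : manifold4 R) := OneForm {
  form1 :> chart M -> 'rV[R]_4 -> 'rV[R]_4;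
  form1_smooth : forall a, smooth_vector_on (cimg a) (form1 a);
  form1_tensor : forall a b x, overlap a b x ->
    form1 a x = form1 b (transition a b x) *m ('J (transition a b) x)^T
}.

(* The sign of the coordinate frame of each chart. *)
Record orientation (R : realType) (M : manifold4 R) := Orientation {
  osign :> chart M -> 'rV[R]_4 -> R;
  osign_values : everywhere (fun a x => osign a x = 1 \/ osign a x = -1);
  osign_locally_constant :
    everywhere (fun a x => \forall y \near x, osign a y = osign a x);
  osign_compat : forall a b x, overlap a b x ->
    osign a x = Num.sg (\det ('J (transition a b) x))
                * osign b (transition a b x)
}.

Section Curvature.
Variables (R : realType) (g : 'rV[R]_4 -> 'M[R]_4).
Implicit Types (x : 'rV[R]_4) (i j k l m p q : 'I_4).
Local Notation tensor4 := ('I_4 -> 'I_4 -> 'I_4 -> 'I_4 -> 'rV[R]_4 -> R).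

Definition ginv x : 'M[R]_4 := invmx (g x).

(* Levi-Civita connection: nabla_(d_i) d_j = sum_k christoffel k i j d_k. *)
Definition christoffel k i j x : R :=
  2^-1 * \sum_l ginv x k l *
    (pderive i (fun y => g y j l) x + pderive j (fun y => g y i l) x
     - pderive l (fun y => g y i j) x).

(* R(d_k, d_l) d_j = sum_i riemann_up i j k l d_i, with
   R(X,Y) = [nabla_X, nabla_Y] - nabla_[X,Y]. *)
Definition riemann_up i j k l x : R :=
  pderive k (christoffel i l j) x - pderive l (christoffel i k j) x
  + \sum_m (christoffel i k m x * christoffel m l j x
            - christoffel i l m x * christoffel m k j x).

(* riemann i j k l = g(d_i, R(d_k, d_l) d_j) *)
Definition riemann : tensor4 :=
  fun i j k l x => \sum_m g x i m * riemann_up m j k l x.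

Definition ricci j l x : R := \sum_k riemann_up k j k l x.

Definition scalar_curvature x : R := \sum_j \sum_l ginv x j l * ricci j l x.

Definition weyl : tensor4 := fun i j k l x =>
  riemann i j k l x
  - 2^-1 * (g x i k * ricci j l x - g x i l * ricci j k x
            + g x j l * ricci i k x - g x j k * ricci i l x)
  + 6^-1 * scalar_curvature x * (g x i k * g x j l - g x i l * g x j k).

Definition nabla4 (T : tensor4) p i j k l x : R :=
  pderive p (T i j k l) x
  - \sum_m (christoffel m p i x * T m j k l x
            + christoffel m p j x * T i m k l x
            + christoffel m p k x * T i j m l x
            + christoffel m p l x * T i j k m x).

(* For an orthonormal frame (e_i), ginv = sum_i epsilon_i e_i e_i. *)
Definition codiff (T : tensor4) i j k x : R :=
  - \sum_p \sum_q ginv x p q * nabla4 T p q i j k x.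

End Curvature.

Section TwoForms.
Variable R : realType.
Implicit Types (g P A : 'M[R]_4) (o : R).

Definition raise g A : 'M[R]_4 := invmx g *m A *m (invmx g)^T.

Definition form_inner g A B : R :=
  2^-1 * \sum_i \sum_j A i j * raise g B i j.

Definition levi_civita (i j k l : 'I_4) : R :=
  \det (\matrix_(p < 4, q < 4) (tnth [tuple i; j; k; l] p == q)%:R).

Definition volume o g (i j k l : 'I_4) : R :=
  o * Num.sqrt `|\det g| * levi_civita i j k l.

(* A /\ hodge B = form_inner A B * volume *)
Definition hodge o g A : 'M[R]_4 :=
  \matrix_(i, j) (2^-1 * \sum_k \sum_l volume o g i j k l * raise g A k l).

Definition sd_part o g A : 'M[R]_4 := 2^-1 *: (A + hodge o g A).

Definition self_dual o g A : Prop := A^T = - A /\ hodge o g A = A.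

(* F(X,Y) = g(X,PY) *)
Definition fundamental g P : 'M[R]_4 := g *m P^T.

(* The components of A^+ along F and along its orthogonal complement
   Lambda^+_0 in Lambda^+. *)
Definition proj_F o g P A : 'M[R]_4 :=
  let F := fundamental g P in
  (form_inner g (sd_part o g A) F / form_inner g F F) *: F.

Definition proj_0 o g P A : 'M[R]_4 := sd_part o g A - proj_F o g P A.

End TwoForms.

(* At one point: P is the value of the paracomplex structure and B a TM-valued
   2-form. *)
Section Types.
Variable R : realType.
Implicit Types (P : 'M[R]_4) (B : 'rV[R]_4 -> 'rV[R]_4 -> 'rV[R]_4).

Definition vector10 P (X : 'rV[R]_4) : Prop := X *m P = X.
Definition vector01 P (X : 'rV[R]_4) : Prop := X *m P = - X.

Definition type11 P B : Prop := forall X Y, B (X *m P) (Y *m P) = - B X Y.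
Definition type02 P B : Prop := forall X Y, B (X *m P) Y = - (B X Y *m P).
Definition type20 P B : Prop := forall X Y, B (X *m P) Y = B X Y *m P.

(* The projection onto type (0,2) along the types (2,0) and (1,1). *)
Definition part02 P B : 'rV[R]_4 -> 'rV[R]_4 -> 'rV[R]_4 := fun X Y =>
  4^-1 *: (B X Y + B (X *m P) (Y *m P) - B (X *m P) Y *m P - B X (Y *m P) *m P).

End Types.

Section LocalConditions.
Variables (R : realType).
(* Fields in one chart: metric, paracomplex structure, orientation sign. *)
Variables (g P : 'rV[R]_4 -> 'M[R]_4) (o : 'rV[R]_4 -> R).
Implicit Types (x X Y Z : 'rV[R]_4) (theta : 'rV[R]_4 -> 'rV[R]_4).

Definition fund_form x : 'M[R]_4 := fundamental (g x) (P x).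

(* dF = theta /\ F *)
Definition lee_at theta x : Prop := forall i j k : 'I_4,
  let F := fund_form in
  pderive i (fun y => F y j k) x + pderive j (fun y => F y k i) x
    + pderive k (fun y => F y i j) x
  = theta x 0 i * F x j k + theta x 0 j * F x k i + theta x 0 k * F x i j.

Definition ext_deriv theta x : 'M[R]_4 :=
  \matrix_(i, j) (pderive i (fun y => theta y 0 j) x
                  - pderive j (fun y => theta y 0 i) x).

(* W^+ is the self-dual part of W in its first pair of indices (equivalently in
   the second one, since W commutes with the Hodge operator). *)
Definition weyl_plus (i j k l : 'I_4) x : R :=
  sd_part (o x) (g x) (\matrix_(p, q) weyl g p q k l x) i j.

Definition weyl_plus_op x (A : 'M[R]_4) : 'M[R]_4 :=
  \matrix_(i, j) (2^-1 * \sum_k \sum_l weyl_plus i j k l x * raise (g x) A k l).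

(* The component of W^+ exchanging RF and Lambda^+_0. *)
Definition weyl_plus2 x (A : 'M[R]_4) : 'M[R]_4 :=
  proj_F (o x) (g x) (P x) (weyl_plus_op x (proj_0 (o x) (g x) (P x) A))
  + proj_0 (o x) (g x) (P x) (weyl_plus_op x (proj_F (o x) (g x) (P x) A)).

Definition eval3 (b : 'I_4 -> 'I_4 -> 'I_4 -> 'rV[R]_4 -> R) x X Y Z : R :=
  \sum_i \sum_j \sum_k b i j k x * X 0 i * Y 0 j * Z 0 k.

(* The TM-valued 2-form B with b(X;Y,Z) = g(X,B(Y,Z)). *)
Definition vector_form (b : 'I_4 -> 'I_4 -> 'I_4 -> 'rV[R]_4 -> R) x Y Z :
    'rV[R]_4 :=
  \row_l \sum_i ginv g x l i * eval3 b x (delta_mx 0 i) Y Z.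

Definition codiff_weyl_plus_minus x : 'rV[R]_4 -> 'rV[R]_4 -> 'rV[R]_4 :=
  part02 (P x) (vector_form (codiff g weyl_plus) x).

End LocalConditions.

Section PartLemmas.
Variable (R : realType) (P : 'M[R]_4) (B : 'rV[R]_4 -> 'rV[R]_4 -> 'rV[R]_4).
Hypothesis PP : P *m P = 1%:M.
Hypothesis B_skew : forall X Y, B X Y = - B Y X.

Let actK (X : 'rV[R]_4) : X *m P *m P = X.
Proof. by rewrite -mulmxA PP mulmx1. Qed.

Lemma part02_id : type02 P B -> forall X Y, part02 P B X Y = B X Y.
Proof.
move=> B02 X Y; rewrite /part02.
have B2 U V : B U (V *m P) = - (B U V *m P).
  by rewrite B_skew B02 (B_skew V) mulNmx !opprK.
rewrite !B2 !B02 !mulNmx !actK !opprK.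
by rewrite -mulr2n -!mulrSr -[B X Y *+ 4]scaler_nat scalerA mulVf ?pnatr_eq0 // scale1r.
Qed.

Lemma part02_type20 : type20 P B -> forall X Y, part02 P B X Y = 0.
Proof.
move=> B20 X Y; rewrite /part02.
have B2 U V : B U (V *m P) = B U V *m P.
  by rewrite B_skew B20 (B_skew V) mulNmx opprK.
by rewrite !B2 !B20 !actK addrK subrr scaler0.
Qed.

Lemma part02_type11 : type11 P B -> forall X Y, part02 P B X Y = 0.
Proof.
move=> B11 X Y; rewrite /part02 B11 subrr.
have -> : B (X *m P) Y = - B X (Y *m P) by rewrite -[in LHS](actK Y) B11.
by rewrite mulNmx opprK add0r subrr scaler0.
Qed.

End PartLemmas.

(* Main.v *)
(* Let T+ be one of the eigenbundles of P; exchanging P and -P gives the other one.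
   It is isotropic and integrable, hence totally geodesic, and near each point it has
   a commuting frame e0, e1, completed to a null frame by the dual frame f0, f1 of T-.
   Put psi = W(e0,f0,e0,e1) = W(e1,f1,e0,e1). It is half of W+(F)(e0,e1), and minus
   half of the curvature of the second exterior power of T+ on (e0,e1). The partial
   connection [X, _] of T+ on TM/T+ is flat; comparing its trace with the values
   theta(e_a) that dF = theta /\ F gives yields dtheta(e0,e1) = 4 psi. Since moreover
   dtheta /\ F = 0, the self-dual part of dtheta is determined by the restrictions of
   dtheta to T+ and T-, which proves the equivalence of (a) and (b). Finally
     delta W(e_a;e0,e1) = delta W+(e_a;e0,e1) = e_a psi + (4 kap_a - tau_a) psi
   with connection coefficients kap and tau. Hence delta W vanishes on T+ if psi does;
   conversely the commutator of these two equations, in which the curvatures of kap and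
   tau are multiples of psi, gives 10 psi^2 = 0. *)

Require Import Defs.
From HB Require Import structures.
From mathcomp Require Import all_boot all_order all_algebra perm ring lra.
From mathcomp Require Import all_classical all_reals all_analysis.
Set Implicit Arguments.
Unset Strict Implicit.
Unset Printing Implicit Defensive.
Import Order.TTheory GRing.Theory Num.Theory numFieldNormedType.Exports.
Local Open Scope classical_set_scope.
Local Open Scope ring_scope.

(** * Smooth functions on an open set *)

(** The commuting frame comes from linear algebra alone: no integration of the distribution [T+] is
    involved. The metric is constant on the frame, so the whole computation is polynomial in the
    connection coefficients and their derivatives. It is carried out over a commutative ring with
    commuting derivations, of which the smooth functions on a small open set are an instance, and
    evaluated at points afterwards. That ring is not a field, so each division, by [\det g], by a
    minor of [1 + P] or by 2, needs an explicit inverse. The equivalence of (a) and (b) compares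
    values at one point. That of (b) and (c) cannot, because [delta W] contains derivatives of
    [psi]: both directions run on a whole neighbourhood. The function [psi] depends on the frame and
    only its vanishing has a meaning, which is expressed by the restriction of [W^+(F)] to the
    eigenbundles. Self-duality of [F] gives the frame unit volume. The Hodge operator, with its
    square root and orientation sign, then becomes a polynomial expression in [P] and the frame,
    which can be differentiated. *)

Section Schwarz.
Variables (R : realType) (V : normedModType R).
Implicit Types (f : V -> R) (x v w : V).

Lemma is_derive_line f x v (t : R) : differentiable f (x + t *: v) ->
  is_derive t 1 (fun s : R => f (x + s *: v)) ('D_v f (x + t *: v)).
Proof.
move=> df.
have dl : is_diff t (fun s : R => x + s *: v) (fun s : R => s *: v).
  apply: (@is_diff_eq _ _ _ _ _ _ _ (is_diffD (is_diff_cst x _) (is_diff_scalel t v))).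
  by apply/funext => s; rewrite /= !fctE add0r.
have dl' : differentiable (fun s : R => x + s *: v) t by case: dl.
have dc : differentiable (f \o (fun s : R => x + s *: v)) t.
  by apply: differentiable_comp.
split; first exact: diff_derivable.
rewrite deriveE // diff_comp //.
by rewrite /= (@diff_val _ _ _ _ _ _ _ dl) scale1r deriveE.
Qed.

Lemma differentiable_approx f x (e : R) : differentiable f x -> 0 < e ->
  exists2 d : R, 0 < d & forall h, `|h| < d ->
    `|f (x + h) - f x - 'D_h f x| <= e * `|h|.
Proof.
move=> df e0.
have [_ fE] := (diff_locallyxP x f).1 df.
have := (@eqaddoP _ _ _ _ _ _ _ _ ).1 (eqaddoE (funext fE)) => /(_ _ e0).
move=> /nbhs_normP[d /= d0 dP]; exists d => // h hd.
have := dP h; rewrite /= sub0r normrN => /(_ hd).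
by rewrite !fctE opprD addrA deriveE // [h + x]addrC.
Qed.

(** Young's form of Schwarz's theorem: besides differentiability of [f] on [U], only that of
    ['D_i f] at [x] is used. The mean value theorem along [i], applied to the increment of [f] in
    the direction [j], turns the second difference into [h] times an increment of ['D_i f], which
    the linear approximation at [x] controls. The second difference is symmetric in [i] and [j],
    whence [derive_comm]. *)
Let second_difference_approx f i j x (e : R) (U : set V) :
  open U -> (forall y, U y -> differentiable f y) -> U x ->
  differentiable (fun y => 'D_i f y) x -> 0 < e ->
  exists2 d : R, 0 < d & forall h, 0 < h < d ->
   `|f (x + h *: i + h *: j) - f (x + h *: i) - f (x + h *: j) + f x
     - h ^+ 2 * 'D_j (fun y => 'D_i f y) x| <= e * h ^+ 2.
Proof.
move=> oU fU Ux dif e0.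
(* The summand 1 keeps [c] positive when both directions vanish. *)
set c := `|i| + `|j| + 1.
have c0 : 0 < c by rewrite /c ltr_wpDl // addr_ge0.
have [d1 d10 d1P] : exists2 d : R, 0 < d & forall v, `|v| < d -> U (x + v).
  have /nbhs_normP[d /= d0 dP] := open_nbhs_nbhs (conj oU Ux).
  exists d => // v vd; apply: dP.
  by rewrite /= opprD addrA subrr add0r normrN.
(* Two approximation errors will occur, each at most this constant times a displacement of length at
   most [h * c]; together they stay below [e * h]. *)
have e'0 : 0 < e / (2 * c) by rewrite divr_gt0 // mulr_gt0.
have [d2 d20 d2P] := differentiable_approx dif e'0.
set d := Num.min d1 d2.
have d0 : 0 < d by rewrite lt_min d10.
exists (d / c); first by rewrite divr_gt0.
move=> h /andP[h0 hd].
have small s t : 0 <= s <= h -> 0 <= t <= h -> `|s *: i + t *: j| <= h * c.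
  move=> /andP[s0 sh] /andP[t0 th]; apply: (le_trans (ler_normD _ _)).
  rewrite !normrZ (ger0_norm s0) (ger0_norm t0) /c !mulrDr mulr1.
  rewrite -[leLHS]addr0 lerD ?(ltW h0) //.
  by rewrite lerD // ler_wpM2r.
have hcd : h * c < d by rewrite -ltr_pdivlMr.
have sm1 s t : 0 <= s <= h -> 0 <= t <= h -> `|s *: i + t *: j| < d1.
  by move=> /small sh /sh /le_lt_trans; apply; apply: lt_le_trans hcd _; rewrite ge_min lexx.
have sm2 s t : 0 <= s <= h -> 0 <= t <= h -> `|s *: i + t *: j| < d2.
  by move=> /small sh /sh /le_lt_trans; apply; apply: lt_le_trans hcd _; rewrite ge_min lexx orbT.
have h00 : (0 : R) <= 0 <= h by rewrite lexx ltW.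
have hhh : 0 <= h <= h by rewrite lexx (ltW h0).
pose phi (s : R) := f (x + h *: j + s *: i) - f (x + s *: i).
have dphi s : 0 <= s <= h -> is_derive s 1 phi
    ('D_i f (x + h *: j + s *: i) - 'D_i f (x + s *: i)).
  move=> sh; apply: is_deriveB; apply: is_derive_line; apply: fU.
    by rewrite -addrA [h *: j + _]addrC; apply/d1P/sm1.
  by rewrite -[s *: i]addr0 -[X in x + (_ + X)](scale0r j); apply/d1P/sm1.
have [s sh phiE] : exists2 s, s \in `]0, h[%R & phi h - phi 0 =
   ('D_i f (x + h *: j + s *: i) - 'D_i f (x + s *: i)) * (h - 0).
  apply: (@MVT _ phi (fun s => 'D_i f (x + h *: j + s *: i) - 'D_i f (x + s *: i))) => //.
    by move=> s; rewrite in_itv /= => /andP[s0 sh]; apply: dphi; rewrite !ltW.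
  apply: derivable_within_continuous => s; rewrite in_itv /= => sh.
  by have [] := dphi s sh.
have sh' : 0 <= s <= h by move: sh; rewrite in_itv /= => /andP[s0 sh]; rewrite !ltW.
have -> : f (x + h *: i + h *: j) - f (x + h *: i) - f (x + h *: j) + f x = phi h - phi 0.
  rewrite /phi scale0r !addr0 -!addrA [h *: j + _]addrC !addrA; ring.
rewrite phiE subr0.
have A1 := d2P _ (sm2 s h sh' hhh).
have A2 := d2P _ (sm2 s 0 sh' h00).
have lin : 'D_(s *: i + h *: j) (fun y => 'D_i f y) x - 'D_(s *: i + 0 *: j) (fun y => 'D_i f y) x
     = h * 'D_j (fun y => 'D_i f y) x.
  rewrite !deriveE // -linearB /= scale0r addr0 addrAC subrr add0r linearZ //.
set G := fun y => 'D_i f y in A1 A2 lin *.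
have -> : ('D_i f (x + h *: j + s *: i) - 'D_i f (x + s *: i)) * h - h ^+ 2 * 'D_j G x
  = h * ((G (x + (s *: i + h *: j)) - G x - 'D_(s *: i + h *: j) G x)
    - (G (x + (s *: i + 0 *: j)) - G x - 'D_(s *: i + 0 *: j) G x)).
  have sub4 (a b u w k : R) : (a - u - w) - (b - u - k) = a - b - (w - k) by ring.
  rewrite sub4 lin scale0r addr0 [s *: i + h *: j]addrC [x + (_ + _)]addrA /G.
  by rewrite mulrBr mulrA -expr2 [_ * h]mulrC.
rewrite normrM (gtr0_norm h0) expr2 mulrCA ler_pM2l //.
apply: (le_trans (ler_normB _ _)).
have A1' : `|G (x + (s *: i + h *: j)) - G x - 'D_(s *: i + h *: j) G x| <= e / 2 * h.
  apply: (le_trans A1); rewrite invfM mulrA.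
  rewrite -[leLHS]mulrA ler_wpM2l //; first by rewrite divr_ge0 // ltW.
  by rewrite ler_pdivrMl // [leRHS]mulrC small.
have A2' : `|G (x + (s *: i + 0 *: j)) - G x - 'D_(s *: i + 0 *: j) G x| <= e / 2 * h.
  apply: (le_trans A2); rewrite invfM mulrA.
  rewrite -[leLHS]mulrA ler_wpM2l //; first by rewrite divr_ge0 // ltW.
  by rewrite ler_pdivrMl // [leRHS]mulrC small.
apply: (le_trans (lerD A1' A2')).
by rewrite -mulrDl -splitr.
Qed.

Lemma derive_comm f i j x (U : set V) :
  open U -> (forall y, U y -> differentiable f y) -> U x ->
  differentiable (fun y => 'D_i f y) x -> differentiable (fun y => 'D_j f y) x ->
  'D_j (fun y => 'D_i f y) x = 'D_i (fun y => 'D_j f y) x.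
Proof.
move=> oU fU Ux di dj.
apply/eqP; rewrite -subr_eq0 -normr_le0; apply/ler_addgt0Pl => e e0.
rewrite addr0.
have e20 : 0 < e / 2 by rewrite divr_gt0.
have [d1 d10 d1P] := second_difference_approx j oU fU Ux di e20.
have [d2 d20 d2P] := second_difference_approx i oU fU Ux dj e20.
set h := Num.min d1 d2 / 2.
have h0 : 0 < h by rewrite divr_gt0 // lt_min d10.
have hm : h < Num.min d1 d2 by rewrite ltr_pdivrMr // ltr_pMr ?ltr1n // lt_min d10.
have /d1P A1 : 0 < h < d1 by rewrite h0 (lt_le_trans hm) // ge_min lexx.
have /d2P A2 : 0 < h < d2 by rewrite h0 (lt_le_trans hm) // ge_min lexx orbT.
move: A1 A2; rewrite [x + h *: j + h *: i]addrAC.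
move: (f (x + h *: i + h *: j)) (f (x + h *: i)) (f (x + h *: j)) (f x) => a b c k.
move: ('D_j (fun y => 'D_i f y) x) ('D_i (fun y => 'D_j f y) x) => p q A1 A2.
have sub4 : (a - c - b + k - h ^+ 2 * q) - (a - b - c + k - h ^+ 2 * p) = h ^+ 2 * (p - q).
  by ring.
rewrite -(ler_pM2l (exprn_gt0 2 h0)) -{1}(ger0_norm (exprn_ge0 2 (ltW h0))) -normrM.
rewrite -sub4 (le_trans (ler_normB _ _)) // (le_trans (lerD A2 A1)) //.
by rewrite -mulrDl -splitr mulrC.
Qed.

End Schwarz.

Lemma near_eq_differentiable (R : realType) (V W : normedModType R) (f g : V -> W) x :
  (\forall y \near x, f y = g y) -> differentiable f x -> differentiable g x.
Proof.
move=> fg /diff_locallyP[fc fE].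
have fgx : f x = g x := nbhs_singleton fg.
have gE : g \o shift x = cst (g x) + 'd f x +o_ (0 : V) id.
  apply: eqaddoE; apply/eqaddoP => e e0.
  have /eqaddoP /(_ _ e0) fe := eqaddoE fE.
  have nU : \forall y \near (0 : V), f (y + x) = g (y + x).
    have /nbhs_normP[d /= d0 dP] := fg.
    apply/nbhs_normP; exists d => //= y /=; rewrite sub0r => yd; apply: dP => /=.
    by rewrite opprD addrC -addrA addNr addr0.
  near=> y.
  have E : f (y + x) = g (y + x) by near: y.
  suff : `|(f \o shift x - (cst (f x) + 'd f x)) y| <= e * `|id y|.
    by rewrite !fctE /= fgx E.
  by near: y.
have dE := diff_unique fc gE.
by apply/diff_locallyP; rewrite dE.
Unshelve. all: by end_near. Qed.

Section SmoothFunctions.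
Variable R : realType.
Implicit Types (U : set 'rV[R]_4) (f g : 'rV[R]_4 -> R) (x : 'rV[R]_4) (i j : 'I_4).

Lemma near_eq_on U f g x : open U -> U x -> (forall y, U y -> f y = g y) ->
  \forall y \near x, f y = g y.
Proof. by move=> oU Ux fg; apply: filterS (open_nbhs_nbhs (conj oU Ux)). Qed.

Lemma pderive_eq U f g i x : open U -> U x -> (forall y, U y -> f y = g y) ->
  pderive i f x = pderive i g x.
Proof. by move=> oU Ux fg; apply: near_eq_derive; apply: near_eq_on fg. Qed.

Lemma foldr_pderive_eq U f g s x : open U -> U x -> (forall y, U y -> f y = g y) ->
  foldr (@pderive R) f s x = foldr (@pderive R) g s x.
Proof.
move=> oU + fg; elim: s x => [|i s IH] x Ux /=; first exact: fg.
exact: pderive_eq oU Ux _.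
Qed.

Lemma smooth_on_pderive U f i : smooth_on U f -> smooth_on U (pderive i f).
Proof. by move=> sf s x Ux; rewrite -foldr_rcons; exact: sf. Qed.

Lemma smooth_on_eq U f g : open U -> (forall y, U y -> f y = g y) ->
  smooth_on U f -> smooth_on U g.
Proof.
move=> oU fg sf s x Ux; apply: (near_eq_differentiable (near_eq_on oU Ux _) (sf s x Ux)) => y Uy.
exact: foldr_pderive_eq oU Uy fg.
Qed.

Lemma smooth_on_sub U U' f : U' `<=` U -> smooth_on U f -> smooth_on U' f.
Proof. by move=> UU' sf s x /UU'; apply: sf. Qed.

Lemma smooth_on_differentiable U f x : smooth_on U f -> U x -> differentiable f x.
Proof. by move=> /(_ [::] x). Qed.

Lemma smooth_on_cst U (c : R) : smooth_on U (cst c).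
Proof.
have cE i (a : R) : pderive i (cst a) = cst 0.
  by apply/funext => x; rewrite /pderive derive_cst.
move=> s x _; suff [a ->] : exists a : R, foldr (@pderive R) (cst c) s = cst a.
  exact: differentiable_cst.
by elim: s => [|i s [a /= ->]]; [exists c | exists 0; rewrite cE].
Qed.

(* The closure of the smooth functions under the field operations is stable
   under partial derivatives, so that it consists of smooth functions. *)
Inductive smooth_closure U : ('rV[R]_4 -> R) -> Prop :=
| SmoothBase f of smooth_on U f : smooth_closure U f
| SmoothAdd f g of smooth_closure U f & smooth_closure U g :
    smooth_closure U (fun x => f x + g x)
| SmoothMul f g of smooth_closure U f & smooth_closure U g :
    smooth_closure U (fun x => f x * g x)
| SmoothInv f of smooth_closure U f & (forall x, U x -> f x != 0) :
    smooth_closure U (fun x => (f x)^-1).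

Lemma pderiveD f g i x : differentiable f x -> differentiable g x ->
  pderive i (fun y => f y + g y) x = pderive i f x + pderive i g x.
Proof. by move=> df dg; apply: deriveD; apply: diff_derivable. Qed.

Lemma pderiveM f g i x : differentiable f x -> differentiable g x ->
  pderive i (fun y => f y * g y) x = f x * pderive i g x + g x * pderive i f x.
Proof. by move=> df dg; apply: deriveM; apply: diff_derivable. Qed.

Lemma smooth_closure_differentiable U f x : smooth_closure U f -> U x ->
  differentiable f x.
Proof.
move=> + Ux; elim=> {f} [f sf|f g _ df _ dg|f g _ df _ dg|f _ df f0].
- exact: smooth_on_differentiable sf Ux.
- exact: differentiableD.
- exact: differentiableM.
- exact/differentiableV/f0.
Qed.

(** Agreement is claimed on [U] only, since the rule for the derivative of an inverse needs a
    nonzero denominator. *)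
Lemma smooth_closure_pderive U f i : smooth_closure U f ->
  exists2 h, smooth_closure U h & forall x, U x -> pderive i f x = h x.
Proof.
elim=> {f} [f sf|f g sf [f' sf' ff'] sg [g' sg' gg']|f g sf [f' sf' ff'] sg [g' sg' gg']|
    f sf [f' sf' ff'] f0].
- by exists (pderive i f) => //; apply/SmoothBase/smooth_on_pderive.
- exists (fun x => f' x + g' x); first exact: SmoothAdd.
  move=> x Ux; rewrite pderiveD ?ff' ?gg' //; exact: smooth_closure_differentiable Ux.
- exists (fun x => f x * g' x + g x * f' x).
    by apply: SmoothAdd; apply: SmoothMul.
  move=> x Ux; rewrite pderiveM ?ff' ?gg' //; exact: smooth_closure_differentiable Ux.
- exists (fun x => cst (-1) x * ((f x)^-1 * (f x)^-1) * f' x).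
    apply: SmoothMul => //; apply: SmoothMul; first exact/SmoothBase/smooth_on_cst.
    by apply: SmoothMul; apply: SmoothInv.
  move=> x Ux; rewrite /pderive deriveV ?f0 //; last first.
    by apply: diff_derivable; apply: smooth_closure_differentiable Ux.
  rewrite -ff' // /pderive /GRing.scale /=; congr (_ * _).
  by rewrite mulN1r -expr2 exprVn.
Qed.

Lemma smooth_closure_on U f : open U -> smooth_closure U f -> smooth_on U f.
Proof.
(* The last index of [s] is the derivative taken first, so reverse induction leaves a shorter word
   acting on another member of the closure. *)
move=> oU + s; elim/last_ind: s f => [|s i IH] f sf x Ux /=.
  exact: smooth_closure_differentiable Ux.
have [h sh fh] := smooth_closure_pderive i sf.
rewrite foldr_rcons; apply: (near_eq_differentiable (near_eq_on oU Ux _) (IH _ sh x Ux)) => y Uy.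
by apply: foldr_pderive_eq oU Uy _ => z Uz; rewrite fh.
Qed.

Lemma smooth_onD U f g : open U -> smooth_on U f -> smooth_on U g ->
  smooth_on U (fun x => f x + g x).
Proof. by move=> oU sf sg; apply: smooth_closure_on oU (SmoothAdd _ _); apply: SmoothBase. Qed.

Lemma smooth_onM U f g : open U -> smooth_on U f -> smooth_on U g ->
  smooth_on U (fun x => f x * g x).
Proof. by move=> oU sf sg; apply: smooth_closure_on oU (SmoothMul _ _); apply: SmoothBase. Qed.

Lemma smooth_onV U f : open U -> smooth_on U f -> (forall x, U x -> f x != 0) ->
  smooth_on U (fun x => (f x)^-1).
Proof. by move=> oU sf f0; apply: smooth_closure_on oU (SmoothInv _ f0); apply: SmoothBase. Qed.

Lemma pderive_comm U f i j x : open U -> smooth_on U f -> U x ->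
  pderive i (pderive j f) x = pderive j (pderive i f) x.
Proof.
move=> oU sf Ux; apply: (derive_comm oU _ Ux).
- by move=> y; apply: smooth_on_differentiable sf.
- exact: (smooth_on_differentiable (smooth_on_pderive j sf)).
- exact: (smooth_on_differentiable (smooth_on_pderive i sf)).
Qed.

End SmoothFunctions.

(** * The ring of smooth functions on a nonempty open set *)

Record region (R : realType) := Region {
  region_set :> set 'rV[R]_4;
  region_open : open region_set;
  region_point : 'rV[R]_4;
  region_pointP : region_set region_point
}.

(* The functions are extended by 0 outside of U, so that equality on U is
   Leibniz equality. *)
Record smooth_fun (R : realType) (U : region R) := SmoothFun {
  sval_fun :> 'rV[R]_4 -> R;
  sval_smooth : smooth_on U sval_fun;
  sval_out : forall x, ~ region_set U x -> sval_fun x = 0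
}.

Section SmoothRing.
Variables (R : realType) (U : region R).
Local Notation A := (smooth_fun U).
Implicit Types (a b c : A) (f : 'rV[R]_4 -> R) (i j : 'I_4).

HB.instance Definition _ := gen_eqMixin A.
HB.instance Definition _ := gen_choiceMixin A.

Lemma smooth_fun_ext a b : (forall x, region_set U x -> a x = b x) -> a = b.
Proof.
move=> ab; have fab : sval_fun a = sval_fun b.
  apply/funext => x; have [Ux|Ux] := pselect (region_set U x); first exact: ab.
  by rewrite !sval_out.
case: a b fab {ab} => [f sf f0] [g sg g0] /= fg; rewrite -fg in sg g0 *.
by congr SmoothFun; apply: Prop_irrelevance.
Qed.

Definition zero_out f : 'rV[R]_4 -> R := fun x => if `[< region_set U x >] then f x else 0.

Lemma zero_outE f x : region_set U x -> zero_out f x = f x.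
Proof. by rewrite /zero_out => /asboolT ->. Qed.

Lemma zero_out_smooth f : smooth_on U f -> smooth_on U (zero_out f).
Proof.
by move=> sf; apply: (smooth_on_eq (@region_open _ U) _ sf) => x Ux; rewrite zero_outE.
Qed.

Lemma zero_out_out f x : ~ region_set U x -> zero_out f x = 0.
Proof. by rewrite /zero_out; case: asboolP. Qed.

Definition smf f (sf : smooth_on U f) : A :=
  SmoothFun (zero_out_smooth sf) (@zero_out_out f).

Lemma smfE f (sf : smooth_on U f) x : region_set U x -> smf sf x = f x.
Proof. exact: zero_outE. Qed.

Definition smf_cst (k : R) : A := smf (@smooth_on_cst R U k).
Definition smf_add a b : A :=
  smf (smooth_onD (@region_open _ U) (@sval_smooth _ _ a) (@sval_smooth _ _ b)).
Definition smf_mul a b : A :=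
  smf (smooth_onM (@region_open _ U) (@sval_smooth _ _ a) (@sval_smooth _ _ b)).
Definition smf_opp a : A := smf_mul (smf_cst (-1)) a.

Lemma smf_cstE k x : region_set U x -> smf_cst k x = k. Proof. exact: smfE. Qed.
Lemma smf_addE a b x : region_set U x -> smf_add a b x = a x + b x. Proof. exact: smfE. Qed.
Lemma smf_mulE a b x : region_set U x -> smf_mul a b x = a x * b x. Proof. exact: smfE. Qed.
Lemma smf_oppE a x : region_set U x -> smf_opp a x = - a x.
Proof. by move=> Ux; rewrite smf_mulE // smf_cstE // mulN1r. Qed.

Let smf_addA : associative smf_add.
Proof. by move=> a b c; apply: smooth_fun_ext => x Ux; rewrite !smf_addE // addrA. Qed.
Let smf_addC : commutative smf_add.
Proof. by move=> a b; apply: smooth_fun_ext => x Ux; rewrite !smf_addE // addrC. Qed.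
Let smf_add0 : left_id (smf_cst 0) smf_add.
Proof. by move=> a; apply: smooth_fun_ext => x Ux; rewrite smf_addE // smf_cstE // add0r. Qed.
Let smf_addN : left_inverse (smf_cst 0) smf_opp smf_add.
Proof.
by move=> a; apply: smooth_fun_ext => x Ux; rewrite smf_addE // smf_oppE // smf_cstE // addNr.
Qed.

HB.instance Definition _ := GRing.isZmodule.Build A smf_addA smf_addC smf_add0 smf_addN.

Let smf_mulA : associative smf_mul.
Proof. by move=> a b c; apply: smooth_fun_ext => x Ux; rewrite !smf_mulE // mulrA. Qed.
Let smf_mulC : commutative smf_mul.
Proof. by move=> a b; apply: smooth_fun_ext => x Ux; rewrite !smf_mulE // mulrC. Qed.
Let smf_mul1 : left_id (smf_cst 1) smf_mul.
Proof. by move=> a; apply: smooth_fun_ext => x Ux; rewrite smf_mulE // smf_cstE // mul1r. Qed.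
Let smf_mulDl : left_distributive smf_mul smf_add.
Proof.
by move=> a b c; apply: smooth_fun_ext => x Ux; rewrite !(smf_mulE, smf_addE) // mulrDl.
Qed.
(** The marked point of a region serves this purpose: over the empty set the ring would be zero. *)
Let smf_oner_neq0 : smf_cst 1 != 0.
Proof.
apply/eqP => /(congr1 (fun a : A => a (region_point U))).
rewrite !smf_cstE; try exact: region_pointP.
by move/eqP; rewrite oner_eq0.
Qed.

HB.instance Definition _ := GRing.Zmodule_isComNzRing.Build A
  smf_mulA smf_mulC smf_mul1 smf_mulDl smf_oner_neq0.

Lemma smooth_funD a b x : region_set U x -> (a + b) x = a x + b x. Proof. exact: smf_addE. Qed.
Lemma smooth_funM a b x : region_set U x -> (a * b) x = a x * b x. Proof. exact: smf_mulE. Qed.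
Lemma smooth_funN a x : region_set U x -> (- a) x = - a x. Proof. exact: smf_oppE. Qed.
Lemma smooth_fun0 x : region_set U x -> (0 : A) x = 0. Proof. exact: smf_cstE. Qed.
Lemma smooth_fun1 x : region_set U x -> (1 : A) x = 1. Proof. exact: smf_cstE. Qed.
Lemma smooth_fun_sum (I : finType) (F : I -> A) x : region_set U x ->
  (\sum_i F i) x = \sum_i F i x.
Proof.
move=> Ux; apply: (big_morph (fun a : A => a x)) => [a b|]; first exact: smooth_funD.
exact: smooth_fun0.
Qed.

Definition smf_d i a : A := smf (smooth_on_pderive i (@sval_smooth _ _ a)).

Lemma smf_dE i a x : region_set U x -> smf_d i a x = pderive i a x. Proof. exact: smfE. Qed.

Let diffA a x : region_set U x -> differentiable a x.
Proof. exact: smooth_on_differentiable (@sval_smooth _ _ a). Qed.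

Lemma smf_dD i : {morph smf_d i : a b / a + b}.
Proof.
move=> a b; apply: smooth_fun_ext => x Ux.
rewrite smf_dE // smooth_funD // !smf_dE // -pderiveD; try exact: diffA.
by apply: pderive_eq (@region_open _ U) Ux _ => y; apply: smooth_funD.
Qed.

Lemma smf_dM i a b : smf_d i (a * b) = smf_d i a * b + a * smf_d i b.
Proof.
apply: smooth_fun_ext => x Ux.
rewrite smf_dE // smooth_funD // !smooth_funM // !smf_dE // addrC [pderive i a x * _]mulrC.
rewrite -pderiveM; try exact: diffA.
by apply: pderive_eq (@region_open _ U) Ux _ => y; apply: smooth_funM.
Qed.

Lemma smf_d_comm i j a : smf_d i (smf_d j a) = smf_d j (smf_d i a).
Proof.
have E k l x : region_set U x -> smf_d k (smf_d l a) x = pderive k (pderive l a) x.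
  move=> Ux; rewrite (smf_dE k (smf_d l a) Ux).
  by apply: pderive_eq (@region_open _ U) Ux _ => y; exact: smf_dE.
apply: smooth_fun_ext => x Ux.
apply: (etrans (E i j x Ux)); apply: esym; apply: (etrans (E j i x Ux)).
exact: pderive_comm (@region_open _ U) (@sval_smooth _ _ a) Ux.
Qed.

Lemma smooth_fun_inv a : (forall x, region_set U x -> a x != 0) -> exists b, b * a = 1.
Proof.
move=> a0.
pose sb := smooth_onV (@region_open _ U) (@sval_smooth _ _ a) a0.
exists (smf sb); apply: smooth_fun_ext => x Ux.
have bE : smf sb x = (a x)^-1 by exact: smfE.
by rewrite smooth_funM // bE mulVf ?a0 // smooth_fun1.
Qed.

End SmoothRing.

(** * Tensor calculus over a ring with commuting derivations *)

Record derivations (A : comNzRingType) := Derivations {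
  der :> 'I_4 -> A -> A;
  derD : forall i, {morph der i : a b / a + b};
  derM : forall i a b, der i (a * b) = der i a * b + a * der i b;
  derC : forall i j a, der i (der j a) = der j (der i a)
}.

Section DifferentialRing.
Variables (A : comNzRingType) (d : derivations A).
Local Notation dD := (derD d).
Local Notation dM := (derM d).
Local Notation dC := (derC d).

Local Notation vec := 'rV[A]_4.
Implicit Types (X Y Z V W : vec) (a b c f : A) (i j k l m p : 'I_4).

Lemma rvecD X Y k : (X + Y) 0 k = X 0 k + Y 0 k. Proof. by rewrite mxE. Qed.
Lemma rvecN X k : (- X) 0 k = - X 0 k. Proof. by rewrite mxE. Qed.
Lemma rvecZ a X k : (a *: X) 0 k = a * X 0 k. Proof. by rewrite mxE. Qed.
Definition rvecE := (rvecD, rvecN, rvecZ).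

Definition tlinear (h : vec -> A) : Prop :=
  {morph h : X Y / X + Y} /\ forall a X, h (a *: X) = a * h X.

(** The tensoriality principle. Once both sides are linear over the functions, a slot may be filled
    with a coordinate vector, whose components are constant and whose brackets with the other
    coordinate vectors vanish. The passage from component formulas to invariant ones below applies
    this once per slot. *)
Lemma tlinear_eq (h h' : vec -> A) : tlinear h -> tlinear h' ->
  (forall i, h (delta_mx 0 i) = h' (delta_mx 0 i)) -> forall X, h X = h' X.
Proof.
move=> [hD hZ] [hD' hZ'] E X.
have sumE (u : vec -> A) : {morph u : X Y / X + Y} -> (forall a X, u (a *: X) = a * u X) ->
    u X = \sum_i X 0 i * u (delta_mx 0 i).
  move=> uD uZ; have u0 : u 0 = 0 by rewrite -(scale0r 0) uZ mul0r.
  rewrite [in LHS](row_sum_delta X) (big_morph u uD u0).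
  by apply: eq_bigr => i _; rewrite uZ.
rewrite (sumE h) // (sumE h') //; apply: eq_bigr => i _; by rewrite E.
Qed.

Lemma tlinear_contraction (c : 'I_4 -> A) : tlinear (fun X => \sum_i X 0 i * c i).
Proof.
split=> [X Y|a X]; first by rewrite -big_split; apply: eq_bigr => i _; rewrite mxE mulrDl.
by rewrite mulr_sumr; apply: eq_bigr => i _; rewrite mxE mulrA.
Qed.

Lemma contraction_delta (c : 'I_4 -> A) i : \sum_j (delta_mx 0 i : vec) 0 j * c j = c i.
Proof.
rewrite (bigD1 i) //= big1 => [|j /negPf ji]; rewrite mxE eqxx /= ?eqxx ?mul1r ?addr0 //.
by rewrite ji mul0r.
Qed.

Lemma der0 i : d i 0 = 0.
Proof. by apply: (@addrI _ (d i 0)); rewrite -dD !addr0. Qed.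
Lemma der1 i : d i 1 = 0.
Proof. by apply: (@addrI _ (d i 1)); rewrite -{3}[1]mulr1 dM mulr1 mul1r addr0. Qed.
Lemma derN i a : d i (- a) = - d i a.
Proof. by apply: (@addrI _ (d i a)); rewrite -dD !subrr der0. Qed.

Definition Der X a : A := \sum_i X 0 i * d i a.

Lemma DerD X a b : Der X (a + b) = Der X a + Der X b.
Proof. by rewrite -big_split; apply: eq_bigr => i _; rewrite dD mulrDr. Qed.
Lemma DerM X a b : Der X (a * b) = Der X a * b + a * Der X b.
Proof.
rewrite mulr_suml mulr_sumr -big_split; apply: eq_bigr => i _; rewrite dM /=; ring.
Qed.
Lemma Der0 X : Der X 0 = 0.
Proof. by apply: big1 => i _; rewrite der0 mulr0. Qed.
Lemma Der1 X : Der X 1 = 0.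
Proof. by apply: big1 => i _; rewrite der1 mulr0. Qed.
Lemma DerN X a : Der X (- a) = - Der X a.
Proof. by apply: (@addrI _ (Der X a)); rewrite -DerD !subrr Der0. Qed.
Lemma Der_sum (I : finType) (F : I -> A) X : Der X (\sum_j F j) = \sum_j Der X (F j).
Proof. exact: (big_morph _ (DerD X) (Der0 X)). Qed.
Lemma tlinear_Der a : tlinear (fun X => Der X a).
Proof. exact: tlinear_contraction. Qed.
Lemma DerDl X Y a : Der (X + Y) a = Der X a + Der Y a.
Proof. exact: (tlinear_Der a).1. Qed.
Lemma DerZl X b a : Der (b *: X) a = b * Der X a.
Proof. exact: (tlinear_Der a).2. Qed.
Lemma Der_delta i a : Der (delta_mx 0 i) a = d i a.
Proof. exact: contraction_delta. Qed.

Definition brk X Y : vec := \row_k (Der X (Y 0 k) - Der Y (X 0 k)).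

Lemma Der_brk X Y a : Der (brk X Y) a = Der X (Der Y a) - Der Y (Der X a).
Proof.
have E V W : Der V (Der W a) =
    \sum_i Der V (W 0 i) * d i a + \sum_i \sum_j V 0 i * W 0 j * d i (d j a).
  rewrite {2}/Der Der_sum; under eq_bigr do rewrite DerM.
  rewrite big_split /=; congr (_ + _).
  rewrite exchange_big; apply: eq_bigr => i _; rewrite mulr_sumr.
  by apply: eq_bigr => j _; rewrite mulrCA mulrA [V 0 j * _]mulrC.
rewrite !E opprD addrACA [X in _ + (_ - X)]exchange_big -!sumrB.
rewrite [X in _ + X]big1 ?addr0 => [|i _].
  by apply: eq_bigr => i _; rewrite mxE mulrBl.
by rewrite -sumrB big1 // => j _; rewrite dC [Y 0 j * _]mulrC subrr.
Qed.

Lemma brkC X Y : brk X Y = - brk Y X.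
Proof. by apply/rowP => k; rewrite !mxE opprB. Qed.
Lemma brkDr X Y Z : brk X (Y + Z) = brk X Y + brk X Z.
Proof. by apply/rowP => k; rewrite !mxE DerD DerDl; ring. Qed.
Lemma brkZr X Y a : brk X (a *: Y) = Der X a *: Y + a *: brk X Y.
Proof. by apply/rowP => k; rewrite !mxE DerM DerZl; ring. Qed.
Lemma brkDl X Y Z : brk (X + Y) Z = brk X Z + brk Y Z.
Proof. by apply/rowP => k; rewrite !mxE DerD DerDl; ring. Qed.
Lemma brkZl X Y a : brk (a *: X) Y = - Der Y a *: X + a *: brk X Y.
Proof. by apply/rowP => k; rewrite !mxE DerM DerZl; ring. Qed.
Lemma brk0r X : brk X 0 = 0.
Proof. by apply/rowP => k; rewrite !mxE Der0 -(scale0r 0) DerZl; ring. Qed.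
Lemma brk_delta i j : brk (delta_mx 0 i) (delta_mx 0 j) = 0.
Proof.
apply/rowP => k; rewrite !mxE !Der_delta.
by case: (_ && _); case: (_ && _); rewrite /= ?der0 ?der1 subrr.
Qed.

Lemma jacobi X Y Z : brk X (brk Y Z) + brk Y (brk Z X) + brk Z (brk X Y) = 0.
Proof.
apply/rowP => k; rewrite !mxE !Der_brk !DerD !DerN; ring.
Qed.

Definition bil (B : 'M[A]_4) X Y : A := \sum_i \sum_j B i j * X 0 i * Y 0 j.

Lemma tlinear_bill B Y : tlinear (bil B ^~ Y).
Proof.
have [hD hZ] := tlinear_contraction (fun i => \sum_j B i j * Y 0 j).
have E X : bil B X Y = \sum_i X 0 i * (\sum_j B i j * Y 0 j).
  apply: eq_bigr => i _; rewrite mulr_sumr; apply: eq_bigr => j _; ring.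
by split=> [X X'|a X]; rewrite !E.
Qed.

Lemma bil_tr (B : 'M[A]_4) X Y : bil B^T X Y = bil B Y X.
Proof.
rewrite /bil exchange_big; apply: eq_bigr => i _; apply: eq_bigr => j _.
by rewrite mxE mulrAC.
Qed.

Lemma tlinear_bilr B X : tlinear (bil B X).
Proof.
have [hD hZ] := tlinear_bill B^T X.
by split=> [Y Y'|a Y]; rewrite -!(bil_tr B).
Qed.

Lemma bilDl B X Y Z : bil B (X + Y) Z = bil B X Z + bil B Y Z.
Proof. exact: (tlinear_bill B Z).1. Qed.
Lemma bilZl B a X Z : bil B (a *: X) Z = a * bil B X Z.
Proof. exact: (tlinear_bill B Z).2. Qed.
Lemma bilDr B X Y Z : bil B Z (X + Y) = bil B Z X + bil B Z Y.
Proof. exact: (tlinear_bilr B Z).1. Qed.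
Lemma bilZr B a X Z : bil B Z (a *: X) = a * bil B Z X.
Proof. exact: (tlinear_bilr B Z).2. Qed.
Lemma bilNl B X Z : bil B (- X) Z = - bil B X Z.
Proof. by rewrite -scaleN1r bilZl mulN1r. Qed.
Lemma bilNr B X Z : bil B Z (- X) = - bil B Z X.
Proof. by rewrite -scaleN1r bilZr mulN1r. Qed.
Lemma bil_delta B i j : bil B (delta_mx 0 i) (delta_mx 0 j) = B i j.
Proof.
rewrite -[RHS](contraction_delta (fun i => B i j)); apply: eq_bigr => k _.
rewrite -(contraction_delta (B k) j) mulr_sumr; apply: eq_bigr => l _; ring.
Qed.

Lemma bil_mul B X Y : bil B X Y = (X *m B *m Y^T) 0 0.
Proof.
rewrite /bil exchange_big mxE; apply: eq_bigr => j _; rewrite !mxE mulr_suml.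
by apply: eq_bigr => i _; rewrite [X 0 i * _]mulrC.
Qed.

Lemma bil_mxN B X Y : bil (- B) X Y = - bil B X Y.
Proof. by rewrite !bil_mul mulmxN mulNmx mxE. Qed.

Notation tensor4 := ('I_4 -> 'I_4 -> 'I_4 -> 'I_4 -> A).

Definition ten4 (T : tensor4) X Y Z W : A :=
  \sum_i \sum_j \sum_k \sum_l T i j k l * X 0 i * Y 0 j * Z 0 k * W 0 l.

(** Rotating the slots transfers linearity from the first one to the other three. *)
Lemma ten4_rot T X Y Z W : ten4 T X Y Z W = ten4 (fun i j k l => T l i j k) Y Z W X.
Proof.
rewrite /ten4 exchange_big; apply: eq_bigr => j _; rewrite exchange_big; apply: eq_bigr => k _.
rewrite exchange_big; apply: eq_bigr => l _; apply: eq_bigr => i _; ring.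
Qed.

Lemma tlinear_ten41 T Y Z W : tlinear (fun X => ten4 T X Y Z W).
Proof.
pose c i := \sum_j \sum_k \sum_l T i j k l * Y 0 j * Z 0 k * W 0 l.
have [hD hZ] := tlinear_contraction c.
have E X : ten4 T X Y Z W = \sum_i X 0 i * c i.
  apply: eq_bigr => i _; rewrite mulr_sumr; apply: eq_bigr => j _.
  rewrite mulr_sumr; apply: eq_bigr => k _; rewrite mulr_sumr; apply: eq_bigr => l _; ring.
by split=> [X X'|a X]; rewrite !E.
Qed.
Lemma tlinear_ten42 T X Z W : tlinear (fun Y => ten4 T X Y Z W).
Proof.
have [hD hZ] := tlinear_ten41 (fun i j k l => T l i j k) Z W X.
by split=> [Y Y'|a Y]; rewrite !(ten4_rot T).
Qed.
Lemma tlinear_ten43 T X Y W : tlinear (fun Z => ten4 T X Y Z W).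
Proof.
have [hD hZ] := tlinear_ten42 (fun i j k l => T l i j k) Y W X.
by split=> [Z Z'|a Z]; rewrite !(ten4_rot T).
Qed.
Lemma tlinear_ten44 T X Y Z : tlinear (fun W => ten4 T X Y Z W).
Proof.
have [hD hZ] := tlinear_ten43 (fun i j k l => T l i j k) Y Z X.
by split=> [W W'|a W]; rewrite !(ten4_rot T).
Qed.

Lemma ten4D1 T X X' Y Z W : ten4 T (X + X') Y Z W = ten4 T X Y Z W + ten4 T X' Y Z W.
Proof. exact: (tlinear_ten41 T Y Z W).1. Qed.
Lemma ten4D2 T X X' Y Z W : ten4 T Y (X + X') Z W = ten4 T Y X Z W + ten4 T Y X' Z W.
Proof. exact: (tlinear_ten42 T Y Z W).1. Qed.
Lemma ten4D3 T X X' Y Z W : ten4 T Y Z (X + X') W = ten4 T Y Z X W + ten4 T Y Z X' W.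
Proof. exact: (tlinear_ten43 T Y Z W).1. Qed.
Lemma ten4D4 T X X' Y Z W : ten4 T Y Z W (X + X') = ten4 T Y Z W X + ten4 T Y Z W X'.
Proof. exact: (tlinear_ten44 T Y Z W).1. Qed.
Lemma ten4Z1 T a X Y Z W : ten4 T (a *: X) Y Z W = a * ten4 T X Y Z W.
Proof. exact: (tlinear_ten41 T Y Z W).2. Qed.
Lemma ten4Z2 T a X Y Z W : ten4 T Y (a *: X) Z W = a * ten4 T Y X Z W.
Proof. exact: (tlinear_ten42 T Y Z W).2. Qed.
Lemma ten4Z3 T a X Y Z W : ten4 T Y Z (a *: X) W = a * ten4 T Y Z X W.
Proof. exact: (tlinear_ten43 T Y Z W).2. Qed.
Lemma ten4Z4 T a X Y Z W : ten4 T Y Z W (a *: X) = a * ten4 T Y Z W X.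
Proof. exact: (tlinear_ten44 T Y Z W).2. Qed.
Definition ten4E := (ten4D1, ten4D2, ten4D3, ten4D4, ten4Z1, ten4Z2, ten4Z3, ten4Z4).

Lemma ten4_delta T i j k l :
  ten4 T (delta_mx 0 i) (delta_mx 0 j) (delta_mx 0 k) (delta_mx 0 l) = T i j k l.
Proof.
rewrite -[RHS](contraction_delta (fun i => T i j k l)); apply: eq_bigr => i' _.
rewrite -(contraction_delta (fun j => T i' j k l)) mulr_sumr; apply: eq_bigr => j' _.
rewrite -(contraction_delta (fun k => T i' j' k l)) !mulr_sumr; apply: eq_bigr => k' _.
rewrite -(contraction_delta (T i' j' k')) !mulr_sumr; apply: eq_bigr => l' _; ring.
Qed.

Section Connection.
Variable Gam : 'I_4 -> 'I_4 -> 'I_4 -> A.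

Definition cov X Y : vec :=
  \row_k (Der X (Y 0 k) + \sum_i \sum_j Gam k i j * X 0 i * Y 0 j).

Lemma covE X Y k : cov X Y 0 k = Der X (Y 0 k) + bil (\matrix_(i, j) Gam k i j) X Y.
Proof.
rewrite mxE; congr (_ + _); apply: eq_bigr => i _; apply: eq_bigr => j _.
by rewrite mxE.
Qed.

Lemma covDl X Y Z : cov (X + Y) Z = cov X Z + cov Y Z.
Proof. by apply/rowP => k; rewrite [RHS]mxE !covE DerDl bilDl addrACA. Qed.
Lemma covZl a X Z : cov (a *: X) Z = a *: cov X Z.
Proof. by apply/rowP => k; rewrite [RHS]mxE !covE DerZl bilZl mulrDr. Qed.
Lemma covNl X Z : cov (- X) Z = - cov X Z.
Proof. by rewrite -!scaleN1r covZl. Qed.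
Lemma covDr X Y Z : cov Z (X + Y) = cov Z X + cov Z Y.
Proof. by apply/rowP => k; rewrite [RHS]mxE !covE mxE DerD bilDr addrACA. Qed.
Lemma covZr a X Z : cov Z (a *: X) = Der Z a *: X + a *: cov Z X.
Proof.
apply/rowP => k; rewrite covE [RHS]mxE [X in _ = X + _]mxE [X in _ = _ + X]mxE covE.
by rewrite mxE DerM bilZr; ring.
Qed.

Hypothesis GamC : forall k i j, Gam k i j = Gam k j i.

Lemma cov_torsion X Y : cov X Y - cov Y X = brk X Y.
Proof.
apply/rowP => k; rewrite [RHS]mxE mxE [X in _ + X]mxE !covE -(bil_tr _ X Y).
have -> : (\matrix_(i, j) Gam k i j)^T = \matrix_(i, j) Gam k i j.
  by apply/matrixP => i j; rewrite !mxE.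
ring.
Qed.

Definition curvature X Y Z : vec := cov X (cov Y Z) - cov Y (cov X Z) - cov (brk X Y) Z.

(** The Jacobi identity, with every bracket expanded by vanishing torsion. *)
Lemma curv_bianchi X Y Z : curvature X Y Z + curvature Y Z X + curvature Z X Y = 0.
Proof.
have covB V W W' : cov V (brk W W') = cov V (cov W W') - cov V (cov W' W).
  by rewrite -cov_torsion covDr -!scaleN1r covZr DerN Der1 oppr0 scale0r add0r.
have E V W W' : brk V (brk W W') = cov V (cov W W') - cov V (cov W' W) - cov (brk W W') V.
  by rewrite -cov_torsion covB.
rewrite -(jacobi X Y Z) !E /curvature.
by apply/rowP => k; rewrite !rvecE; ring.
Qed.

End Connection.
End DifferentialRing.

(** The inverse metric and one half are carried as data because [A] need not contain inverses;
    [half] also lets [a + a = 0] be cancelled. *)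
Record metric_data (A : comNzRingType) := MetricData {
  gm : 'M[A]_4;
  gi : 'M[A]_4;
  half : A;
  gmT : gm^T = gm;
  giK : gi *m gm = 1%:M;
  half2 : half + half = 1
}.

(** * The Levi-Civita connection and the symmetries of its curvature *)

Section LeviCivita.
Variables (A : comNzRingType) (d : derivations A) (G : metric_data A).
Local Notation vec := 'rV[A]_4.
Local Notation g := (gm G).
Local Notation ginv := (gi G).
Local Notation h := (half G).
Implicit Types (X Y Z V W : vec) (a b c f : A) (i j k l m p : 'I_4).

Definition chr k i j : A :=
  h * \sum_l ginv k l * (d i (g j l) + d j (g i l) - d l (g i j)).

Local Notation cov := (cov d chr).
Local Notation curv := (curvature d chr).
Local Notation Der := (Der d).
Local Notation brk := (brk d).
Local Notation ip := (bil g).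

Lemma halfK a : a + a = 0 -> a = 0.
Proof. by move=> aa; rewrite -[a]mul1r -(half2 G) mulrDl -mulrDr aa mulr0. Qed.

Lemma half_double a : h * (a + a) = a.
Proof. by rewrite mulrDr -mulrDl half2 mul1r. Qed.

Lemma gmC i j : g i j = g j i.
Proof. by rewrite -[in LHS](gmT G) mxE. Qed.

Lemma gmK : g *m ginv = 1%:M. Proof. exact: mulmx1C (giK G). Qed.

Lemma giT : ginv^T = ginv.
Proof.
by rewrite -[LHS]mulmx1 -gmK mulmxA -{1}(gmT G) -trmx_mul gmK trmx1 mul1mx.
Qed.

Lemma giC i j : ginv i j = ginv j i.
Proof. by rewrite -[in LHS]giT mxE. Qed.

Lemma ipC X Y : ip X Y = ip Y X.
Proof. by rewrite -[in LHS](gmT G) bil_tr. Qed.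

Lemma chrC k i j : chr k i j = chr k j i.
Proof.
congr (_ * _); apply: eq_bigr => l _; rewrite [g j i]gmC; congr (_ * _); ring.
Qed.

Lemma chr_lower m i j :
  \sum_k g m k * chr k i j = h * (d i (g j m) + d j (g i m) - d m (g i j)).
Proof.
pose u l := d i (g j l) + d j (g i l) - d l (g i j).
transitivity (\sum_k \sum_l h * (g m k * ginv k l * u l)).
  by apply: eq_bigr => k _; rewrite /chr !mulr_sumr; apply: eq_bigr => l _; rewrite /u; ring.
rewrite exchange_big -/(u m).
transitivity (\sum_l (g *m ginv) m l * (h * u l)).
  apply: eq_bigr => l _; rewrite mxE mulr_suml; apply: eq_bigr => k _; ring.
rewrite gmK (bigD1 m) //= mxE eqxx mul1r big1 ?addr0 // => l /negPf lm.
by rewrite mxE eq_sym lm mul0r.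
Qed.

Lemma d_metric k i j :
  d k (g i j) = \sum_m g i m * chr m k j + \sum_m g j m * chr m k i.
Proof.
rewrite !chr_lower [g j i]gmC -mulrDr -[LHS]half_double.
congr (_ * _); ring.
Qed.

Lemma cov_delta i j k : cov (delta_mx 0 i) (delta_mx 0 j) 0 k = chr k i j.
Proof.
rewrite covE bil_delta !mxE Der_delta; case: (_ && _); rewrite /= ?der0 ?der1 add0r //.
Qed.

Lemma Der_ip Z X Y : Der Z (ip X Y) = ip (cov Z X) Y + ip X (cov Z Y).
Proof.
apply/eqP; rewrite eq_sym -subr_eq0; apply/eqP.
move: Z; apply: tlinear_eq; [split=> [Z Z'|a Z]|split=> [Z Z'|a Z]; ring|].
- by rewrite !(covDl, bilDl, bilDr, DerDl); ring.
- by rewrite !(covZl, bilZl, bilZr, DerZl); ring.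
move=> k; move: X; apply: tlinear_eq; [split=> [X X'|a X]|split=> [X X'|a X]; ring|].
- by rewrite !(covDr, bilDl, bilDr, DerD); ring.
- by rewrite !(covZr, bilDl, bilZl, bilDr, bilZr, DerD, DerM); ring.
move=> i; move: Y; apply: tlinear_eq; [split=> [X X'|a X]|split=> [X X'|a X]; ring|].
- by rewrite !(covDr, bilDl, bilDr, DerD); ring.
- by rewrite !(covZr, bilDl, bilZl, bilDr, bilZr, DerD, DerM); ring.
move=> j.
have E (i' j' : 'I_4) : ip (delta_mx 0 i') (cov (delta_mx 0 k) (delta_mx 0 j')) =
    \sum_m g i' m * chr m k j'.
  transitivity (\sum_i0 (delta_mx 0 i' : vec) 0 i0 * \sum_m g i0 m * chr m k j').
    apply: eq_bigr => i0 _; rewrite mulr_sumr; apply: eq_bigr => m _.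
    rewrite cov_delta; ring.
  exact: contraction_delta.
rewrite ipC !E bil_delta Der_delta d_metric; ring.
Qed.

Definition rie_up i j k l : A :=
  d k (chr i l j) - d l (chr i k j)
  + \sum_m (chr i k m * chr m l j - chr i l m * chr m k j).

Definition rie i j k l : A := \sum_m g i m * rie_up m j k l.

Lemma curv_delta k l j i :
  curv (delta_mx 0 k) (delta_mx 0 l) (delta_mx 0 j) 0 i = rie_up i j k l.
Proof.
have D u v w : cov (delta_mx 0 u) (cov (delta_mx 0 v) (delta_mx 0 w)) 0 i =
    d u (chr i v w) + \sum_m chr i u m * chr m v w.
  rewrite covE Der_delta cov_delta; congr (_ + _).
  transitivity (\sum_i0 (delta_mx 0 u : vec) 0 i0 * \sum_m chr i i0 m * chr m v w).
    apply: eq_bigr => i0 _; rewrite mulr_sumr; apply: eq_bigr => m _.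
    rewrite cov_delta mxE; ring.
  exact: contraction_delta.
have cov0l V : cov 0 V = 0 by have := covZl d chr 0 0 V; rewrite !scale0r.
rewrite /curvature brk_delta cov0l subr0 mxE D mxE D /rie_up sumrB; ring.
Qed.

Lemma curvC X Y Z : curv X Y Z = - curv Y X Z.
Proof. by apply/rowP => k; rewrite /curvature (brkC d X Y) covNl !rvecE; ring. Qed.

Lemma curvDl X X' Y Z : curv (X + X') Y Z = curv X Y Z + curv X' Y Z.
Proof.
apply/rowP => k; rewrite /curvature brkDl !(covDl, covDr).
by rewrite !rvecE; ring.
Qed.

Lemma curvZl a X Y Z : curv (a *: X) Y Z = a *: curv X Y Z.
Proof.
apply/rowP => k; rewrite /curvature brkZl !(covDl, covZl, covZr).
by rewrite !rvecE; ring.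
Qed.

Lemma curvDr X Y Z Z' : curv X Y (Z + Z') = curv X Y Z + curv X Y Z'.
Proof.
apply/rowP => k; rewrite /curvature !(covDl, covDr).
by rewrite !rvecE; ring.
Qed.

Lemma curvZr a X Y Z : curv X Y (a *: Z) = a *: curv X Y Z.
Proof.
apply/rowP => k; rewrite /curvature !(covDr, covZr) Der_brk.
by rewrite !rvecE; ring.
Qed.

(** Ties the component formula to the curvature operator, for which the symmetries follow from
    metric compatibility and vanishing torsion. *)
Lemma rie_curv W Z X Y : ten4 rie W Z X Y = ip W (curv X Y Z).
Proof.
have tl (u : vec -> vec) V : (forall X Y, u (X + Y) = u X + u Y) ->
    (forall a X, u (a *: X) = a *: u X) -> tlinear (fun X => ip V (u X)).
  by move=> uD uZ; split=> [X1 X2|a X1]; rewrite ?uD ?uZ ?bilDr ?bilZr.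
move: W; apply: tlinear_eq; [exact: tlinear_ten41 | exact: tlinear_bill | move=> i].
move: Z; apply: tlinear_eq; [exact: tlinear_ten42 | | move=> j].
  by apply: tl => *; rewrite ?curvDr ?curvZr.
move: X; apply: tlinear_eq; [exact: tlinear_ten43 | | move=> k].
  by apply: tl => *; rewrite ?curvDl ?curvZl.
move: Y; apply: tlinear_eq; [exact: tlinear_ten44 | | move=> l].
  apply: tl => *; first by rewrite curvC curvDl opprD -!curvC.
  by rewrite curvC curvZl -scalerN -curvC.
rewrite ten4_delta.
transitivity (\sum_i0 (delta_mx 0 i : vec) 0 i0 * \sum_m g i0 m * rie_up m j k l).
  by rewrite contraction_delta.
apply: eq_bigr => i0 _; rewrite mulr_sumr; apply: eq_bigr => m _.
rewrite curv_delta; ring.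
Qed.

Local Notation Rm := (ten4 rie).

Lemma rie_skew34 W Z X Y : Rm W Z X Y = - Rm W Z Y X.
Proof. by rewrite !rie_curv curvC bilNr. Qed.

Lemma rie_skew12 W Z X Y : Rm W Z X Y = - Rm Z W X Y.
Proof.
have E := Der_brk d X Y (ip W Z); rewrite !Der_ip !DerD !Der_ip in E.
rewrite !rie_curv /curvature !(bilDr, bilNr) [ip Z (cov X _)]ipC [ip Z (cov Y _)]ipC.
rewrite [ip Z (cov (brk _ _) _)]ipC; apply/eqP; rewrite -subr_eq0; apply/eqP.
by move/eqP: E; rewrite -subr_eq0 => /eqP E; rewrite -[RHS]oppr0 -E; ring.
Qed.

Lemma rie_cyclic W Z X Y : Rm W Z X Y + Rm W X Y Z + Rm W Y Z X = 0.
Proof.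
rewrite !rie_curv -!bilDr.
have -> : curv X Y Z + curv Y Z X + curv Z X Y = 0 by apply: curv_bianchi chrC _ _ _.
by have := bilZr g 0 0 W; rewrite scale0r mul0r.
Qed.

(** The octahedron argument: four cyclic identities, combined through the two skew symmetries, add
    up to twice the claim. *)
Lemma rie_pair W Z X Y : Rm W Z X Y = Rm X Y W Z.
Proof.
apply/eqP; rewrite -subr_eq0; apply/eqP/halfK.
have e1 := rie_cyclic W Z X Y; have e2 := rie_cyclic Z X Y W.
have e3 := rie_cyclic X Y W Z; have e4 := rie_cyclic Y W Z X.
rewrite (rie_skew34 Z X) (rie_skew12 Z W) in e2.
rewrite (rie_skew34 X W) (rie_skew12 X Z) (rie_skew12 X W) in e3.
rewrite (rie_skew34 Y Z X) (rie_skew12 Y W) (rie_skew12 Y Z) (rie_skew12 Y X) in e4.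
rewrite (rie_skew34 Z X Y) in e3.
move: e1 e2 e3 e4; move: (Rm W Z X Y) (Rm W X Y Z) (Rm W Y Z X) => a p q.
move: (Rm Z X W Y) (Rm Z Y W X) (Rm X Y W Z) => r s c e1 e2 e3 e4.
transitivity ((a + p + q) - (- r + s - a) - (c - - p - - r) + (- q - - s - c)); first by ring.
by rewrite e1 e2 e3 e4; ring.
Qed.

(** The Leibniz rule hidden in the component formula; it allows divergences to be computed in a
    frame that is not a coordinate frame. *)
Lemma nab_ten4 (T : 'I_4 -> 'I_4 -> 'I_4 -> 'I_4 -> A) V X Y Z W :
  \sum_p V 0 p * ten4 (fun i j k l => d p (T i j k l)
   - \sum_m (chr m p i * T m j k l + chr m p j * T i m k l
            + chr m p k * T i j m l + chr m p l * T i j k m)) X Y Z W =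
  Der V (ten4 T X Y Z W) - ten4 T (cov V X) Y Z W - ten4 T X (cov V Y) Z W
   - ten4 T X Y (cov V Z) W - ten4 T X Y Z (cov V W).
Proof.
move: V; apply: tlinear_eq; first exact: tlinear_contraction.
  by split=> [u v|a u] /=; rewrite !(covDl, covZl, ten4E, DerDl, DerZl); ring.
move=> p; rewrite contraction_delta.
move: X; apply: tlinear_eq; first exact: tlinear_ten41.
  by split=> [u v|a u] /=; rewrite !(covDr, covZr, ten4E, DerD, DerM); ring.
move=> i; move: Y; apply: tlinear_eq; first exact: tlinear_ten42.
  by split=> [u v|a u] /=; rewrite !(covDr, covZr, ten4E, DerD, DerM); ring.
move=> j; move: Z; apply: tlinear_eq; first exact: tlinear_ten43.
  by split=> [u v|a u] /=; rewrite !(covDr, covZr, ten4E, DerD, DerM); ring.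
move=> k; move: W; apply: tlinear_eq; first exact: tlinear_ten44.
  by split=> [u v|a u] /=; rewrite !(covDr, covZr, ten4E, DerD, DerM); ring.
move=> l.
rewrite !ten4_delta Der_delta.
have E (u : vec -> A) (c : 'I_4 -> A) k' : tlinear u ->
    (forall m, u (delta_mx 0 m) = c m) ->
    u (cov (delta_mx 0 p) (delta_mx 0 k')) = \sum_m chr m p k' * c m.
  move=> tu uc.
  pose v (X : vec) := \sum_m X 0 m * c m.
  rewrite (tlinear_eq tu (tlinear_contraction c)); last first.
    by move=> m; rewrite contraction_delta.
  by apply: eq_bigr => m _; rewrite cov_delta.
rewrite (E _ (fun m => T m j k l) _ (tlinear_ten41 T _ _ _)) => [|m]; last exact: ten4_delta.
rewrite (E _ (fun m => T i m k l) _ (tlinear_ten42 T _ _ _)) => [|m]; last exact: ten4_delta.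
rewrite (E _ (fun m => T i j m l) _ (tlinear_ten43 T _ _ _)) => [|m]; last exact: ten4_delta.
rewrite (E _ (fun m => T i j k m) _ (tlinear_ten44 T _ _ _)) => [|m]; last exact: ten4_delta.
rewrite !big_split /=; ring.
Qed.

End LeviCivita.

(** * Null frames with a commuting half *)

Section NullFrame.
Variables (A : comNzRingType) (d : derivations A) (G : metric_data A).
Local Notation vec := 'rV[A]_4.
Local Notation g := (gm G).
Local Notation ginv := (gi G).
Local Notation cov := (cov d (chr d G)).
Local Notation Der := (Der d).
Local Notation brk := (brk d).
Local Notation ip := (bil g).
Local Notation Rm := (ten4 (rie d G)).
Implicit Types (X Y Z V W : vec) (a b c : A).

Record null_frame (e0 e1 f0 f1 : vec) : Prop := NullFrame {
  nf_e00 : ip e0 e0 = 0; nf_e01 : ip e0 e1 = 0; nf_e11 : ip e1 e1 = 0;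
  nf_f00 : ip f0 f0 = 0; nf_f01 : ip f0 f1 = 0; nf_f11 : ip f1 f1 = 0;
  nf_ef00 : ip e0 f0 = 1; nf_ef01 : ip e0 f1 = 0;
  nf_ef10 : ip e1 f0 = 0; nf_ef11 : ip e1 f1 = 1
}.

Variables e0 e1 f0 f1 : vec.
Hypothesis nf : null_frame e0 e1 f0 f1.

Lemma null_frame_ip : (ip e0 e0 = 0) * (ip e0 e1 = 0) * (ip e1 e1 = 0) *
  (ip f0 f0 = 0) * (ip f0 f1 = 0) * (ip f1 f1 = 0) *
  (ip e0 f0 = 1) * (ip e0 f1 = 0) * (ip e1 f0 = 0) * (ip e1 f1 = 1) *
  (ip e1 e0 = 0) * (ip f1 f0 = 0) *
  (ip f0 e0 = 1) * (ip f1 e0 = 0) * (ip f0 e1 = 0) * (ip f1 e1 = 1).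
Proof. by case: nf => *; do ![split=> //]; rewrite ipC. Qed.
Let ipeE := null_frame_ip.

(** The Gram matrix of the frame [t] against its dual frame [t'] is the identity, and inverting this
    relation expresses the inverse metric. *)
Lemma frame_ginv p q : ginv p q =
  e0 0 p * f0 0 q + f0 0 p * e0 0 q + e1 0 p * f1 0 q + f1 0 p * e1 0 q.
Proof.
pose t := [:: e0; e1; f0; f1]; pose t' := [:: f0; f1; e0; e1].
pose E : 'M[A]_4 := \matrix_(i, j) nth 0 t i 0 j.
pose E' : 'M[A]_4 := \matrix_(i, j) nth 0 t' i 0 j.
have EE : E *m (g *m E'^T) = 1%:M.
  apply/matrixP => i j.
  have -> : (E *m (g *m E'^T)) i j = ip (nth 0 t i) (nth 0 t' j).
    rewrite mxE; apply: eq_bigr => k _; rewrite !mxE mulr_sumr; apply: eq_bigr => l _.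
    rewrite !mxE; ring.
  rewrite !mxE; case: i => [[|[|[|[|//]]]] ?]; case: j => [[|[|[|[|//]]]] ?];
  by rewrite /= !ipeE.
have giE : ginv = E'^T *m E.
  have := mulmx1C EE; rewrite -mulmxA => EE'.
  by rewrite -[E'^T *m E]mul1mx -(giK G) -mulmxA EE' mulmx1.
rewrite giE mxE !big_ord_recl big_ord0 !mxE /=; ring.
Qed.

Lemma frame_dec V : V = ip V f0 *: e0 + ip V f1 *: e1 + ip V e0 *: f0 + ip V e1 *: f1.
Proof.
apply/rowP => k; rewrite !rvecE -[in LHS](mulmx1 V) -(gmK G) mulmxA mxE.
have E X : ip V X = \sum_j (V *m g) 0 j * X 0 j.
  by rewrite bil_mul mxE; apply: eq_bigr => j _; rewrite [X^T _ _]mxE.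
rewrite !E !mulr_suml -!big_split; apply: eq_bigr => j _ /=.
rewrite frame_ginv; ring.
Qed.

Let ip_frame X Y :
  ip X Y = ip X f0 * ip Y e0 + ip X f1 * ip Y e1 + ip X e0 * ip Y f0 + ip X e1 * ip Y f1.
Proof.
rewrite [in LHS](frame_dec X) !(bilDl, bilZl) [ip e0 Y]ipC [ip e1 Y]ipC.
by rewrite [ip f0 Y]ipC [ip f1 Y]ipC.
Qed.

Let skew V X Y : Der V (ip X Y) = 0 -> ip (cov V X) Y = - ip (cov V Y) X.
Proof. by rewrite Der_ip [ip X _]ipC => /eqP; rewrite addr_eq0 => /eqP. Qed.

Let skewE V : (ip (cov V e1) e0 = - ip (cov V e0) e1) *
  (ip (cov V f0) e0 = - ip (cov V e0) f0) * (ip (cov V f1) e0 = - ip (cov V e0) f1) *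
  (ip (cov V f0) e1 = - ip (cov V e1) f0) * (ip (cov V f1) e1 = - ip (cov V e1) f1) *
  (ip (cov V f1) f0 = - ip (cov V f0) f1) *
  (ip (cov V e0) e0 = 0) * (ip (cov V e1) e1 = 0) *
  (ip (cov V f0) f0 = 0) * (ip (cov V f1) f1 = 0).
Proof.
do ![split]; try by apply: skew; rewrite !ipeE ?Der0 ?Der1.
all: apply: (halfK G); rewrite [X in X + _]skew ?addNr // !ipeE Der0 //.
Qed.

Hypothesis e_comm : brk e0 e1 = 0.

Let torsion X Y : cov X Y - cov Y X = brk X Y.
Proof. by apply: cov_torsion => *; apply: chrC. Qed.

Let cov_comm : cov e1 e0 = cov e0 e1.
Proof. by apply/eqP; rewrite eq_sym -subr_eq0 torsion e_comm. Qed.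

(* The isotropic integrable distribution spanned by e0, e1 is totally geodesic. *)
Let geodesic : (ip (cov e0 e0) e1 = 0) * (ip (cov e1 e0) e1 = 0).
Proof.
split; last by rewrite cov_comm skewE.
by rewrite skew ?ipeE ?Der0 // -cov_comm skewE oppr0.
Qed.

(* [tau] is the connection induced on the second exterior power of <e0, e1>, and
   tau e_a + kap_a is minus the trace of [e_a, _] on the quotient of the tangent
   bundle by <e0, e1>. *)
Definition tau V := ip (cov V e0) f0 + ip (cov V e1) f1.
Definition kap0 := ip (cov f1 e0) e1.
Definition kap1 := - ip (cov f0 e0) e1.

(** Total geodesy makes the span of [e0], [e1] parallel along itself, so the quadratic terms form
    the trace of a commutator and only derivatives of [tau] survive. *)
Lemma frame_curv_trace :
  Rm f0 e0 e0 e1 + Rm f1 e1 e0 e1 = Der e0 (tau e1) - Der e1 (tau e0).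
Proof.
have cov0 Z : cov 0 Z = 0 by have := covZl d (chr d G) 0 0 Z; rewrite !scale0r.
have D U V Z W : ip W (cov U (cov V Z)) = Der U (ip (cov V Z) W) - ip (cov V Z) (cov U W).
  by rewrite Der_ip [ip W _]ipC addrK.
rewrite !rie_curv /curvature e_comm !cov0 !subr0 !(bilDr, bilNr) !D.
rewrite [ip (cov e1 e0) (cov _ _)]ip_frame [ip (cov e0 e0) (cov _ _)]ip_frame.
rewrite [ip (cov e1 e1) (cov _ _)]ip_frame [ip (cov e0 e1) (cov _ _)]ip_frame.
rewrite !skewE !geodesic /tau !DerD cov_comm; ring.
Qed.

(** The operator [R(e0, e1)] preserves the totally geodesic span of [e0], [e1], on which the metric
    vanishes. *)
Lemma frame_curv_null : Rm e0 e1 e0 e1 = 0.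
Proof.
have cov0 Z : cov 0 Z = 0 by have := covZl d (chr d G) 0 0 Z; rewrite !scale0r.
have D U V Z W : ip W (cov U (cov V Z)) = Der U (ip (cov V Z) W) - ip (cov V Z) (cov U W).
  by rewrite Der_ip [ip W _]ipC addrK.
rewrite !rie_curv /curvature e_comm !cov0 !subr0 !(bilDr, bilNr) !D.
rewrite [ip (cov e1 e1) (cov _ _)]ip_frame [ip (cov e0 e1) (cov _ _)]ip_frame.
rewrite !skewE !geodesic !oppr0 !Der0 ?cov_comm; ring.
Qed.

(* The partial connection [e_a, _] on the quotient is flat by the Jacobi identity;
   this is the curvature of its determinant. *)
Lemma bott_flat :
  Der e0 (tau e1 + kap1) - Der e1 (tau e0 + kap0) = 0.
Proof.
have bE X Y V : ip (brk X Y) V = ip (cov X Y) V - ip (cov Y X) V.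
  by rewrite -torsion bilDl bilNl.
have bt X : tau X = - (ip (cov X f0) e0 + ip (cov X f1) e1).
  by rewrite /tau !skewE; ring.
have t0 : tau e0 + kap0 = - (ip (brk e0 f0) e0 + ip (brk e0 f1) e1).
  by rewrite bt !bE /kap0 !skewE; ring.
have t1 : tau e1 + kap1 = - (ip (brk e1 f0) e0 + ip (brk e1 f1) e1).
  by rewrite bt !bE /kap1 !skewE; ring.
(* The Leibniz rule on the quotient: pairing with a [W] orthogonal to [e0] and [e1] discards the
   components along them. *)
have D X V W : ip X e0 = 0 -> ip X e1 = 0 -> ip e0 W = 0 -> ip e1 W = 0 ->
   brk X e0 = 0 -> brk X e1 = 0 ->
   ip (brk X V) W = Der X (ip V e0) * ip f0 W + Der X (ip V e1) * ip f1 W +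
      ip V e0 * ip (brk X f0) W + ip V e1 * ip (brk X f1) W.
  move=> X0 X1 W0 W1 b0 b1.
  rewrite {1}(frame_dec V) !(brkDr, brkZr) b0 b1 !(bilDl, bilZl) W0 W1.
  have -> : ip (0 : vec) W = 0 by have := bilZl g 0 0 W; rewrite scale0r mul0r.
  ring.
have b00 : brk e0 e0 = 0 by apply/rowP => k; rewrite !mxE subrr.
have b11 : brk e1 e1 = 0 by apply/rowP => k; rewrite !mxE subrr.
have b10 : brk e1 e0 = 0 by rewrite brkC e_comm oppr0.
have J f : brk e0 (brk e1 f) = brk e1 (brk e0 f).
  have := jacobi d e0 e1 f; rewrite e_comm brk0r addr0 (brkC d f e0).
  rewrite -scaleN1r brkZr DerN Der1 oppr0 scale0r add0r scaleN1r.
  by move/eqP; rewrite subr_eq0 => /eqP.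
(* These are the two diagonal entries of the flatness equation on the quotient; their sum is its
   trace, in which the quadratic terms cancel. *)
have J0 := congr1 (ip ^~ e0) (J f0); have J1 := congr1 (ip ^~ e1) (J f1).
have D0 V W : ip e0 W = 0 -> ip e1 W = 0 -> ip (brk e0 V) W =
    Der e0 (ip V e0) * ip f0 W + Der e0 (ip V e1) * ip f1 W +
      ip V e0 * ip (brk e0 f0) W + ip V e1 * ip (brk e0 f1) W.
  by move=> ? ?; apply: D => //; rewrite ipeE.
have D1 V W : ip e0 W = 0 -> ip e1 W = 0 -> ip (brk e1 V) W =
    Der e1 (ip V e0) * ip f0 W + Der e1 (ip V e1) * ip f1 W +
      ip V e0 * ip (brk e1 f0) W + ip V e1 * ip (brk e1 f1) W.
  by move=> ? ?; apply: D => //; rewrite ipeE.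
have ee : (ip e0 e0 = 0) * (ip e0 e1 = 0) * (ip e1 e0 = 0) * (ip e1 e1 = 0) by rewrite !ipeE.
cbv beta in J0, J1.
rewrite (D0 (brk e1 f0) e0 ee.1.1.1 ee.1.2) (D1 (brk e0 f0) e0 ee.1.1.1 ee.1.2) !ipeE in J0.
rewrite (D0 (brk e1 f1) e1 ee.1.1.2 ee.2) (D1 (brk e0 f1) e1 ee.1.1.2 ee.2) !ipeE in J1.
rewrite t0 t1 !DerN !DerD.
move/eqP: J0; rewrite -subr_eq0 => /eqP J0; move/eqP: J1; rewrite -subr_eq0 => /eqP J1.
have sum0 (a b c : A) : b = 0 -> c = 0 -> a = - b - c -> a = 0.
  by move=> -> -> ->; rewrite oppr0 addr0.
apply: (sum0 _ _ _ J0 J1); ring.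
Qed.

Section Lee.
Variables (F : 'M[A]_4) (th : 'I_4 -> A).
Definition form_at V := \sum_i V 0 i * th i.

Lemma form_atD X Y : form_at (X + Y) = form_at X + form_at Y.
Proof. exact: (tlinear_contraction th).1. Qed.
Lemma form_atZ a X : form_at (a *: X) = a * form_at X.
Proof. exact: (tlinear_contraction th).2. Qed.
Lemma form_at_delta i : form_at (delta_mx 0 i) = th i.
Proof. exact: contraction_delta. Qed.
Lemma form_at0 : form_at 0 = 0.
Proof. by rewrite -(scale0r 0) form_atZ mul0r. Qed.

Lemma ext_deriv_eval X Y :
  bil (\matrix_(i, j) (d i (th j) - d j (th i))) X Y =
  Der X (form_at Y) - Der Y (form_at X) - form_at (brk X Y).
Proof.
move: X; apply: tlinear_eq; first exact: tlinear_bill.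
  by split=> [u v|a u]; rewrite !(brkDl, brkZl, DerDl, DerZl, form_atD, form_atZ, DerD, DerM); ring.
move=> i; move: Y; apply: tlinear_eq; first exact: tlinear_bilr.
  by split=> [u v|a u]; rewrite !(brkDr, brkZr, DerDl, DerZl, form_atD, form_atZ, DerD, DerM); ring.
by move=> j; rewrite bil_delta mxE !form_at_delta !Der_delta brk_delta form_at0 subr0.
Qed.

Lemma lee_eval : F^T = - F ->
  (forall i j k, d i (F j k) + d j (F k i) + d k (F i j)
     = th i * F j k + th j * F k i + th k * F i j) ->
  forall X Y Z, Der X (bil F Y Z) + Der Y (bil F Z X) + Der Z (bil F X Y)
    - bil F (brk X Y) Z - bil F (brk Y Z) X - bil F (brk Z X) Y
  = form_at X * bil F Y Z + form_at Y * bil F Z X + form_at Z * bil F X Y.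
Proof.
move=> Fsk lee X Y Z.
have Fs U V : bil F U V = - bil F V U by rewrite -[in LHS]bil_tr Fsk bil_mxN.
pose E := (brkDl, brkZl, brkDr, brkZr, DerDl, DerZl, form_atD, form_atZ, bilDl, bilDr,
  bilZl, bilZr, DerD, DerM).
move: X; apply: tlinear_eq.
- by split=> [u v|a u]; rewrite !E ?(Fs Y u) ?(Fs u Z); ring.
- by split=> [u v|a u]; rewrite !E; ring.
move=> i; move: Y; apply: tlinear_eq.
- by split=> [u v|a u]; rewrite !E ?(Fs _ u) ?(Fs Z); ring.
- by split=> [u v|a u]; rewrite !E; ring.
move=> j; move: Z; apply: tlinear_eq.
- by split=> [u v|a u]; rewrite !E ?(Fs _ u) ?(Fs u); ring.
- by split=> [u v|a u]; rewrite !E; ring.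
move=> k; rewrite !form_at_delta !Der_delta !brk_delta !bil_delta.
have F0 V : bil F 0 V = 0 by have := bilZl F 0 0 V; rewrite scale0r mul0r.
by rewrite !F0 !subr0.
Qed.

(** On [(e0, e1, f1)] the only nonzero value of [F] is [F(e1, f1) = -1], which isolates [theta(e0)];
    likewise [(e1, e0, f0)] isolates [theta(e1)]. All values of [F] on the frame are constant, so
    [dF] reduces to brackets. Two of the resulting connection terms coincide, giving [2 kap], and
    the others cancel because the frame commutes. *)
Lemma lee_frame : F^T = - F ->
  (forall X, (bil F X e0 = ip X e0) * (bil F X e1 = ip X e1) *
      (bil F X f0 = - ip X f0) * (bil F X f1 = - ip X f1)) ->
  (forall i j k, d i (F j k) + d j (F k i) + d k (F i j)
     = th i * F j k + th j * F k i + th k * F i j) ->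
  (form_at e0 = kap0 + kap0) * (form_at e1 = kap1 + kap1).
Proof.
move=> Fsk FE lee; have L := lee_eval Fsk lee.
have bE X Y V : ip (brk X Y) V = ip (cov X Y) V - ip (cov Y X) V.
  by rewrite -torsion bilDl bilNl.
have L0 := L e0 e1 f1; have L1 := L e1 e0 f0.
have e10 : brk e1 e0 = 0 by rewrite brkC e_comm oppr0.
have i0 V : ip 0 V = 0 by have := bilZl g 0 0 V; rewrite scale0r mul0r.
rewrite e_comm !FE !ipeE !DerN !Der0 Der1 !bE i0 !skewE ?cov_comm in L0.
rewrite e10 !FE !ipeE !DerN !Der0 Der1 !bE i0 !skewE ?cov_comm in L1.
rewrite /kap0 /kap1; split.
  by apply: oppr_inj; move: L0; rewrite oppr0 !mulr0 !addr0 mulrN1 => <-; ring.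
by apply: oppr_inj; move: L1; rewrite oppr0 !mulr0 !addr0 mulrN1 => <-; ring.
Qed.

End Lee.

Section Codifferential.
Variable T : 'I_4 -> 'I_4 -> 'I_4 -> 'I_4 -> A.
Local Notation C := (chr d G).

Definition nab4 p i j k l : A := d p (T i j k l)
   - \sum_m (C m p i * T m j k l + C m p j * T i m k l
            + C m p k * T i j m l + C m p l * T i j k m).

Definition cod i j k : A := - \sum_p \sum_q ginv p q * nab4 p q i j k.

Definition nab_at V U X Y Z : A :=
  Der V (ten4 T U X Y Z) - ten4 T (cov V U) X Y Z - ten4 T U (cov V X) Y Z
   - ten4 T U X (cov V Y) Z - ten4 T U X Y (cov V Z).

Lemma cod_skew : (forall X Y Z W, ten4 T X Y Z W = - ten4 T X Y W Z) ->
  forall i j k, cod i j k = - cod i k j.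
Proof.
move=> sk i j k; have Ts p q u v : T p q u v = - T p q v u.
  by rewrite -!(ten4_delta T) sk.
rewrite /cod opprK; rewrite -sumrN; apply: eq_bigr => p _; rewrite -sumrN.
apply: eq_bigr => q _; rewrite -mulrN; congr (_ * _).
rewrite /nab4 (Ts q i j k) derN.
rewrite (_ : \sum_m _ = - \sum_m (C m p q * T m i k j + C m p i * T q m k j
  + C m p k * T q i m j + C m p j * T q i k m)); first by ring.
rewrite -sumrN; apply: eq_bigr => m _.
rewrite (Ts m i j k) (Ts q m j k) (Ts q i m k) (Ts q i j m); ring.
Qed.

(** The metric trace in a null frame pairs each vector with its dual, in both orders. *)
Lemma cod_frame X Y Z :
  \sum_i \sum_j \sum_k cod i j k * X 0 i * Y 0 j * Z 0 k =
  - (nab_at e0 f0 X Y Z + nab_at f0 e0 X Y Z + nab_at e1 f1 X Y Z + nab_at f1 e1 X Y Z).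
Proof.
pose S p q := \sum_i \sum_j \sum_k nab4 p q i j k * X 0 i * Y 0 j * Z 0 k.
have NE V U : nab_at V U X Y Z = \sum_p \sum_q V 0 p * U 0 q * S p q.
  rewrite -[LHS]nab_ten4; apply: eq_bigr => p _; rewrite mulr_sumr; apply: eq_bigr => q _.
  rewrite -mulrA; congr (_ * _); rewrite mulr_sumr; apply: eq_bigr => i _.
  rewrite mulr_sumr; apply: eq_bigr => j _; rewrite mulr_sumr; apply: eq_bigr => k _.
  rewrite /nab4; ring.
have push (I : finType) (H : 'I_4 -> 'I_4 -> I -> A) :
    \sum_k \sum_p \sum_q H p q k = \sum_p \sum_q \sum_k H p q k.
  by rewrite exchange_big; apply: eq_bigr => p _; rewrite exchange_big.
transitivity (\sum_p \sum_q - (ginv p q * S p q)).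
  transitivity (\sum_i \sum_j \sum_k \sum_p \sum_q
      - (ginv p q * (nab4 p q i j k * X 0 i * Y 0 j * Z 0 k))).
    apply: eq_bigr => i _; apply: eq_bigr => j _; apply: eq_bigr => k _.
    rewrite /cod !mulNr !mulr_suml -sumrN; apply: eq_bigr => p _.
    rewrite !mulr_suml -sumrN; apply: eq_bigr => q _; ring.
  under eq_bigr => i _ do under eq_bigr => j _ do rewrite push.
  under eq_bigr => i _ do rewrite push.
  rewrite push; apply: eq_bigr => p _; apply: eq_bigr => q _.
  rewrite /S mulr_sumr -sumrN; apply: eq_bigr => i _; rewrite mulr_sumr -sumrN.
  by apply: eq_bigr => j _; rewrite mulr_sumr -sumrN.
rewrite !NE -!big_split -sumrN; apply: eq_bigr => p _ /=.
rewrite -!big_split -sumrN; apply: eq_bigr => q _ /=.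
rewrite frame_ginv; ring.
Qed.

(** Metric compatibility leaves six connection coefficients per direction, the dimension of
    [so(2,2)]. Naming them turns the divergence into a polynomial that [ring] can handle. *)
Let decE V : exists2 t : A * A * A * A * A * A,
    [/\ t.1.1.1.1.1 = ip (cov V e0) f0, t.1.1.1.1.2 = ip (cov V e0) f1,
        t.1.1.1.2 = ip (cov V e1) f0, t.1.1.2 = ip (cov V e1) f1
      & t.1.2 = ip (cov V e0) e1] &
    let '(a, b, c, k, m, n) := t in
    [/\ cov V e0 = a *: e0 + b *: e1 + m *: f1,
        cov V e1 = c *: e0 + k *: e1 - m *: f0,
        cov V f0 = n *: e1 - a *: f0 - c *: f1 &
        cov V f1 = - n *: e0 - b *: f0 - k *: f1].
Proof.
exists (ip (cov V e0) f0, ip (cov V e0) f1, ip (cov V e1) f0, ip (cov V e1) f1,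
   ip (cov V e0) e1, ip (cov V f0) f1) => //=.
by split; rewrite [LHS]frame_dec !skewE ?scale0r ?scaleNr ?addr0 ?add0r.
Qed.

(** Stated for any [T] with the listed components, in order to serve both the Weyl tensor and its
    self-dual part: no other component enters, which is why their codifferentials agree on the span
    of [e0], [e1]. The hypothesis on the sum stands in for pair symmetry; the two summands enter
    only through it. *)
Lemma cod_plus psi :
  (forall X Y Z W, ten4 T X Y Z W = - ten4 T Y X Z W) ->
  (forall X Y Z W, ten4 T X Y Z W = - ten4 T X Y W Z) ->
  ten4 T e0 e1 e0 e1 = 0 -> ten4 T e0 f0 e0 e1 = psi -> ten4 T e1 f1 e0 e1 = psi ->
  ten4 T e0 f1 e0 e1 = 0 -> ten4 T e1 f0 e0 e1 = 0 ->
  ten4 T e0 e1 e0 f0 + ten4 T e0 e1 e1 f1 = psi + psi ->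
  let cod_at X := \sum_i \sum_j \sum_k cod i j k * X 0 i * e0 0 j * e1 0 k in
  (cod_at e0 = Der e0 psi + (kap0 *+ 4 - tau e0) * psi) *
  (cod_at e1 = Der e1 psi + (kap1 *+ 4 - tau e1) * psi).
Proof.
move=> s12 s34 T0 Tp0 Tp1 Tz1 Tz2 Ts cod_at.
have Txx X Z W : ten4 T X X Z W = 0 by apply: (halfK G); rewrite {1}s12 addNr.
have Tyy X Z W : ten4 T Z W X X = 0 by apply: (halfK G); rewrite {1}s34 addNr.
have {}Ts : ten4 T e0 e1 e1 f1 = psi + psi - ten4 T e0 e1 e0 f0 by rewrite -Ts; ring.
have R : (ten4 T e1 e0 e0 e1 = 0) * (ten4 T f0 e0 e0 e1 = - psi) * (ten4 T f1 e1 e0 e1 = - psi) *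
   (ten4 T f1 e0 e0 e1 = 0) * (ten4 T f0 e1 e0 e1 = 0) *
   (ten4 T e0 e1 f1 e1 = - (psi + psi - ten4 T e0 e1 e0 f0)) *
   (ten4 T e1 e0 e0 f0 = - ten4 T e0 e1 e0 f0) *
   (ten4 T e1 e0 f1 e1 = psi + psi - ten4 T e0 e1 e0 f0).
  by rewrite !(s12 e1 e0) !(s12 f0) !(s12 f1) !(s34 _ _ f1) Ts T0 Tp0 Tp1 Tz1 Tz2 ?oppr0 ?opprK.
have c01 := congr1 (ip ^~ f0) cov_comm; have c11 := congr1 (ip ^~ f1) cov_comm.
cbv beta in c01, c11.
rewrite /cod_at !cod_frame /nab_at /kap0 /kap1 /tau.
have [[[[[[a0 b0] k0] l0] m0] n0] /= [A1 A2 A3 A4 A5] [D01 D02 D03 D04]] := decE e0.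
have [[[[[[a1 b1] k1] l1] m1] n1] /= [B1 B2 B3 B4 B5] [D11 D12 D13 D14]] := decE e1.
have [[[[[[a2 b2] k2] l2] m2] n2] /= [_ _ _ _ C5] [D21 D22 D23 D24]] := decE f0.
have [[[[[[a3 b3] k3] l3] m3] n3] /= [_ _ _ _ E5] [D31 D32 D33 D34]] := decE f1.
(* Total geodesy kills the coefficients [m] along [e0] and [e1], and [cov e1 e0 = cov e0 e1]
   identifies two further pairs. *)
have m0E : m0 = 0 by rewrite A5 geodesic.
have m1E : m1 = 0 by rewrite B5 geodesic.
have k0E : k0 = a1 by rewrite A3 B1 cov_comm.
have l0E : l0 = b1 by rewrite A4 B2 cov_comm.
rewrite -A1 -A4 -B1 -B4 -C5 -E5; clear A1 A2 A3 A4 A5 B1 B2 B3 B4 B5 C5 E5.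
rewrite m0E scale0r ?addr0 ?subr0 in D01 D02; rewrite m1E scale0r ?addr0 ?subr0 in D11 D12.
rewrite !(D01, D02, D03, D04, D11, D12, D13, D14, D21, D22, D23, D24, D31, D32, D33, D34).
rewrite k0E l0E.
have ten4N X Y Z W : (ten4 T (- X) Y Z W = - ten4 T X Y Z W) *
  (ten4 T X (- Y) Z W = - ten4 T X Y Z W) * (ten4 T X Y (- Z) W = - ten4 T X Y Z W) *
  (ten4 T X Y Z (- W) = - ten4 T X Y Z W).
  by do ![split]; rewrite -scaleN1r ten4E mulN1r.
rewrite !(ten4E, ten4N, scaleNr) !(Txx, Tyy, R, T0, Tp0, Tp1, Tz1, Tz2, Ts) ?Der0 ?DerN.
by split; ring.
Qed.

(* The commutator of the two equations along the commuting frame. *)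
Lemma cod_plus_zero psi : psi + psi = - (Rm f0 e0 e0 e1 + Rm f1 e1 e0 e1) ->
  Der e0 psi + (kap0 *+ 4 - tau e0) * psi = 0 ->
  Der e1 psi + (kap1 *+ 4 - tau e1) * psi = 0 -> psi * psi *+ 10 = 0.
Proof.
have := bott_flat; rewrite frame_curv_trace.
move: (tau e0) (tau e1) kap0 kap1 => t0 t1 k0 k1 B psiE E0 E1.
have D0 : Der e0 psi = (t0 - k0 *+ 4) * psi.
  by apply/eqP; rewrite -subr_eq0 -mulNr opprB E0.
have D1 : Der e1 psi = (t1 - k1 *+ 4) * psi.
  by apply/eqP; rewrite -subr_eq0 -mulNr opprB E1.
rewrite !DerD in B.
have C := Der_brk d e0 e1 psi.
have b0 : Der (brk e0 e1) psi = 0.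
  by rewrite e_comm; have := DerZl d 0 0 psi; rewrite scale0r mul0r.
have DerMn X a n : Der X (a *+ n) = Der X a *+ n.
  by elim: n => [|n IH]; rewrite ?mulr0n ?Der0 // !mulrS DerD IH.
rewrite b0 D0 D1 !DerM D0 D1 !(DerD, DerN, DerMn) in C.
(* Origin of the 10: the curvature of [tau] is [-2 psi], hence that of [kap] is [2 psi] by
   [bott_flat], and [4 kap - tau] has curvature [8 psi + 2 psi]. The commutator of the two equations
   multiplies it by [psi]. *)
have -> : psi * psi *+ 10 = 5 * ((psi + psi) * psi) by ring.
have sum0 (u v w : A) : v = 0 -> 0 = w -> u = - (4 * v * psi) - w -> u = 0.
  by move=> -> <- ->; rewrite mulr0 mul0r oppr0 addr0.
rewrite psiE; apply: (sum0 _ _ _ B C); ring.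
Qed.

End Codifferential.
End NullFrame.

(** * The Weyl tensor in a null frame *)

(* The value of [sixth] is irrelevant, because the term that it multiplies is not
   seen by the components of interest. *)
Section Weyl.
Variables (A : comNzRingType) (d : derivations A) (G : metric_data A) (sixth : A).
Local Notation vec := 'rV[A]_4.
Local Notation g := (gm G).
Local Notation ginv := (gi G).
Local Notation h := (half G).
Local Notation ip := (bil g).
Local Notation Rm := (ten4 (rie d G)).
Implicit Types (X Y Z V W : vec) (a b c : A).

Lemma ten4_multilinear (phi : vec -> vec -> vec -> vec -> A) :
  (forall Y Z W, tlinear (fun X => phi X Y Z W)) ->
  (forall X Z W, tlinear (fun Y => phi X Y Z W)) ->
  (forall X Y W, tlinear (fun Z => phi X Y Z W)) ->
  (forall X Y Z, tlinear (fun W => phi X Y Z W)) ->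
  forall X Y Z W, ten4 (fun i j k l =>
    phi (delta_mx 0 i) (delta_mx 0 j) (delta_mx 0 k) (delta_mx 0 l)) X Y Z W = phi X Y Z W.
Proof.
move=> t1 t2 t3 t4 X Y Z W.
move: X; apply: tlinear_eq; [exact: tlinear_ten41 | exact: t1 | move=> i].
move: Y; apply: tlinear_eq; [exact: tlinear_ten42 | exact: t2 | move=> j].
move: Z; apply: tlinear_eq; [exact: tlinear_ten43 | exact: t3 | move=> k].
move: W; apply: tlinear_eq; [exact: tlinear_ten44 | exact: t4 | move=> l].
by rewrite ten4_delta.
Qed.

Lemma ten4_contraction13 T X Z j l :
  ten4 T X (delta_mx 0 j) Z (delta_mx 0 l) = \sum_i X 0 i * \sum_k Z 0 k * T i j k l.
Proof.
move: X; apply: tlinear_eq; [exact: tlinear_ten41 | exact: tlinear_contraction | move=> i].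
rewrite contraction_delta.
move: Z; apply: tlinear_eq; [exact: tlinear_ten43 | exact: tlinear_contraction | move=> k].
by rewrite contraction_delta ten4_delta.
Qed.

Definition ric j l : A := \sum_k rie_up d G k j k l.
Definition sca : A := \sum_j \sum_l ginv j l * ric j l.
Definition wey i j k l : A := rie d G i j k l
  - h * (g i k * ric j l - g i l * ric j k + g j l * ric i k - g j k * ric i l)
  + sixth * sca * (g i k * g j l - g i l * g j k).

Local Notation rc := (bil (\matrix_(j, l) ric j l)).
Local Notation We := (ten4 wey).

Lemma wey_eval X Y Z W : We X Y Z W = Rm X Y Z W
  - h * (ip X Z * rc Y W - ip X W * rc Y Z + ip Y W * rc X Z - ip Y Z * rc X W)
  + sixth * sca * (ip X Z * ip Y W - ip X W * ip Y Z).
Proof.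
pose phi X Y Z W := Rm X Y Z W
  - h * (ip X Z * rc Y W - ip X W * rc Y Z + ip Y W * rc X Z - ip Y Z * rc X W)
  + sixth * sca * (ip X Z * ip Y W - ip X W * ip Y Z).
have -> : wey = fun i j k l =>
    phi (delta_mx 0 i) (delta_mx 0 j) (delta_mx 0 k) (delta_mx 0 l).
  apply/funext => i; apply/funext => j; apply/funext => k; apply/funext => l.
  by rewrite /phi ten4_delta !bil_delta !mxE.
apply: ten4_multilinear; rewrite /phi.
all: by move=> *; split=> [u v|a u]; rewrite !(ten4E, bilDl, bilDr, bilZl, bilZr); ring.
Qed.

Variables e0 e1 f0 f1 : vec.
Hypothesis nf : null_frame G e0 e1 f0 f1.

Lemma ric_frame Y W :
  rc Y W = Rm e0 Y f0 W + Rm f0 Y e0 W + Rm e1 Y f1 W + Rm f1 Y e1 W.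
Proof.
move: Y; apply: tlinear_eq; first exact: tlinear_bill.
  by split=> [u v|a u]; rewrite !ten4E; ring.
move=> j; move: W; apply: tlinear_eq; first exact: tlinear_bilr.
  by split=> [u v|a u]; rewrite !ten4E; ring.
move=> l; rewrite bil_delta mxE !ten4_contraction13.
have RE k : rie_up d G k j k l = \sum_i ginv k i * rie d G i j k l.
  transitivity (\sum_m (ginv *m g) k m * rie_up d G m j k l).
    rewrite giK (bigD1 k) //= mxE eqxx mul1r big1 ?addr0 // => m /negPf mk.
    by rewrite mxE eq_sym mk mul0r.
  under eq_bigr do rewrite mxE mulr_suml.
  rewrite exchange_big; apply: eq_bigr => i _; rewrite mulr_sumr.
  by apply: eq_bigr => m _; rewrite mulrA.
rewrite /ric; under eq_bigr do rewrite RE.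
rewrite exchange_big -!big_split; apply: eq_bigr => i _ /=.
rewrite !mulr_sumr -!big_split; apply: eq_bigr => k _ /=.
rewrite (frame_ginv nf); ring.
Qed.

Lemma ric_sym Y W : rc Y W = rc W Y.
Proof.
rewrite !ric_frame (rie_pair d G e0 Y) (rie_pair d G f0 Y) (rie_pair d G e1 Y).
rewrite (rie_pair d G f1 Y); ring.
Qed.

Lemma wey_skew12 X Y Z W : We X Y Z W = - We Y X Z W.
Proof. rewrite !wey_eval rie_skew12; ring. Qed.

Lemma wey_skew34 X Y Z W : We X Y Z W = - We X Y W Z.
Proof. rewrite !wey_eval rie_skew34; ring. Qed.

Lemma wey_pair X Y Z W : We X Y Z W = We Z W X Y.
Proof.
rewrite !wey_eval rie_pair (ipC G Z X) (ipC G Z Y) (ipC G W X) (ipC G W Y).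
rewrite (ric_sym W Y) (ric_sym W X) (ric_sym Z X) (ric_sym Z Y); ring.
Qed.

Definition psi : A := h * (Rm e0 f0 e0 e1 + Rm e1 f1 e0 e1).

Let ipeE := null_frame_ip nf.

Let Rxx X Z W : Rm X X Z W = 0.
Proof. by apply: (halfK G); rewrite {1}rie_skew12 addNr. Qed.
Let Ryy X Z W : Rm Z W X X = 0.
Proof. by apply: (halfK G); rewrite {1}rie_skew34 addNr. Qed.

(** [ring] sees [h] as an atom, so a term without this factor has to be halved by hand before it can
    cancel. *)
Let hh a : a = h * a + h * a.
Proof. by rewrite -mulrDl half2 mul1r. Qed.

Hypothesis R0 : Rm e0 e1 e0 e1 = 0.

Lemma wey_e0101 : We e0 e1 e0 e1 = 0.
Proof. by rewrite wey_eval !ipeE R0; ring. Qed.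

(** The Ricci correction is half of [Rm e1 f1 e0 e1 - Rm e0 f0 e0 e1], so it replaces one Riemann
    component by the mean of the two. The scalar curvature term drops out because [e0] is orthogonal
    to [e0] and [e1]. *)
Lemma wey_e0201 : We e0 f0 e0 e1 = psi.
Proof.
rewrite wey_eval !ipeE !ric_frame !Rxx !Ryy.
rewrite (rie_skew12 d G f0 e0 e0 e1) (rie_pair d G e1 e0 f1 e1) (rie_skew34 d G f1 e1 e1 e0).
rewrite (rie_skew12 d G f1 e1 e0 e1) /psi [X in X - _]hh; ring.
Qed.

Lemma wey_e1301 : We e1 f1 e0 e1 = psi.
Proof.
rewrite wey_eval !ipeE !ric_frame !Rxx !Ryy.
rewrite (rie_skew12 d G f1 e1 e1 e0) (rie_skew34 d G e1 f1 e1 e0) (rie_pair d G e0 e1 f0 e0).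
rewrite (rie_skew12 d G f0 e0 e0 e1) /psi [X in X - _]hh; ring.
Qed.

Lemma wey_e0301 : We e0 f1 e0 e1 = 0.
Proof.
rewrite wey_eval !ipeE !ric_frame !Rxx !Ryy (rie_pair d G e1 e0 f1 e0).
rewrite (rie_skew12 d G f1 e0 e1 e0) (rie_skew34 d G e0 f1 e1 e0) [X in X - _]hh; ring.
Qed.

Lemma wey_e1201 : We e1 f0 e0 e1 = 0.
Proof.
rewrite wey_eval !ipeE !ric_frame !Rxx !Ryy (rie_pair d G e0 e1 f0 e1).
rewrite (rie_skew12 d G f0 e1 e0 e1) [X in X - _]hh; ring.
Qed.

Lemma wey_e01F : We e0 e1 e0 f0 + We e0 e1 e1 f1 = psi + psi.
Proof. by rewrite (wey_pair e0 e1 e0) (wey_pair e0 e1 e1) wey_e0201 wey_e1301. Qed.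

Variable P : 'M[A]_4.
Hypotheses (Pe0 : e0 *m P = e0) (Pe1 : e1 *m P = e1)
  (Pf0 : f0 *m P = - f0) (Pf1 : f1 *m P = - f1).
Local Notation F := (g *m P^T).

Lemma F_eval X Y : bil F X Y = ip X (Y *m P).
Proof. by rewrite !bil_mul trmx_mul !mulmxA. Qed.

(* [sd_partE] applied to the first pair of indices; unlike the Hodge operator this
   expression is polynomial, and makes sense over a ring of functions. *)
Definition wplus_at X Y Z W : A :=
  h * (We X Y Z W + We (X *m P) (Y *m P) Z W)
  - h * (We e0 f0 Z W + We e1 f1 Z W) * bil F X Y.

Definition wplus i j k l : A := wplus_at
  (delta_mx 0 i) (delta_mx 0 j) (delta_mx 0 k) (delta_mx 0 l).

Lemma wplus_eval X Y Z W : ten4 wplus X Y Z W = wplus_at X Y Z W.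
Proof.
apply: ten4_multilinear; rewrite /wplus_at.
all: by move=> *; split=> [u v|a u];
  rewrite ?mulmxDl -?scalemxAl !(ten4E, bilDl, bilDr, bilZl, bilZr); ring.
Qed.

Hypothesis Fsk : F^T = - F.

Lemma wplus_skew12 X Y Z W : ten4 wplus X Y Z W = - ten4 wplus Y X Z W.
Proof.
have Fs : bil F Y X = - bil F X Y by rewrite -[in LHS]bil_tr Fsk bil_mxN.
rewrite !wplus_eval /wplus_at Fs (wey_skew12 X) (wey_skew12 (X *m P)); ring.
Qed.

Lemma wplus_skew34 X Y Z W : ten4 wplus X Y Z W = - ten4 wplus X Y W Z.
Proof.
rewrite !wplus_eval /wplus_at (wey_skew34 X) (wey_skew34 (X *m P)) (wey_skew34 e0).
rewrite (wey_skew34 e1); ring.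
Qed.

Let we_N X Y Z W : We X (- Y) Z W = - We X Y Z W.
Proof. by rewrite -scaleN1r ten4E mulN1r. Qed.

Let hh' a : h * (a + a) = a.
Proof. exact: half_double. Qed.

Let ip_N X Y : ip X (- Y) = - ip X Y. Proof. exact: bilNr. Qed.

Lemma wplus_e01 Z W : ten4 wplus e0 e1 Z W = We e0 e1 Z W.
Proof. by rewrite wplus_eval /wplus_at F_eval Pe0 Pe1 !ipeE mulr0 subr0 hh'. Qed.

Lemma wplus_e02 : ten4 wplus e0 f0 e0 e1 = psi.
Proof.
rewrite wplus_eval /wplus_at F_eval Pe0 Pf0 we_N wey_e0201 wey_e1301 ip_N !ipeE.
rewrite hh'; ring.
Qed.

Lemma wplus_e13 : ten4 wplus e1 f1 e0 e1 = psi.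
Proof.
rewrite wplus_eval /wplus_at F_eval Pe1 Pf1 we_N wey_e0201 wey_e1301 ip_N !ipeE.
rewrite hh'; ring.
Qed.

Lemma wplus_e03 : ten4 wplus e0 f1 e0 e1 = 0.
Proof. by rewrite wplus_eval /wplus_at F_eval Pe0 Pf1 we_N ip_N !ipeE; ring. Qed.

Lemma wplus_e12 : ten4 wplus e1 f0 e0 e1 = 0.
Proof. by rewrite wplus_eval /wplus_at F_eval Pe1 Pf0 we_N ip_N !ipeE; ring. Qed.

Local Notation Der := (Der d).
Hypothesis e_comm : brk d e0 e1 = 0.

Lemma psi_double : psi + psi = - (Rm f0 e0 e0 e1 + Rm f1 e1 e0 e1).
Proof.
by rewrite /psi -mulrDr hh' (rie_skew12 d G e0) (rie_skew12 d G e1 f1) -opprD.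
Qed.

Lemma cod_wey_wplus :
  let at_ T X := \sum_i \sum_j \sum_k cod d G T i j k * X 0 i * e0 0 j * e1 0 k in
  let k0 := kap0 d G e0 e1 f1 in let k1 := kap1 d G e0 e1 f0 in
  let t := tau d G e0 e1 f0 f1 in
  [/\ at_ wey e0 = Der e0 psi + (k0 *+ 4 - t e0) * psi,
      at_ wey e1 = Der e1 psi + (k1 *+ 4 - t e1) * psi,
      at_ wplus e0 = at_ wey e0 & at_ wplus e1 = at_ wey e1].
Proof.
move=> at_ k0 k1 t.
have [w0 w1] := cod_plus nf e_comm wey_skew12 wey_skew34 wey_e0101 wey_e0201
  wey_e1301 wey_e0301 wey_e1201 wey_e01F.
have p01 : ten4 wplus e0 e1 e0 e1 = 0 by rewrite wplus_e01 wey_e0101.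
have pF : ten4 wplus e0 e1 e0 f0 + ten4 wplus e0 e1 e1 f1 = psi + psi.
  by rewrite !wplus_e01 wey_e01F.
have [v0 v1] := cod_plus nf e_comm wplus_skew12 wplus_skew34 p01 wplus_e02
  wplus_e13 wplus_e03 wplus_e12 pF.
by split=> //; rewrite /at_ ?w0 ?w1 ?v0 ?v1.
Qed.

Lemma cod_wey_zero :
  (\sum_i \sum_j \sum_k cod d G wey i j k * e0 0 i * e0 0 j * e1 0 k = 0) ->
  (\sum_i \sum_j \sum_k cod d G wey i j k * e1 0 i * e0 0 j * e1 0 k = 0) ->
  psi * psi *+ 10 = 0.
Proof.
have [-> -> _ _] := cod_wey_wplus.
exact: (cod_plus_zero nf e_comm psi_double).
Qed.

Section Lee.
Variable th : 'I_4 -> A.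
Hypothesis lee : forall i j k, d i (F j k) + d j (F k i) + d k (F i j)
     = th i * F j k + th j * F k i + th k * F i j.
Local Notation dth := (\matrix_(i, j) (d i (th j) - d j (th i))).

(** By [lee_frame] the value is twice the curvature of [kap], which [bott_flat] makes opposite to
    the curvature of [tau], that is, equal to [psi + psi]. *)
Lemma ext_deriv_psi : bil dth e0 e1 = psi *+ 4.
Proof.
rewrite ext_deriv_eval e_comm form_at0 subr0.
have FE X : (bil F X e0 = ip X e0) * (bil F X e1 = ip X e1) *
      (bil F X f0 = - ip X f0) * (bil F X f1 = - ip X f1).
  by rewrite !F_eval Pe0 Pe1 Pf0 Pf1 !ip_N.
have [-> ->] := lee_frame nf e_comm Fsk FE lee.
have := bott_flat nf e_comm; have := psi_double; rewrite (frame_curv_trace nf e_comm).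
rewrite !DerD => psiE B.
have -> : psi *+ 4 = (psi + psi) + (psi + psi) by ring.
have sum0 (u v w : A) : w = 0 -> u - v = w + w -> u = v.
  by move=> -> /eqP; rewrite addr0 subr_eq0 => /eqP.
rewrite psiE; apply: (sum0 _ _ _ B); ring.
Qed.

(* d theta /\ F = d (theta /\ F) + theta /\ d F = 0. *)
Lemma ext_deriv_wedge i j k l :
  dth i j * F k l - dth i k * F j l + dth i l * F j k
  + dth j k * F i l - dth j l * F i k + dth k l * F i j = 0.
Proof.
have Fs p q : F p q = - F q p by move/matrixP: Fsk => /(_ q p); rewrite [LHS]mxE [RHS]mxE.
pose dF p q r := d p (F q r) + d q (F r p) + d r (F p q).
pose tF p q r := th p * F q r + th q * F r p + th r * F p q.
have L p q r : dF p q r - tF p q r = 0 by rewrite /dF lee subrr.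
have DL e p q r : d e (dF p q r) - d e (tF p q r) = 0.
  by rewrite /dF lee subrr.
(* The linear combination behind the identity: the alternating derivatives of [dF - theta /\ F],
   where the second derivatives of [F] cancel, corrected by the wedge of [theta] with the same
   expression. *)
have sum0 (u v1 v2 v3 v4 w1 w2 w3 w4 : A) : v1 = 0 -> v2 = 0 -> v3 = 0 -> v4 = 0 ->
    w1 = 0 -> w2 = 0 -> w3 = 0 -> w4 = 0 ->
    u = - (v1 - v2 + v3 - v4) + (th i * w1 - th j * w2 + th k * w3 - th l * w4) -> u = 0.
  by do 9 move=> ->; ring.
apply: (sum0 _ _ _ _ _ _ _ _ _ (DL i j k l) (DL j i k l) (DL k i j l) (DL l i j k)
  (L j k l) (L i k l) (L i j l) (L i j k)).
rewrite /dF /tF (Fs l j) (Fs l i) (Fs k i) !mxE !(derD, derM, derN).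
rewrite (derC d j i) (derC d k i) (derC d l i) (derC d k j) (derC d l j) (derC d l k).
move: (F i j) (F i k) (F i l) (F j k) (F j l) (F k l) => a1 a2 a3 a4 a5 a6.
ring.
Qed.

Lemma ext_deriv_trace : bil dth e0 f0 + bil dth e1 f1 = 0.
Proof.
pose phi X Y Z W := bil dth X Y * bil F Z W - bil dth X Z * bil F Y W
  + bil dth X W * bil F Y Z + bil dth Y Z * bil F X W - bil dth Y W * bil F X Z
  + bil dth Z W * bil F X Y.
have : phi e0 e1 f0 f1 = 0.
  rewrite -ten4_multilinear /phi; last first.
  1-4: by move=> *; split=> [u v|a u]; rewrite !(bilDl, bilDr, bilZl, bilZr); ring.
  apply: big1 => i _; apply: big1 => j _; apply: big1 => k _; apply: big1 => l _.
  by rewrite !bil_delta ext_deriv_wedge !mul0r.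
rewrite /phi !F_eval Pe1 Pf0 Pf1 !ip_N !ipeE => E.
by rewrite -[RHS]E; ring.
Qed.

End Lee.
End Weyl.

(** * Self-dual forms at a point *)

Section LeviCivitaSymbol.
Variable R : realType.
Implicit Types (X Y Z W : 'rV[R]_4).
Local Notation lc := (@levi_civita R).

Lemma det_rows_tperm (t t' : 'I_4 -> 'I_4) (a b : 'I_4) : a != b ->
  (forall p, t' p = t (tperm a b p)) ->
  \det (\matrix_(p < 4, q < 4) (t' p == q)%:R) =
  - \det (\matrix_(p < 4, q < 4) (t p == q)%:R) :> R.
Proof.
move=> ab tE; rewrite (_ : \matrix_(p, q) _ =
    row_perm (tperm a b) (\matrix_(p < 4, q < 4) (t p == q)%:R)); last first.
  by apply/matrixP => p q; rewrite !mxE tE.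
by rewrite row_permE det_mulmx det_perm odd_tperm ab expr1 mulN1r.
Qed.

Lemma levi_civita_swap01 i j k l : lc i j k l = - lc j i k l.
Proof.
apply: (@det_rows_tperm _ _ (@Ordinal 4 0 isT) (@Ordinal 4 1 isT)) => //.
by case=> [[|[|[|[|//]]]] ?]; rewrite permE /=; do ?case: eqP => //.
Qed.
Lemma levi_civita_swap12 i j k l : lc i j k l = - lc i k j l.
Proof.
apply: (@det_rows_tperm _ _ (@Ordinal 4 1 isT) (@Ordinal 4 2 isT)) => //.
by case=> [[|[|[|[|//]]]] ?]; rewrite permE /=; do ?case: eqP => //.
Qed.
Lemma levi_civita_swap23 i j k l : lc i j k l = - lc i j l k.
Proof.
apply: (@det_rows_tperm _ _ (@Ordinal 4 2 isT) (@Ordinal 4 3 isT)) => //.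
by case=> [[|[|[|[|//]]]] ?]; rewrite permE /=; do ?case: eqP => //.
Qed.

Local Notation det4 := (ten4 lc).

Lemma det4_swap01 X Y Z W : det4 X Y Z W = - det4 Y X Z W.
Proof.
rewrite /ten4 [in RHS]exchange_big -sumrN; apply: eq_bigr => i _.
rewrite -sumrN; apply: eq_bigr => j _; rewrite -sumrN; apply: eq_bigr => k _.
by rewrite -sumrN; apply: eq_bigr => l _; rewrite levi_civita_swap01; ring.
Qed.
Lemma det4_swap12 X Y Z W : det4 X Y Z W = - det4 X Z Y W.
Proof.
rewrite /ten4 -sumrN; apply: eq_bigr => i _.
rewrite [in RHS]exchange_big -sumrN; apply: eq_bigr => j _; rewrite -sumrN; apply: eq_bigr => k _.
by rewrite -sumrN; apply: eq_bigr => l _; rewrite levi_civita_swap12; ring.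
Qed.
Lemma det4_swap23 X Y Z W : det4 X Y Z W = - det4 X Y W Z.
Proof.
rewrite /ten4 -sumrN; apply: eq_bigr => i _.
rewrite -sumrN; apply: eq_bigr => j _; rewrite [in RHS]exchange_big -sumrN; apply: eq_bigr => k _.
by rewrite -sumrN; apply: eq_bigr => l _; rewrite levi_civita_swap23; ring.
Qed.

End LeviCivitaSymbol.

Section SelfDual.
Variables (R : realType) (G : metric_data R).
Local Notation vec := 'rV[R]_4.
Local Notation g := (gm G).
Local Notation ip := (bil g).
Implicit Types (X Y Z V W : vec) (A B C : 'M[R]_4).
Variables e0 e1 f0 f1 : vec.
Hypothesis nf : null_frame G e0 e1 f0 f1.
Variable P : 'M[R]_4.
Hypotheses (Pe0 : e0 *m P = e0) (Pe1 : e1 *m P = e1)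
  (Pf0 : f0 *m P = - f0) (Pf1 : f1 *m P = - f1).
Local Notation F := (fundamental g P).
Variable o : R.
Hypothesis F_sd : self_dual o g F.

Lemma gi_invmx : invmx g = gi G.
Proof.
have gu : g \in unitmx by case: (mulmx1_unit (gmK G)).
by rewrite -[LHS]mul1mx -(giK G) -mulmxA mulmxV // mulmx1.
Qed.

Let E (a : 'I_4) : vec := nth 0 [:: e0; e1; f0; f1] a.
(** The dual frame: the product of [E a] with [E' b] is 1 if [a = b] and 0 otherwise. *)
Let E' (a : 'I_4) : vec := nth 0 [:: f0; f1; e0; e1] a.

Lemma raise_contraction (C A : 'M[R]_4) :
  \sum_k \sum_l C k l * raise g A k l =
  \sum_a \sum_b bil A (E' a) (E' b) * bil C (E a) (E b).
Proof.
have gE k i : gi G k i = \sum_a E a 0 k * E' a 0 i.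
  by rewrite (frame_ginv nf) !big_ord_recl big_ord0 /E /E' /=; ring.
have rE k l : raise g A k l = \sum_a \sum_b E a 0 k * E b 0 l * bil A (E' a) (E' b).
  rewrite /raise gi_invmx giT.
  have -> : (gi G *m A *m gi G) k l = bil A (\row_i gi G k i) (\row_i gi G l i).
    rewrite /bil exchange_big [LHS]mxE; apply: eq_bigr => j _.
    rewrite [X in X * _]mxE mulr_suml.
    apply: eq_bigr => i _; rewrite !mxE (giC G j); ring.
  have rowE' m : \row_i gi G m i = \sum_a E a 0 m *: E' a.
    apply/rowP => i; rewrite mxE gE summxE; apply: eq_bigr => a _; by rewrite mxE.
  rewrite !rowE'.
  have bl (I : finType) (c : I -> R) (V : I -> vec) W :
      bil A (\sum_i c i *: V i) W = \sum_i c i * bil A (V i) W.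
    rewrite (big_morph (fun X => bil A X W) (fun X Y => bilDl A X Y W) (id1 := 0)).
      by apply: eq_bigr => i _; rewrite bilZl.
    by have := bilZl A 0 0 W; rewrite scale0r mul0r.
  have br (I : finType) (c : I -> R) (V : I -> vec) W :
      bil A W (\sum_i c i *: V i) = \sum_i c i * bil A W (V i).
    rewrite (big_morph (fun X => bil A W X) (fun X Y => bilDr A X Y W) (id1 := 0)).
      by apply: eq_bigr => i _; rewrite bilZr.
    by have := bilZr A 0 0 W; rewrite scale0r mul0r.
  rewrite bl; apply: eq_bigr => a _; rewrite br mulr_sumr; apply: eq_bigr => b _; ring.
transitivity (\sum_k \sum_l \sum_a \sum_b C k l * E a 0 k * E b 0 l * bil A (E' a) (E' b)).
  apply: eq_bigr => k _; apply: eq_bigr => l _; rewrite rE mulr_sumr.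
  apply: eq_bigr => a _; rewrite mulr_sumr; apply: eq_bigr => b _; ring.
have push (H : 'I_4 -> 'I_4 -> 'I_4 -> R) :
    \sum_k \sum_p \sum_q H p q k = \sum_p \sum_q \sum_k H p q k.
  by rewrite exchange_big; apply: eq_bigr => p _; rewrite exchange_big.
under eq_bigr do rewrite push.
rewrite push; apply: eq_bigr => a _; apply: eq_bigr => b _.
rewrite /bil !mulr_sumr; apply: eq_bigr => k _; rewrite !mulr_sumr; apply: eq_bigr => l _.
by rewrite mulrC.
Qed.

Local Notation det4 := (ten4 (@levi_civita R)).

Lemma bil_hodge A X Y : bil (hodge o g A) X Y =
  2^-1 * (o * Num.sqrt `|\det g|) *
  \sum_a \sum_b bil A (E' a) (E' b) * det4 X Y (E a) (E b).
Proof.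
pose C X Y : 'M[R]_4 := \matrix_(k, l) det4 X Y (delta_mx 0 k) (delta_mx 0 l).
have CE Z W : bil (C X Y) Z W = det4 X Y Z W.
  move: Z; apply: tlinear_eq; [exact: tlinear_bill | exact: tlinear_ten43 | move=> k].
  move: W; apply: tlinear_eq; [exact: tlinear_bilr | exact: tlinear_ten44 | move=> l].
  by rewrite bil_delta mxE.
under eq_bigr do under eq_bigr do rewrite -CE.
rewrite -raise_contraction /C {C CE}.
under eq_bigr do under eq_bigr do rewrite mxE.
move: X; apply: tlinear_eq; first exact: tlinear_bill.
  split=> [u v|a u].
    rewrite -mulrDr -big_split; congr (_ * _); apply: eq_bigr => k _; rewrite -big_split.
    by apply: eq_bigr => l _; rewrite ten4E mulrDl.
  rewrite [RHS]mulrCA; congr (_ * _); rewrite mulr_sumr; apply: eq_bigr => k _.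
  by rewrite mulr_sumr; apply: eq_bigr => l _; rewrite ten4E mulrA.
move=> i; move: Y; apply: tlinear_eq; first exact: tlinear_bilr.
  split=> [u v|a u].
    rewrite -mulrDr -big_split; congr (_ * _); apply: eq_bigr => k _; rewrite -big_split.
    by apply: eq_bigr => l _; rewrite ten4E mulrDl.
  rewrite [RHS]mulrCA; congr (_ * _); rewrite mulr_sumr; apply: eq_bigr => k _.
  by rewrite mulr_sumr; apply: eq_bigr => l _; rewrite ten4E mulrA.
move=> j; rewrite bil_delta mxE -[in RHS]mulrA; congr (_ * _).
rewrite mulr_sumr; apply: eq_bigr => k _; rewrite mulr_sumr; apply: eq_bigr => l _.
by rewrite ten4_delta /volume mulrA.
Qed.

Let det4R X Z W : (det4 X X Z W = 0) * (det4 Z X X W = 0) * (det4 Z W X X = 0) *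
  (det4 X Z X W = 0) * (det4 X Z W X = 0) * (det4 Z X W X = 0).
Proof.
have t (u : R) : u = - u -> u = 0 by lra.
have a01 U V : det4 X X U V = 0 by apply: t; rewrite {1}det4_swap01.
have a12 U V : det4 U X X V = 0 by apply: t; rewrite {1}det4_swap12.
have a23 U V : det4 U V X X = 0 by apply: t; rewrite {1}det4_swap23.
do ![split=> //]; rewrite det4_swap12 ?a01 ?a23 ?oppr0 //.
by rewrite det4_swap23 det4_swap12 a01 !oppr0.
Qed.

Let ipeE := null_frame_ip nf.

Let vol := o * Num.sqrt `|\det g| * det4 e0 e1 f0 f1.

Let det4E : let D := det4 e0 e1 f0 f1 in
  (det4 e0 e1 f1 f0 = - D) *
  (det4 f0 f1 e0 e1 = D) * (det4 f0 f1 e1 e0 = - D) *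
  (det4 e0 f0 e1 f1 = - D) * (det4 e0 f0 f1 e1 = D) *
  (det4 e1 f1 e0 f0 = - D) * (det4 e1 f1 f0 e0 = D) *
  (det4 e0 f1 e1 f0 = D) * (det4 e0 f1 f0 e1 = - D) *
  (det4 e1 f0 e0 f1 = D) * (det4 e1 f0 f1 e0 = - D).
Proof.
have s01 := @det4_swap01 R; have s12 := @det4_swap12 R; have s23 := @det4_swap23 R.
cbv zeta.
have E1 : det4 e0 e1 f1 f0 = - det4 e0 e1 f0 f1 by rewrite s23.
have E2 : det4 e0 f0 e1 f1 = - det4 e0 e1 f0 f1 by rewrite s12.
have E3 : det4 e0 f0 f1 e1 = det4 e0 e1 f0 f1 by rewrite s23 E2 opprK.
have E4 : det4 e0 f1 e1 f0 = det4 e0 e1 f0 f1 by rewrite s12 E1 opprK.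
have E5 : det4 e0 f1 f0 e1 = - det4 e0 e1 f0 f1 by rewrite s23 E4.
have E6 : det4 f0 f1 e0 e1 = det4 e0 e1 f0 f1.
  by rewrite s12 s01 E3 opprK.
have E7 : det4 e1 f0 e0 f1 = det4 e0 e1 f0 f1 by rewrite s12 s01 opprK.
have E8 : det4 e1 f1 e0 f0 = - det4 e0 e1 f0 f1 by rewrite s12 s01 opprK.
by rewrite E1 E2 E3 E4 E5 E6 E7 E8 (s23 f0 f1) E6 (s23 e1 f1) E8 (s23 e1 f0) E7 opprK.
Qed.

Lemma hodge_frame A : A^T = - A ->
  (bil (hodge o g A) e0 e1 = vol * bil A e0 e1) *
  (bil (hodge o g A) f0 f1 = vol * bil A f0 f1) *
  (bil (hodge o g A) e0 f0 = vol * bil A e1 f1) *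
  (bil (hodge o g A) e1 f1 = vol * bil A e0 f0) *
  (bil (hodge o g A) e0 f1 = - vol * bil A e0 f1) *
  (bil (hodge o g A) e1 f0 = - vol * bil A e1 f0).
Proof.
move=> Ask.
have As X Y : bil A X Y = - bil A Y X by rewrite -[in LHS]bil_tr Ask bil_mxN.
do ![split]; rewrite bil_hodge !big_ord_recl !big_ord0 /E /E' /= !det4R !det4E /vol;
  rewrite ?(As e1 e0) ?(As f0 e0) ?(As f1 e0) ?(As f0 e1) ?(As f1 e1) ?(As f1 f0);
  by field.
Qed.

Lemma bil_fundamental X Y : bil F X Y = ip X (Y *m P).
Proof. by rewrite !bil_mul trmx_mul !mulmxA. Qed.

Let ip_N X Y : ip X (- Y) = - ip X Y. Proof. exact: bilNr. Qed.

Let FE : (bil F e0 e1 = 0) * (bil F f0 f1 = 0) * (bil F e0 f0 = -1) * (bil F e1 f1 = -1) *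
  (bil F e0 f1 = 0) * (bil F e1 f0 = 0) *
  (bil F e1 e0 = 0) * (bil F f1 f0 = 0) * (bil F f0 e0 = 1) * (bil F f1 e1 = 1) *
  (bil F f1 e0 = 0) * (bil F f0 e1 = 0) * (bil F e0 e0 = 0) * (bil F e1 e1 = 0) *
  (bil F f0 f0 = 0) * (bil F f1 f1 = 0).
Proof. by rewrite !bil_fundamental Pe0 Pe1 Pf0 Pf1 !ip_N !ipeE !oppr0. Qed.

(** Self-duality of [F] fixes both the orientation and the size of the frame:
    [F(e0, f0) = vol * F(e1, f1)], and both values are -1. The determinant of [g] need not be
    computed. *)
Let vol1 : vol = 1.
Proof.
have [Fsk Fh] := F_sd; have H := hodge_frame Fsk.
have : bil (hodge o g F) e0 f0 = vol * bil F e1 f1 by rewrite H.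
by rewrite Fh !FE mulrN1 => /oppr_inj.
Qed.

Lemma skew_frame_eq A B : A^T = - A -> B^T = - B ->
  bil A e0 e1 = bil B e0 e1 -> bil A f0 f1 = bil B f0 f1 ->
  bil A e0 f0 = bil B e0 f0 -> bil A e1 f1 = bil B e1 f1 ->
  bil A e0 f1 = bil B e0 f1 -> bil A e1 f0 = bil B e1 f0 -> A = B.
Proof.
move=> Ask Bsk E1 E2 E3 E4 E5 E6.
have sk (C : 'M[R]_4) X Y : C^T = - C -> bil C X Y = - bil C Y X.
  by move=> Csk; rewrite -[in LHS]bil_tr Csk bil_mxN.
have sk0 (C : 'M[R]_4) X : C^T = - C -> bil C X X = 0 by move=> /(sk _ X X); lra.
have As X Y := sk A X Y Ask; have Bs X Y := sk B X Y Bsk.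
apply/matrixP => i j; rewrite -(bil_delta A) -(bil_delta B).
rewrite (frame_dec nf (delta_mx 0 i)) (frame_dec nf (delta_mx 0 j)).
move: (ip _ f0) (ip _ f1) (ip _ e0) (ip _ e1) (ip _ f0) (ip _ f1) (ip _ e0) (ip _ e1).
move=> *; rewrite !(bilDl, bilDr, bilZl, bilZr).
rewrite (As e1 e0) (As f1 f0) (As f0 e0) (As f1 e1) (As f1 e0) (As f0 e1) !(sk0 A) //.
rewrite (Bs e1 e0) (Bs f1 f0) (Bs f0 e0) (Bs f1 e1) (Bs f1 e0) (Bs f0 e1) !(sk0 B) //.
by rewrite E1 E2 E3 E4 E5 E6.
Qed.

Lemma hodge_skew A : (hodge o g A)^T = - hodge o g A.
Proof.
apply/matrixP => i j; rewrite !mxE -mulrN; congr (_ * _).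
rewrite -sumrN; apply: eq_bigr => k _; rewrite -sumrN; apply: eq_bigr => l _.
by rewrite /volume (levi_civita_swap01 R i j); ring.
Qed.

Lemma bilD_mx A B X Y : bil (A + B) X Y = bil A X Y + bil B X Y.
Proof. by rewrite !bil_mul mulmxDr mulmxDl mxE. Qed.
Lemma bilZ_mx a A X Y : bil (a *: A) X Y = a * bil A X Y.
Proof. by rewrite !bil_mul -scalemxAr -scalemxAl mxE. Qed.
Lemma bil_conj A X Y : bil (P *m A *m P^T) X Y = bil A (X *m P) (Y *m P).
Proof. by rewrite !bil_mul trmx_mul !mulmxA. Qed.

(** [A + P A P^T] doubles the components on [T+] and on [T-] and kills the mixed ones; of the latter
    the self-dual part retains only the component along [F]. *)
Lemma sd_partE A : A^T = - A -> sd_part o g A =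
  2^-1 *: (A + P *m A *m P^T) - (2^-1 * (bil A e0 f0 + bil A e1 f1)) *: F.
Proof.
move=> Ask; have [Fsk _] := F_sd; have H := hodge_frame Ask.
have bN B X Y : bil B X (- Y) = - bil B X Y by exact: bilNr.
have bN' B X Y : bil B (- X) Y = - bil B X Y by exact: bilNl.
apply: skew_frame_eq.
- by rewrite /sd_part linearZ /= linearD /= Ask hodge_skew -opprD scalerN.
- rewrite linearB /= !linearZ /= linearD /= Fsk !trmx_mul trmxK Ask.
  by rewrite mulNmx mulmxN mulmxA -opprD !scalerN opprD.
all: rewrite /sd_part -scaleNr !(bilD_mx, bilZ_mx, bil_conj) !H vol1.
all: rewrite ?Pe0 ?Pe1 ?Pf0 ?Pf1 ?bN ?bN' ?opprK !FE; by field.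
Qed.

Lemma form_innerE A : A^T = - A -> form_inner g A F = bil A e0 f0 + bil A e1 f1.
Proof.
move=> Ask.
have As X Y : bil A X Y = - bil A Y X by rewrite -[in LHS]bil_tr Ask bil_mxN.
rewrite /form_inner raise_contraction !big_ord_recl !big_ord0 /E /E' /= !FE.
by rewrite (As f0 e0) (As f1 e1); field.
Qed.

(** Formulated on eigenspaces rather than on a frame, so that results obtained with frames for [P]
    and for [-P] can be combined. *)
Definition vanish (s : R) (B : 'M[R]_4) : Prop :=
  forall X Y, X *m P = s *: X -> Y *m P = s *: Y -> bil B X Y = 0.

Let bN B X Y : (bil B X (- Y) = - bil B X Y) * (bil B (- X) Y = - bil B X Y).
Proof. by split; rewrite (bilNr, bilNl). Qed.

Let skew_bil B : B^T = - B ->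
  (forall X Y, bil B X Y = - bil B Y X) * (forall X, bil B X X = 0).
Proof.
move=> Bsk; have H X Y : bil B X Y = - bil B Y X by rewrite -[in LHS]bil_tr Bsk bil_mxN.
by split=> // X; have := H X X; lra.
Qed.

Let dec_act X : X *m P = ip X f0 *: e0 + ip X f1 *: e1 - ip X e0 *: f0 - ip X e1 *: f1.
Proof.
rewrite {1}(frame_dec nf X) !mulmxDl -!scalemxAl Pe0 Pe1 Pf0 Pf1.
by rewrite !scalerN.
Qed.

Lemma dec10 X : X *m P = X -> X = ip X f0 *: e0 + ip X f1 *: e1.
Proof.
move=> XP; have E0 := congr1 (ip ^~ e0) XP; have E1 := congr1 (ip ^~ e1) XP.
move: E0 E1; rewrite /= dec_act !(bilDl, bilZl, bN) !ipeE => E0 E1.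
rewrite {1}(frame_dec nf X); have -> : ip X e0 = 0 by lra.
have -> : ip X e1 = 0 by lra.
by rewrite !scale0r !addr0.
Qed.

Lemma dec01 X : X *m P = - X -> X = ip X e0 *: f0 + ip X e1 *: f1.
Proof.
move=> XP; have E0 := congr1 (ip ^~ f0) XP; have E1 := congr1 (ip ^~ f1) XP.
move: E0 E1; rewrite /= dec_act !(bilDl, bilZl, bN) !ipeE => E0 E1.
rewrite {1}(frame_dec nf X); have -> : ip X f0 = 0 by lra.
have -> : ip X f1 = 0 by lra.
by rewrite !scale0r !add0r.
Qed.

Lemma vanish10P B : B^T = - B -> (vanish 1 B <-> bil B e0 e1 = 0).
Proof.
move=> /skew_bil[Bs B0]; split=> [v|Be X Y]; first by apply: v; rewrite scale1r.
rewrite !scale1r => /dec10 -> /dec10 ->.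
by rewrite !(bilDl, bilDr, bilZl, bilZr) !B0 (Bs e1 e0) Be; ring.
Qed.

Lemma vanish01P B : B^T = - B -> (vanish (-1) B <-> bil B f0 f1 = 0).
Proof.
move=> /skew_bil[Bs B0]; split=> [v|Be X Y]; first by apply: v; rewrite scaleN1r.
rewrite !scaleN1r => /dec01 -> /dec01 ->.
by rewrite !(bilDl, bilDr, bilZl, bilZr) !B0 (Bs f1 f0) Be; ring.
Qed.

Lemma bil_sd_part A : A^T = - A ->
  (bil (sd_part o g A) e0 e1 = bil A e0 e1) * (bil (sd_part o g A) f0 f1 = bil A f0 f1) *
  (bil (sd_part o g A) e0 f0 = 2^-1 * (bil A e0 f0 + bil A e1 f1)) *
  (bil (sd_part o g A) e1 f1 = 2^-1 * (bil A e0 f0 + bil A e1 f1)) *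
  (bil (sd_part o g A) e0 f1 = 0) * (bil (sd_part o g A) e1 f0 = 0).
Proof.
move=> Ask; rewrite sd_partE // -scaleNr !(bilD_mx, bilZ_mx, bil_conj).
by rewrite Pe0 Pe1 Pf0 Pf1 !bN !FE; do ![split]; field.
Qed.

Lemma sd_part_skew A : A^T = - A -> (sd_part o g A)^T = - sd_part o g A.
Proof.
by move=> Ask; rewrite /sd_part linearZ /= linearD /= Ask hodge_skew -opprD scalerN.
Qed.

Let bil0 X Y : bil (0 : 'M[R]_4) X Y = 0.
Proof. by rewrite bil_mul mulmx0 mul0mx mxE. Qed.

Lemma sd_part_zeroP A : A^T = - A -> bil A e0 f0 + bil A e1 f1 = 0 ->
  (sd_part o g A = 0 <-> vanish 1 A /\ vanish (-1) A).
Proof.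
move=> Ask A0; rewrite vanish10P // vanish01P //; have H := bil_sd_part Ask.
split=> [S0|[E1 E2]]; first by rewrite -!H S0 !bil0.
apply: skew_frame_eq; rewrite ?sd_part_skew ?trmx0 ?oppr0 // !H bil0 //; lra.
Qed.

Lemma proj_FE A : A^T = - A ->
  proj_F o g P A = - (2^-1 * (bil A e0 f0 + bil A e1 f1)) *: F.
Proof.
move=> Ask; rewrite /proj_F !form_innerE ?sd_part_skew //; last by case: F_sd.
by rewrite !(bil_sd_part Ask) !FE; congr (_ *: _); field.
Qed.

Lemma proj_0E A : A^T = - A -> proj_0 o g P A = 2^-1 *: (A + P *m A *m P^T).
Proof.
by move=> Ask; rewrite /proj_0 proj_FE // sd_partE // scaleNr opprK subrK.
Qed.

(** * The self-dual Weyl tensor as an operator on 2-forms *)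

Section WeylOperator.
Variable We : 'I_4 -> 'I_4 -> 'I_4 -> 'I_4 -> R.
Hypothesis We_skew12 : forall X Y Z W, ten4 We X Y Z W = - ten4 We Y X Z W.
Hypothesis We_skew34 : forall X Y Z W, ten4 We X Y Z W = - ten4 We X Y W Z.
Hypothesis We_pair : forall X Y Z W, ten4 We X Y Z W = ten4 We Z W X Y.

Definition weyl_sd i j k l : R := sd_part o g (\matrix_(p, q) We p q k l) i j.
Definition Wop A : 'M[R]_4 :=
  \matrix_(i, j) (2^-1 * \sum_k \sum_l weyl_sd i j k l * raise g A k l).

Let We_slice k l : (\matrix_(p, q) We p q k l)^T = - (\matrix_(p, q) We p q k l).
Proof. by apply/matrixP => p q; rewrite !mxE -!ten4_delta We_skew12. Qed.

Lemma bil_slice (T : 'I_4 -> 'I_4 -> 'I_4 -> 'I_4 -> R) k l X Y :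
  bil (\matrix_(p, q) T p q k l) X Y = ten4 T X Y (delta_mx 0 k) (delta_mx 0 l).
Proof.
move: X; apply: tlinear_eq; [exact: tlinear_bill | exact: tlinear_ten41 | move=> i].
move: Y; apply: tlinear_eq; [exact: tlinear_bilr | exact: tlinear_ten42 | move=> j].
by rewrite bil_delta mxE ten4_delta.
Qed.

Lemma weyl_sd_eval X Y Z W : ten4 weyl_sd X Y Z W =
  2^-1 * (ten4 We X Y Z W + ten4 We (X *m P) (Y *m P) Z W)
  - 2^-1 * (ten4 We e0 f0 Z W + ten4 We e1 f1 Z W) * bil F X Y.
Proof.
move: Z; apply: tlinear_eq; first exact: tlinear_ten43.
  by split=> [u v|a u]; rewrite !ten4E; ring.
move=> k; move: W; apply: tlinear_eq; first exact: tlinear_ten44.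
  by split=> [u v|a u]; rewrite !ten4E; ring.
move=> l; rewrite -bil_slice.
have -> : \matrix_(p, q) weyl_sd p q k l = sd_part o g (\matrix_(p, q) We p q k l).
  by apply/matrixP => p q; rewrite [LHS]mxE.
by rewrite sd_partE // -scaleNr !(bilD_mx, bilZ_mx, bil_conj) !bil_slice mulNr.
Qed.

Let WeN X Y Z W : (ten4 We X (- Y) Z W = - ten4 We X Y Z W) *
  (ten4 We (- X) Y Z W = - ten4 We X Y Z W).
Proof. by split; rewrite -scaleN1r ten4E mulN1r. Qed.

Let WpE Z W : (ten4 weyl_sd e0 e1 Z W = ten4 We e0 e1 Z W) *
  (ten4 weyl_sd f0 f1 Z W = ten4 We f0 f1 Z W) *
  (ten4 weyl_sd e0 f0 Z W = 2^-1 * (ten4 We e0 f0 Z W + ten4 We e1 f1 Z W)) *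
  (ten4 weyl_sd e1 f1 Z W = 2^-1 * (ten4 We e0 f0 Z W + ten4 We e1 f1 Z W)) *
  (ten4 weyl_sd e0 f1 Z W = 0) * (ten4 weyl_sd e1 f0 Z W = 0).
Proof.
by rewrite !weyl_sd_eval Pe0 Pe1 Pf0 Pf1 !WeN !FE; do ![split]; field.
Qed.

Lemma Wop_eval A X Y : A^T = - A -> bil (Wop A) X Y =
  bil A e0 e1 * ten4 weyl_sd X Y f0 f1 + bil A f0 f1 * ten4 weyl_sd X Y e0 e1
  - bil A e0 f0 * ten4 weyl_sd X Y e0 f0 - bil A e1 f1 * ten4 weyl_sd X Y e1 f1
  - bil A e0 f1 * ten4 weyl_sd X Y e1 f0 - bil A e1 f0 * ten4 weyl_sd X Y e0 f1.
Proof.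
move=> /skew_bil[As A0].
have Wp34 Z W : ten4 weyl_sd X Y Z W = - ten4 weyl_sd X Y W Z.
  by rewrite !weyl_sd_eval (We_skew34 X Y Z) (We_skew34 (X *m P) _ Z) (We_skew34 e0 f0 Z)
    (We_skew34 e1 f1 Z); ring.
pose C := \matrix_(k, l) ten4 weyl_sd X Y (delta_mx 0 k) (delta_mx 0 l).
have CE Z W : bil C Z W = ten4 weyl_sd X Y Z W.
  move: Z; apply: tlinear_eq; [exact: tlinear_bill | exact: tlinear_ten43 | move=> k].
  move: W; apply: tlinear_eq; [exact: tlinear_bilr | exact: tlinear_ten44 | move=> l].
  by rewrite bil_delta mxE.
have -> : bil (Wop A) X Y = 2^-1 * \sum_k \sum_l C k l * raise g A k l.
  transitivity (2^-1 * \sum_k \sum_l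
      ten4 weyl_sd X Y (delta_mx 0 k) (delta_mx 0 l) * raise g A k l); last first.
    by congr (_ * _); apply: eq_bigr => k _; apply: eq_bigr => l _; rewrite [X in _ = X * _]mxE.
  move: X {Wp34 C CE}; apply: tlinear_eq; first exact: tlinear_bill.
    split=> [u v|a u].
      rewrite -mulrDr -big_split; congr (_ * _); apply: eq_bigr => k _; rewrite -big_split.
      by apply: eq_bigr => l _; rewrite ten4E mulrDl.
    rewrite [RHS]mulrCA; congr (_ * _); rewrite mulr_sumr; apply: eq_bigr => k _.
    by rewrite mulr_sumr; apply: eq_bigr => l _; rewrite ten4E mulrA.
  move=> i; move: Y; apply: tlinear_eq; first exact: tlinear_bilr.
    split=> [u v|a u].
      rewrite -mulrDr -big_split; congr (_ * _); apply: eq_bigr => k _; rewrite -big_split.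
      by apply: eq_bigr => l _; rewrite ten4E mulrDl.
    rewrite [RHS]mulrCA; congr (_ * _); rewrite mulr_sumr; apply: eq_bigr => k _.
    by rewrite mulr_sumr; apply: eq_bigr => l _; rewrite ten4E mulrA.
  move=> j; rewrite bil_delta mxE; congr (_ * _).
  by apply: eq_bigr => k _; apply: eq_bigr => l _; rewrite ten4_delta.
rewrite raise_contraction !big_ord_recl !big_ord0 /E /E' /= !CE !A0.
rewrite (As e1 e0) (As f1 f0) (As f0 e0) (As f1 e1) (As f1 e0) (As f0 e1).
rewrite (Wp34 e1 e0) (Wp34 f1 f0) (Wp34 f0 e0) (Wp34 f1 e1) (Wp34 f1 e0) (Wp34 f0 e1).
by field.
Qed.

Lemma Wop_skew A : (Wop A)^T = - Wop A.
Proof.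
apply/matrixP => i j; rewrite !mxE -mulrN; congr (_ * _).
rewrite -sumrN; apply: eq_bigr => k _; rewrite -sumrN; apply: eq_bigr => l _.
rewrite -mulNr; congr (_ * _).
by have /matrixP/(_ i j) := sd_part_skew (We_slice k l); rewrite mxE [RHS]mxE.
Qed.

Lemma WopF_eval :
  (bil (Wop F) e0 e1 = ten4 We e0 e1 e0 f0 + ten4 We e0 e1 e1 f1) *
  (bil (Wop F) f0 f1 = ten4 We f0 f1 e0 f0 + ten4 We f0 f1 e1 f1).
Proof.
by have [Fsk _] := F_sd; rewrite !Wop_eval // !FE !WpE; split; ring.
Qed.

(** By pair symmetry the block of [W^+] from [Lambda^+_0] to [R F] is the transpose of the block in
    the other direction, so one vanishes with the other. *)
Let mixed_zero : vanish 1 (Wop F) -> vanish (-1) (Wop F) ->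
  (ten4 weyl_sd e0 f0 e0 e1 = 0) * (ten4 weyl_sd e0 f0 f0 f1 = 0) *
  (ten4 weyl_sd e1 f1 e0 e1 = 0) * (ten4 weyl_sd e1 f1 f0 f1 = 0).
Proof.
rewrite vanish10P ?vanish01P ?Wop_skew // !WopF_eval !(We_pair e0 e1) !(We_pair f0 f1).
by move=> p0 q0; rewrite !WpE p0 q0 mulr0.
Qed.

Lemma Wop_eigenP : (exists c, Wop F = c *: F) <-> vanish 1 (Wop F) /\ vanish (-1) (Wop F).
Proof.
have [Fsk _] := F_sd.
split=> [[c ->]|[v1 v2]].
  by rewrite vanish10P ?vanish01P ?linearZ /= ?Fsk ?scalerN // !bilZ_mx !FE mulr0.
(* The sign is forced by [F(e0, f0) = -1]. *)
exists (- bil (Wop F) e0 f0); apply: skew_frame_eq.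
- exact: Wop_skew.
- by rewrite linearZ /= Fsk scalerN.
- by rewrite bilZ_mx FE mulr0; apply/vanish10P => //; exact: Wop_skew.
- by rewrite bilZ_mx FE mulr0; apply/vanish01P => //; exact: Wop_skew.
all: rewrite bilZ_mx !Wop_eval // !FE !WpE; ring.
Qed.

Lemma Wop_mixedP : (forall A, self_dual o g A ->
    proj_F o g P (Wop (proj_0 o g P A)) + proj_0 o g P (Wop (proj_F o g P A)) = 0) <->
  vanish 1 (Wop F) /\ vanish (-1) (Wop F).
Proof.
have [Fsk Fh] := F_sd.
have p0sk A : A^T = - A -> (2^-1 *: (A + P *m A *m P^T))^T = - (2^-1 *: (A + P *m A *m P^T)).
  move=> Ask; rewrite linearZ /= linearD /= !trmx_mul trmxK Ask mulNmx mulmxN mulmxA.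
  by rewrite -opprD scalerN.
split=> [H|[v1 v2] A [Ask _]].
  (* Testing on [F] suffices: the first summand is a multiple of [F], which vanishes on [T+] and on
     [T-], and there the second summand has the values of [Wop F]. *)
  have := H F F_sd; rewrite proj_FE; last exact: Wop_skew.
  rewrite [proj_F _ _ _ F]proj_FE // !FE.
  have c1 : - (2^-1 * (-1 + -1)) = 1 :> R by field.
  rewrite c1 scale1r.
  rewrite [proj_0 _ _ _ (Wop F)]proj_0E; last exact: Wop_skew.
  move: (- (2^-1 * _)) => c H0.
  have ev X Y := congr1 (fun B => bil B X Y) H0.
  rewrite vanish10P ?vanish01P ?Wop_skew //; split.
    have := ev e0 e1; rewrite /= !(bilD_mx, bilZ_mx, bil_conj) bil0 Pe0 Pe1 FE; lra.
  have := ev f0 f1; rewrite /= !(bilD_mx, bilZ_mx, bil_conj) bil0 Pf0 Pf1 !bN FE; lra.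
have M := mixed_zero v1 v2.
move/vanish10P: v1 => /(_ (Wop_skew _)) v1; move/vanish01P: v2 => /(_ (Wop_skew _)) v2.
have WZ a B X Y : B^T = - B -> bil (Wop (a *: B)) X Y = a * bil (Wop B) X Y.
  move=> Bsk; rewrite !Wop_eval // ?bilZ_mx; first by ring.
  by rewrite linearZ /= Bsk scalerN.
have zs : (0 : 'M[R]_4)^T = - 0 by rewrite trmx0 oppr0.
rewrite proj_0E // proj_FE; last exact: Wop_skew.
rewrite proj_FE // proj_0E; last exact: Wop_skew.
rewrite !Wop_eval ?p0sk // !(bilD_mx, bilZ_mx, bil_conj) !M.
rewrite Pe0 Pe1 Pf0 Pf1 !bN !WpE.
rewrite [X in X *: F + _](_ : _ = 0); last by ring.
rewrite scale0r add0r.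
move: (- (2^-1 * _)) => c; apply: skew_frame_eq => //; try exact/p0sk/Wop_skew.
all: rewrite bil0 !(bilD_mx, bilZ_mx, bil_conj) ?Pe0 ?Pe1 ?Pf0 ?Pf1 ?bN !WZ // ?v1 ?v2; ring.
Qed.

End WeylOperator.
End SelfDual.

(** * From rings of functions to points *)

Section Evaluation.
Variables (R : realType) (U : region R).
Local Notation A := (smooth_fun U).

(** The membership proof is an argument because evaluation is a ring morphism only at points of [U]:
    elsewhere the unit of the ring takes the value 0. *)
Definition sev x (Ux : region_set U x) (a : A) : R := a x.

Section At.
Variables (x : 'rV[R]_4) (Ux : region_set U x).
Lemma sev_is_zmod_morphism : zmod_morphism (sev Ux).
Proof. by move=> a b; rewrite /sev smooth_funD // smooth_funN. Qed.
Lemma sev_is_monoid_morphism : monoid_morphism (sev Ux).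
Proof. by split=> [|a b]; rewrite /sev ?smooth_fun1 ?smooth_funM. Qed.
HB.instance Definition _ := GRing.isZmodMorphism.Build A R (sev Ux) sev_is_zmod_morphism.
HB.instance Definition _ := GRing.isMonoidMorphism.Build A R (sev Ux) sev_is_monoid_morphism.

Lemma sev_bil (B : 'M[A]_4) X Y :
  sev Ux (bil B X Y) = bil (map_mx (sev Ux) B) (map_mx (sev Ux) X) (map_mx (sev Ux) Y).
Proof.
rewrite rmorph_sum; apply: eq_bigr => i _; rewrite rmorph_sum; apply: eq_bigr => j _.
by rewrite !rmorphM /= !mxE.
Qed.

Lemma sev_ten4 (T : 'I_4 -> 'I_4 -> 'I_4 -> 'I_4 -> A) X Y Z W :
  sev Ux (ten4 T X Y Z W) = ten4 (fun i j k l => sev Ux (T i j k l))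
   (map_mx (sev Ux) X) (map_mx (sev Ux) Y) (map_mx (sev Ux) Z) (map_mx (sev Ux) W).
Proof.
rewrite rmorph_sum; apply: eq_bigr => i _; rewrite rmorph_sum; apply: eq_bigr => j _.
rewrite rmorph_sum; apply: eq_bigr => k _; rewrite rmorph_sum; apply: eq_bigr => l _.
by rewrite !rmorphM /= !mxE.
Qed.
End At.

Lemma sev_inj (a b : A) : (forall x (Ux : region_set U x), sev Ux a = sev Ux b) -> a = b.
Proof. by move=> H; apply: smooth_fun_ext => x Ux; exact: H. Qed.

Definition smf_der : derivations A :=
  Derivations (@smf_dD R U) (@smf_dM R U) (@smf_d_comm R U).

(* [f] is only meaningful on [U], whereas the elements of [A] vanish outside. *)
Definition rep (f : 'rV[R]_4 -> R) (a : A) := forall x, region_set U x -> f x = a x.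

Lemma rep_d i f a : rep f a -> rep (pderive i f) (smf_der i a).
Proof.
move=> fa x Ux; apply: esym; apply: (etrans (smf_dE i a Ux)); apply: esym.
exact: pderive_eq (@region_open _ U) Ux fa.
Qed.
Lemma repD f f' a b : rep f a -> rep f' b -> rep (fun x => f x + f' x) (a + b).
Proof. by move=> fa fb x Ux; rewrite smooth_funD // fa // fb. Qed.
Lemma repN f a : rep f a -> rep (fun x => - f x) (- a).
Proof. by move=> fa x Ux; rewrite smooth_funN // fa. Qed.
Lemma repB f f' a b : rep f a -> rep f' b -> rep (fun x => f x - f' x) (a - b).
Proof. by move=> fa fb; apply/repD/repN. Qed.
Lemma repM f f' a b : rep f a -> rep f' b -> rep (fun x => f x * f' x) (a * b).
Proof. by move=> fa fb x Ux; rewrite smooth_funM // fa // fb. Qed.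
Lemma rep_cst c : rep (fun _ => c) (smf_cst U c).
Proof. by move=> x Ux; rewrite smf_cstE. Qed.
Lemma rep_sum (f : 'I_4 -> 'rV[R]_4 -> R) a : (forall i, rep (f i) (a i)) ->
  rep (fun x => \sum_i f i x) (\sum_i a i).
Proof. by move=> fa x Ux; rewrite smooth_fun_sum //; apply: eq_bigr => i _; exact: fa. Qed.

Definition smf_mx m n (B : 'rV[R]_4 -> 'M[R]_(m, n))
  (sB : forall i j, smooth_on U (fun x => B x i j)) : 'M[A]_(m, n) :=
  \matrix_(i, j) smf (sB i j).

Lemma sev_smf_mx m n (B : 'rV[R]_4 -> 'M[R]_(m, n)) sB x (Ux : region_set U x) :
  map_mx (sev Ux) (@smf_mx m n B sB) = B x.
Proof. by apply/matrixP => i j; rewrite !mxE /sev smfE. Qed.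

Variable g : 'rV[R]_4 -> 'M[R]_4.
Hypothesis g_smooth : smooth_matrix_on U g.
Hypothesis g_sym : forall x, region_set U x -> (g x)^T = g x.
Hypothesis g_unit : forall x, region_set U x -> g x \in unitmx.

Local Notation gA := (smf_mx g_smooth).

(** Over a ring of functions the inverse is the adjugate divided by the determinant, which has no
    zero on [U]. *)
Lemma smf_inverse : exists gi, gi *m gA = 1%:M.
Proof.
have [b bE] : exists b, b * \det gA = 1.
  apply: smooth_fun_inv => x Ux.
  rewrite -[_ x]/(sev Ux _) -det_map_mx sev_smf_mx -unitfE -unitmxE.
  exact: g_unit.
by exists (b *: \adj gA); rewrite -scalemxAl mul_adj_mx scale_scalar_mx bE.
Qed.

Lemma smf_metric_sym : gA^T = gA.
Proof.
apply/matrixP => i j; rewrite !mxE; apply: smooth_fun_ext => x Ux; rewrite !smfE //.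
by rewrite -{1}(g_sym Ux) mxE.
Qed.

Lemma smf_half2 : smf_cst U 2^-1 + smf_cst U 2^-1 = 1.
Proof.
apply: smooth_fun_ext => x Ux; rewrite smooth_funD // !smf_cstE //; lra.
Qed.

Definition smf_metric : metric_data A :=
  MetricData smf_metric_sym (projT2 (cid smf_inverse)) smf_half2.

Local Notation G := smf_metric.
Local Notation sixth := (smf_cst U 6^-1).

Lemma sev_gi x (Ux : region_set U x) : map_mx (sev Ux) (gi G) = invmx (g x).
Proof.
have E : map_mx (sev Ux) (gi G) *m g x = 1%:M.
  by rewrite -(sev_smf_mx g_smooth Ux) -map_mxM (giK G) map_mx1.
by rewrite -[RHS]mul1mx -E -mulmxA mulmxV ?mulmx1 // g_unit.
Qed.

Lemma rep_gm i j : rep (fun x => g x i j) (gm G i j).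
Proof. by move=> x Ux; rewrite mxE smfE. Qed.
Lemma rep_ginv i j : rep (fun x => ginv g x i j) (gi G i j).
Proof. by move=> x Ux; rewrite /ginv -(sev_gi Ux) mxE. Qed.

Lemma rep_chr k i j : rep (christoffel g k i j) (chr smf_der G k i j).
Proof.
apply: repM; first exact: rep_cst.
apply: rep_sum => l; apply: repM; first exact: rep_ginv.
by apply: repB; [apply: repD|]; apply: rep_d; apply: rep_gm.
Qed.

Lemma rep_rie_up i j k l : rep (riemann_up g i j k l) (rie_up smf_der G i j k l).
Proof.
apply: repD; first by apply: repB; apply: rep_d; apply: rep_chr.
by apply: rep_sum => m; apply: repB; apply: repM; apply: rep_chr.
Qed.

Lemma rep_rie i j k l : rep (riemann g i j k l) (rie smf_der G i j k l).
Proof. by apply: rep_sum => m; apply: repM; [apply: rep_gm|apply: rep_rie_up]. Qed.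

Lemma rep_ric j l : rep (ricci g j l) (ric smf_der G j l).
Proof. by apply: rep_sum => m; apply: rep_rie_up. Qed.

Lemma rep_sca : rep (scalar_curvature g) (sca smf_der G).
Proof.
by do 2 apply: rep_sum => ?; apply: repM; [apply: rep_ginv|apply: rep_ric].
Qed.

Lemma rep_weyl i j k l : rep (weyl g i j k l) (wey smf_der G sixth i j k l).
Proof.
have gr p q m n : rep (fun x => g x p q * ricci g m n x) (gm G p q * ric smf_der G m n).
  by apply: repM; [apply: rep_gm|apply: rep_ric].
have gg p q m n : rep (fun x => g x p q * g x m n) (gm G p q * gm G m n).
  by apply: repM; apply: rep_gm.
apply: repD; last first.
  apply: repM; last exact: repB.
  by apply: repM; [apply: rep_cst|apply: rep_sca].
apply: repB; first exact: rep_rie.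
apply: repM; first exact: rep_cst.
by apply: repB => //; apply: repD => //; apply: repB.
Qed.

Lemma rep_codiff (T : 'I_4 -> 'I_4 -> 'I_4 -> 'I_4 -> 'rV[R]_4 -> R) TA i j k :
  (forall i j k l, rep (T i j k l) (TA i j k l)) ->
  rep (codiff g T i j k) (cod smf_der G TA i j k).
Proof.
move=> rT; apply: repN; do 2 apply: rep_sum => ?; apply: repM; first exact: rep_ginv.
apply: repB; first exact: rep_d.
apply: rep_sum => m.
by apply: (repD (repD (repD _ _) _) _); apply: repM => //; apply: rep_chr.
Qed.

End Evaluation.

(** * Trilinear forms *)

Section Trilinear.
Variable A : comNzRingType.
Implicit Types (b : 'I_4 -> 'I_4 -> 'I_4 -> A) (X Y Z : 'rV[A]_4).

Definition tri b X Y Z : A :=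
  \sum_i \sum_j \sum_k b i j k * X 0 i * Y 0 j * Z 0 k.

Lemma tri_rot b X Y Z : tri b X Y Z = tri (fun j k i => b i j k) Y Z X.
Proof.
rewrite /tri exchange_big; apply: eq_bigr => j _; rewrite exchange_big.
by apply: eq_bigr => k _; apply: eq_bigr => i _; ring.
Qed.

Lemma tlinear_tri1 b Y Z : tlinear (fun X => tri b X Y Z).
Proof.
pose u i := \sum_j \sum_k b i j k * Y 0 j * Z 0 k.
have [hD hZ] := tlinear_contraction u.
have E V : tri b V Y Z = \sum_i V 0 i * u i.
  apply: eq_bigr => i _; rewrite mulr_sumr; apply: eq_bigr => j _.
  rewrite mulr_sumr; apply: eq_bigr => k _; ring.
by split=> [X X'|a X]; rewrite !E.
Qed.
Lemma triD1 b X X' Y Z : tri b (X + X') Y Z = tri b X Y Z + tri b X' Y Z.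
Proof. exact: (tlinear_tri1 b Y Z).1. Qed.
Lemma triZ1 b a X Y Z : tri b (a *: X) Y Z = a * tri b X Y Z.
Proof. exact: (tlinear_tri1 b Y Z).2. Qed.
Lemma triD2 b X X' Y Z : tri b Y (X + X') Z = tri b Y X Z + tri b Y X' Z.
Proof. by rewrite !(tri_rot b) triD1. Qed.
Lemma triZ2 b a X Y Z : tri b Y (a *: X) Z = a * tri b Y X Z.
Proof. by rewrite !(tri_rot b) triZ1. Qed.
Lemma triD3 b X X' Y Z : tri b Y Z (X + X') = tri b Y Z X + tri b Y Z X'.
Proof. by rewrite !(tri_rot b) triD2. Qed.
Lemma triZ3 b a X Y Z : tri b Y Z (a *: X) = a * tri b Y Z X.
Proof. by rewrite !(tri_rot b) triZ2. Qed.
Definition triE := (triD1, triD2, triD3, triZ1, triZ2, triZ3).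

Lemma tri_skew b : (forall i j k, b i j k = - b i k j) ->
  forall X Y Z, tri b X Y Z = - tri b X Z Y.
Proof.
move=> bs X Y Z; rewrite /tri -sumrN; apply: eq_bigr => i _.
rewrite [in RHS]exchange_big -sumrN; apply: eq_bigr => j _; rewrite -sumrN.
by apply: eq_bigr => k _; rewrite bs; ring.
Qed.

Lemma tri_span b e0 e1 x0 x1 y0 y1 z0 z1 :
  (forall X Y Z, tri b X Y Z = - tri b X Z Y) -> (forall X Y, tri b X Y Y = 0) ->
  tri b (x0 *: e0 + x1 *: e1) (y0 *: e0 + y1 *: e1) (z0 *: e0 + z1 *: e1) =
  (y0 * z1 - y1 * z0) * (x0 * tri b e0 e0 e1 + x1 * tri b e1 e0 e1).
Proof.
move=> bs b0; rewrite !triE !b0 (bs e0 e1) (bs e1 e1); ring.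
Qed.

End Trilinear.

(** What a single chart contributes, free of the manifold, so that the same hypotheses can be
    verified for [-P]. The field [cd_integrable] is the vanishing of the Nijenhuis tensor on pairs
    of coordinate fields, in components. *)
Record chart_data (R : realType) (C : set 'rV[R]_4) (g P : 'rV[R]_4 -> 'M[R]_4)
    (o : 'rV[R]_4 -> R) (theta : 'rV[R]_4 -> 'rV[R]_4) : Prop := ChartData {
  cd_open : open C;
  cd_g : smooth_matrix_on C g;
  cd_P : smooth_matrix_on C P;
  cd_theta : smooth_vector_on C theta;
  cd_gT : forall x, C x -> (g x)^T = g x;
  cd_gu : forall x, C x -> g x \in unitmx;
  cd_PP : forall x, C x -> P x *m P x = 1%:M;
  cd_gP : forall x, C x -> P x *m g x = - (g x *m (P x)^T);
  cd_rank_plus : forall x, C x -> \rank (eigenspace (P x) 1) = 2%N;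
  cd_rank_minus : forall x, C x -> \rank (eigenspace (P x) (-1)) = 2%N;
  cd_integrable : forall x, C x -> forall i j k,
    \sum_m (P x i m * pderive m (fun y => P y j k) x
      - P x j m * pderive m (fun y => P y i k) x
      + pderive j (fun y => P y i m) x * P x m k
      - pderive i (fun y => P y j m) x * P x m k) = 0;
  cd_self_dual : forall x, C x -> self_dual (o x) (g x) (fund_form g P x);
  cd_lee : forall x, C x -> lee_at g P theta x
}.

(** * The frame computation read in a chart *)

Section Local.
Variables (R : realType) (C : set 'rV[R]_4) (g P : 'rV[R]_4 -> 'M[R]_4).
Variables (o : 'rV[R]_4 -> R) (theta : 'rV[R]_4 -> 'rV[R]_4).
Hypothesis cd : chart_data C g P o theta.
Variable U : region R.
Hypothesis UC : region_set U `<=` C.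
Local Notation A := (smooth_fun U).
Local Notation D := (smf_der U).

Lemma local_metric_smooth : smooth_matrix_on U g.
Proof. by move=> i j; apply: smooth_on_sub UC _; exact: (cd_g cd). Qed.
Lemma local_para_smooth : smooth_matrix_on U P.
Proof. by move=> i j; apply: smooth_on_sub UC _; exact: (cd_P cd). Qed.
Lemma local_theta_smooth : smooth_vector_on U theta.
Proof. by move=> i; apply: smooth_on_sub UC _; exact: (cd_theta cd). Qed.
Lemma local_metric_sym x : region_set U x -> (g x)^T = g x.
Proof. by move=> /UC/(cd_gT cd). Qed.
Lemma local_metric_unit x : region_set U x -> g x \in unitmx.
Proof. by move=> /UC/(cd_gu cd). Qed.

Definition local_metric := smf_metric local_metric_smooth local_metric_sym local_metric_unit.
Definition local_para : 'M[A]_4 := smf_mx local_para_smooth.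
Definition local_theta (i : 'I_4) : A := smf (local_theta_smooth i).
Local Notation F := (gm local_metric *m local_para^T).
Local Notation sixth := (smf_cst U 6^-1).

Lemma sev_gm x (Ux : region_set U x) : map_mx (sev Ux) (gm local_metric) = g x.
Proof. exact: sev_smf_mx. Qed.
Lemma sev_lP x (Ux : region_set U x) : map_mx (sev Ux) local_para = P x.
Proof. exact: sev_smf_mx. Qed.
Lemma sev_F x (Ux : region_set U x) : map_mx (sev Ux) F = fund_form g P x.
Proof. by rewrite map_mxM -map_trmx sev_gm sev_lP. Qed.

Lemma smf_mx_eq m n (B B' : 'M[A]_(m, n)) :
  (forall x (Ux : region_set U x), map_mx (sev Ux) B = map_mx (sev Ux) B') -> B = B'.
Proof.
move=> H; apply/matrixP => i j; apply: sev_inj => x Ux.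
by have /matrixP/(_ i j) := H x Ux; rewrite !mxE.
Qed.

Lemma local_paraK : local_para *m local_para = 1%:M.
Proof.
by apply: smf_mx_eq => x Ux; rewrite map_mxM map_mx1 sev_lP; exact/(cd_PP cd)/UC.
Qed.

Lemma local_para_skew : local_para *m gm local_metric = - F.
Proof.
apply: smf_mx_eq => x Ux; rewrite map_mxN map_mxM sev_F sev_lP sev_gm.
exact/(cd_gP cd)/UC.
Qed.

Lemma local_F_skew : F^T = - F.
Proof. by rewrite trmx_mul trmxK gmT local_para_skew. Qed.

Lemma rep_F i j : rep (fun x => fund_form g P x i j) (F i j).
Proof. by move=> x Ux; rewrite -(sev_F Ux) mxE. Qed.

Lemma lee_local i j k : D i (F j k) + D j (F k i) + D k (F i j)
     = local_theta i * F j k + local_theta j * F k i + local_theta k * F i j.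
Proof.
have rt l : rep (fun x => theta x 0 l) (local_theta l) by move=> x Ux; rewrite smfE.
apply: smooth_fun_ext => x Ux.
have L := cd_lee cd (UC Ux) i j k.
have rd l m n : rep (pderive l (fun y => fund_form g P y m n)) (D l (F m n)).
  by apply: rep_d; exact: rep_F.
have rm l m n : rep (fun y => theta y 0 l * fund_form g P y m n) (local_theta l * F m n).
  by apply: repM => //; exact: rep_F.
have := repD (repD (rd i j k) (rd j k i)) (rd k i j) Ux => <-.
have := repD (repD (rm i j k) (rm j k i)) (rm k i j) Ux => <-.
exact: L.
Qed.

Variables e0 e1 f0 f1 : 'rV[A]_4.
Hypothesis nf : null_frame local_metric e0 e1 f0 f1.
Hypotheses (Pe0 : e0 *m local_para = e0) (Pe1 : e1 *m local_para = e1)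
  (Pf0 : f0 *m local_para = - f0) (Pf1 : f1 *m local_para = - f1).
Hypothesis e_comm : brk D e0 e1 = 0.

Local Notation psi := (psi D local_metric e0 e1 f0 f1).
Local Notation We := (wey D local_metric sixth).
Local Notation Wp := (wplus D local_metric sixth e0 e1 f0 f1 local_para).

Let R0 := frame_curv_null nf e_comm.

Section At.
Variables (x : 'rV[R]_4) (Ux : region_set U x).
Local Notation ev := (map_mx (sev Ux)).

Lemma pt_giK : invmx (g x) *m g x = 1%:M.
Proof. by rewrite mulVmx // local_metric_unit. Qed.
Lemma pt_half2 : 2^-1 + 2^-1 = 1 :> R. Proof. by lra. Qed.
Definition ptG : metric_data R := MetricData (local_metric_sym Ux) pt_giK pt_half2.

Lemma sev_ip X Y : sev Ux (bil (gm local_metric) X Y) = bil (g x) (ev X) (ev Y).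
Proof. by rewrite sev_bil sev_gm. Qed.

Lemma pt_frame : null_frame ptG (ev e0) (ev e1) (ev f0) (ev f1).
Proof.
by case: nf => *; split; rewrite /= -sev_ip; apply: (etrans (congr1 (sev Ux) _));
  try eassumption; rewrite ?rmorph0 ?rmorph1.
Qed.

Lemma pt_Pe0 : ev e0 *m P x = ev e0.
Proof. by rewrite -{2}Pe0 map_mxM sev_lP. Qed.
Lemma pt_Pe1 : ev e1 *m P x = ev e1.
Proof. by rewrite -{2}Pe1 map_mxM sev_lP. Qed.
Lemma pt_Pf0 : ev f0 *m P x = - ev f0.
Proof. by rewrite -map_mxN -Pf0 map_mxM sev_lP. Qed.
Lemma pt_Pf1 : ev f1 *m P x = - ev f1.
Proof. by rewrite -map_mxN -Pf1 map_mxM sev_lP. Qed.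

Local Notation Wx := (fun i j k l => weyl g i j k l x).

Lemma sev_We X Y Z W : sev Ux (ten4 We X Y Z W) =
  ten4 Wx (ev X) (ev Y) (ev Z) (ev W).
Proof.
rewrite sev_ten4; congr (ten4 _ _ _ _ _).
by do 4 apply/funext => ?; apply: esym; apply: rep_weyl.
Qed.

(** A vector at [x] extends to a field with constant components; this brings the symmetries of the
    Weyl tensor down from the ring to the point. *)
Let lift (X : 'rV[R]_4) : 'rV[A]_4 := map_mx (smf_cst U) X.
Let liftK X : ev (lift X) = X.
Proof. by apply/rowP => i; rewrite !mxE /sev smf_cstE. Qed.

Lemma pt_skew12 X Y Z W : ten4 Wx X Y Z W = - ten4 Wx Y X Z W.
Proof.
rewrite -(liftK X) -(liftK Y) -(liftK Z) -(liftK W) -!sev_We -rmorphN.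
by congr (sev Ux _); apply: wey_skew12.
Qed.
Lemma pt_skew34 X Y Z W : ten4 Wx X Y Z W = - ten4 Wx X Y W Z.
Proof.
rewrite -(liftK X) -(liftK Y) -(liftK Z) -(liftK W) -!sev_We -rmorphN.
by congr (sev Ux _); apply: wey_skew34.
Qed.
Lemma pt_pair X Y Z W : ten4 Wx X Y Z W = ten4 Wx Z W X Y.
Proof.
rewrite -(liftK X) -(liftK Y) -(liftK Z) -(liftK W) -!sev_We.
by congr (sev Ux _); apply: wey_pair nf _ _ _ _.
Qed.

Local Notation WF := (weyl_plus_op g o x (fund_form g P x)).

Let Fsd : self_dual (o x) (gm ptG) (fundamental (gm ptG) (P x)).
Proof. exact: (cd_self_dual cd (UC Ux)). Qed.

Let opE B : weyl_plus_op g o x B = Wop ptG (o x) Wx B.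
Proof. by []. Qed.

Lemma pt_psi : bil WF (ev e0) (ev e1) = sev Ux psi + sev Ux psi.
Proof.
rewrite opE (WopF_eval pt_frame pt_Pe0 pt_Pe1 pt_Pf0 pt_Pf1 Fsd pt_skew12 pt_skew34).
rewrite -!sev_We -rmorphD -rmorphD; congr (sev Ux _).
exact: wey_e01F.
Qed.

Lemma pt_vanish_W : vanish (P x) 1 WF <-> sev Ux psi = 0.
Proof.
have sk : WF^T = - WF by rewrite opE; exact: (Wop_skew ptG (o x) pt_skew12).
rewrite (vanish10P pt_frame pt_Pe0 pt_Pe1 pt_Pf0 pt_Pf1 sk).
by rewrite pt_psi; split=> H; lra.
Qed.

Let dthA : 'M[A]_4 := \matrix_(i, j) (D i (local_theta j) - D j (local_theta i)).
Let sev_dth : map_mx (sev Ux) dthA = ext_deriv theta x.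
Proof.
apply/matrixP => i j; rewrite !mxE; apply: esym.
have rd k l : rep (pderive k (fun y => theta y 0 l)) (D k (local_theta l)).
  by apply: rep_d => y Uy; rewrite smfE.
exact: (repB (rd i j) (rd j i) Ux).
Qed.

Lemma ext_deriv_skew : (ext_deriv theta x)^T = - ext_deriv theta x.
Proof. by apply/matrixP => i j; rewrite !mxE opprB. Qed.

Lemma pt_dtheta : bil (ext_deriv theta x) (ev e0) (ev e1) = sev Ux psi *+ 4.
Proof.
rewrite -sev_dth -sev_bil -rmorphMn; congr (sev Ux _).
exact: (ext_deriv_psi nf Pe0 Pe1 Pf0 Pf1 local_F_skew e_comm lee_local).
Qed.

Lemma pt_trace : bil (ext_deriv theta x) (ev e0) (ev f0) +
  bil (ext_deriv theta x) (ev e1) (ev f1) = 0.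
Proof.
have E := ext_deriv_trace nf Pe1 Pf0 Pf1 local_F_skew lee_local.
rewrite -sev_dth -!sev_bil -rmorphD.
exact: (etrans (congr1 (sev Ux) E) (rmorph0 _)).
Qed.

Lemma pt_vanish_dtheta : vanish (P x) 1 (ext_deriv theta x) <-> sev Ux psi = 0.
Proof.
rewrite (vanish10P pt_frame pt_Pe0 pt_Pe1 pt_Pf0 pt_Pf1 ext_deriv_skew) pt_dtheta.
by split=> H; [lra | rewrite H mul0rn].
Qed.

Lemma pt_cond_a : sd_part (o x) (g x) (ext_deriv theta x) = 0 <->
  vanish (P x) 1 (ext_deriv theta x) /\ vanish (P x) (-1) (ext_deriv theta x).
Proof.
exact: (sd_part_zeroP pt_frame pt_Pe0 pt_Pe1 pt_Pf0 pt_Pf1 Fsd ext_deriv_skew pt_trace).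
Qed.

Lemma pt_cond_b : (forall B, self_dual (o x) (g x) B -> weyl_plus2 g P o x B = 0) <->
  vanish (P x) 1 WF /\ vanish (P x) (-1) WF.
Proof.
exact: (Wop_mixedP pt_frame pt_Pe0 pt_Pe1 pt_Pf0 pt_Pf1 Fsd pt_skew12 pt_skew34 pt_pair).
Qed.

Lemma pt_cond_b' : (exists c, WF = c *: fund_form g P x) <->
  vanish (P x) 1 WF /\ vanish (P x) (-1) WF.
Proof.
exact: (Wop_eigenP pt_frame pt_Pe0 pt_Pe1 pt_Pf0 pt_Pf1 Fsd pt_skew12 pt_skew34).
Qed.

Lemma pt_weyl_plus i j k l : weyl_plus g o i j k l x = Wp i j k l x.
Proof.
have -> : weyl_plus g o i j k l x = ten4 (@weyl_sd R ptG (o x) Wx)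
    (delta_mx 0 i) (delta_mx 0 j) (delta_mx 0 k) (delta_mx 0 l) by rewrite ten4_delta.
rewrite (weyl_sd_eval pt_frame pt_Pe0 pt_Pe1 pt_Pf0 pt_Pf1 Fsd pt_skew12).
rewrite -[RHS]/(sev Ux _) /wplus /wplus_at.
have evd m : ev (delta_mx 0 m) = delta_mx 0 m by rewrite map_delta_mx.
rewrite rmorphB !rmorphM !rmorphD /= !sev_We !map_mxM !sev_lP !evd.
by rewrite sev_bil !evd sev_F zero_outE.
Qed.

End At.

(** The codifferential differentiates [weyl_plus], so its identification with the polynomial
    expression [wplus] has to hold on the whole region. *)
Lemma rep_weyl_plus i j k l : rep (weyl_plus g o i j k l) (Wp i j k l).
Proof. by move=> x Ux; apply: pt_weyl_plus. Qed.

Let eval3_rep (b : 'I_4 -> 'I_4 -> 'I_4 -> 'rV[R]_4 -> R) bA x (Ux : region_set U x) X Y Z :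
  (forall i j k, rep (b i j k) (bA i j k)) ->
  eval3 b x (map_mx (sev Ux) X) (map_mx (sev Ux) Y) (map_mx (sev Ux) Z) =
  sev Ux (tri bA X Y Z).
Proof.
move=> rb; rewrite rmorph_sum; apply: eq_bigr => i _; rewrite rmorph_sum; apply: eq_bigr => j _.
by rewrite rmorph_sum; apply: eq_bigr => k _; rewrite !rmorphM /= (rb _ _ _ _ Ux) !mxE.
Qed.

Section AtPlus.
Variables (x : 'rV[R]_4) (Ux : region_set U x).
Local Notation ev := (map_mx (sev Ux)).
Local Notation deltaW := (eval3 (codiff g (weyl g)) x).
Local Notation deltaWp := (eval3 (codiff g (weyl_plus g o)) x).

Let repW i j k : rep (codiff g (weyl g) i j k) (cod D local_metric We i j k).
Proof. by apply: rep_codiff => *; apply: rep_weyl. Qed.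
Let repWp i j k : rep (codiff g (weyl_plus g o) i j k) (cod D local_metric Wp i j k).
Proof. by apply: rep_codiff => *; apply: rep_weyl_plus. Qed.

(** The order of quantifiers matters: the coefficients depend on the vectors and not on the form, so
    the same ones serve [delta W] and [delta W^+]. *)
Lemma delta_span X Y Z : X *m P x = X -> Y *m P x = Y -> Z *m P x = Z ->
  exists c, forall b bA, (forall i j k, rep (b i j k) (bA i j k)) ->
  (forall i j k, bA i j k = - bA i k j) ->
  eval3 b x X Y Z = c.1 * sev Ux (tri bA e0 e0 e1) + c.2 * sev Ux (tri bA e1 e0 e1).
Proof.
have dec V : V *m P x = V -> exists a, V = a.1 *: ev e0 + a.2 *: ev e1.
  move=> VP; exists (bil (g x) V (ev f0), bil (g x) V (ev f1)).
  exact: (dec10 (pt_frame Ux) (pt_Pe0 Ux) (pt_Pe1 Ux) (pt_Pf0 Ux) (pt_Pf1 Ux)).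
move=> /dec[a ->] /dec[b ->] /dec[c ->].
exists ((b.1 * c.2 - b.2 * c.1) * a.1, (b.1 * c.2 - b.2 * c.1) * a.2) => T TA rT sT.
have sx V W Q : tri (fun i j k => T i j k x) V W Q = - tri (fun i j k => T i j k x) V Q W.
  by apply: tri_skew => i j k; rewrite !(rT _ _ _ _ Ux) sT smooth_funN.
have s0 V W : tri (fun i j k => T i j k x) V W W = 0 by have := sx V W W; lra.
rewrite -[eval3 _ _ _ _ _]/(tri (fun i j k => T i j k x) _ _ _) tri_span //.
have ev3 V W Q : tri (fun i j k => T i j k x) (ev V) (ev W) (ev Q) = sev Ux (tri TA V W Q).
  exact: eval3_rep.
by rewrite !ev3 mulrDr !mulrA.
Qed.

Let We34 := @wey_skew34 _ D local_metric sixth.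
Let Wp34 : forall X Y Z W, ten4 Wp X Y Z W = - ten4 Wp X Y W Z.
Proof. by move=> *; apply: wplus_skew34. Qed.

Lemma pt_codiff_plus X Y Z : X *m P x = X -> Y *m P x = Y -> Z *m P x = Z ->
  deltaWp X Y Z = deltaW X Y Z.
Proof.
move=> XP YP ZP; have [c cE] := delta_span XP YP ZP.
rewrite (cE _ _ repW (cod_skew D local_metric We34)) (cE _ _ repWp (cod_skew D local_metric Wp34)).
have [_ _ w0 w1] := cod_wey_wplus sixth nf R0 Pe0 Pe1 Pf0 Pf1 local_F_skew e_comm.
have t0 : tri (cod D local_metric Wp) e0 e0 e1 = tri (cod D local_metric We) e0 e0 e1 := w0.
have t1 : tri (cod D local_metric Wp) e1 e0 e1 = tri (cod D local_metric We) e1 e0 e1 := w1.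
apply: congr2; first exact: (congr1 (fun t => c.1 * sev Ux t) t0).
exact: (congr1 (fun t => c.2 * sev Ux t) t1).
Qed.

Lemma pt_codiff_zero : psi = 0 ->
  forall X Y Z, X *m P x = X -> Y *m P x = Y -> Z *m P x = Z -> deltaW X Y Z = 0.
Proof.
move=> psi0 X Y Z XP YP ZP; have [c cE] := delta_span XP YP ZP.
rewrite (cE _ _ repW (cod_skew D local_metric We34)).
have [w0 w1 _ _] := cod_wey_wplus sixth nf R0 Pe0 Pe1 Pf0 Pf1 local_F_skew e_comm.
have z0 : tri (cod D local_metric We) e0 e0 e1 = 0.
  by apply: (etrans w0); rewrite psi0 Der0 mulr0 addr0.
have z1 : tri (cod D local_metric We) e1 e0 e1 = 0.
  by apply: (etrans w1); rewrite psi0 Der0 mulr0 addr0.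
by move: (tri _ e0 e0 e1) (tri _ e1 e0 e1) z0 z1 => a b -> ->; rewrite rmorph0 !mulr0 addr0.
Qed.

End AtPlus.

(** The hypothesis covers the whole region because the two equations for [psi] get differentiated.
    The factor 10 and the square are cancelled after evaluation, in the field [R]. *)
Lemma codiff_zero_psi : (forall x (Ux : region_set U x) X Y Z,
    X *m P x = X -> Y *m P x = Y -> Z *m P x = Z ->
    eval3 (codiff g (weyl g)) x X Y Z = 0) ->
  forall x (Ux : region_set U x), sev Ux psi = 0.
Proof.
move=> H x Ux.
have repW i j k : rep (codiff g (weyl g) i j k) (cod D local_metric We i j k).
  by apply: rep_codiff => *; apply: rep_weyl.
have Z X : X *m local_para = X -> tri (cod D local_metric We) X e0 e1 = 0.
  move=> XP; apply: sev_inj => y Uy; rewrite rmorph0 -(eval3_rep Uy X e0 e1 repW).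
  by apply: H => //; rewrite -(sev_lP Uy) -map_mxM ?XP ?Pe0 ?Pe1.
have := cod_wey_zero nf R0 Pe0 Pe1 Pf0 Pf1 local_F_skew e_comm (Z _ Pe0) (Z _ Pe1).
move/(congr1 (sev Ux)); rewrite rmorphMn rmorphM rmorph0 /= => /eqP.
by rewrite mulrn_eq0 /= mulf_eq0 orbb => /eqP.
Qed.

End Local.

(** * Existence of adapted frames *)

Lemma rank_minor (K : fieldType) m n (Q : 'M[K]_(m, n)) k : \rank Q = k ->
  exists (r : 'I_k -> 'I_m) (c : 'I_k -> 'I_n), mxsub r c Q \in unitmx.
Proof.
move=> <-; set r := maxrankfun Q.
have rB : \rank (rowsub r Q) = \rank Q by have /eqP := maxrowsub_free Q.
have fB : row_full (rowsub r Q)^T by rewrite /row_full mxrank_tr rB.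
exists r, (fullrankfun fB).
rewrite -unitmx_tr (_ : (mxsub _ _ _)^T = rowsub (fullrankfun fB) (rowsub r Q)^T).
  exact: fullrowsub_unit.
by apply/matrixP => i j; rewrite !mxE.
Qed.

Section Tensoriality.
Variables (A : comNzRingType) (d : derivations A) (P : 'M[A]_4).
Hypothesis PP : P *m P = 1%:M.
Implicit Types X Y : 'rV[A]_4.

Definition nij X Y : 'rV[A]_4 := brk d (X *m P) (Y *m P) + brk d X Y
  - brk d (X *m P) Y *m P - brk d X (Y *m P) *m P.

Lemma nijC X Y : nij X Y = - nij Y X.
Proof.
apply/rowP => k; rewrite /nij !(brkC d X) !(brkC d (X *m P)) !mulNmx !rvecE; ring.
Qed.

(** The Nijenhuis bracket is linear over the functions, since the derivatives of a coefficient
    cancel by [P^2 = 1]. Integrability, known on coordinate fields, thus reaches frame fields that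
    exist only on a smaller region. *)
Lemma nij_eq0 : (forall i j, nij (delta_mx 0 i) (delta_mx 0 j) = 0) ->
  forall X Y, nij X Y = 0.
Proof.
have actK (X : 'rV[A]_4) : X *m P *m P = X by rewrite -mulmxA PP mulmx1.
have lin Y k : tlinear (fun X => nij X Y 0 k).
  split=> [X X'|a X].
    rewrite /nij !(mulmxDl, brkDl, mulmxBl) !rvecE; ring.
  rewrite /nij -!scalemxAl !brkZl !(mulmxDl, mulmxBl) -!scalemxAl !actK !rvecE; ring.
move=> H X Y; apply/rowP => k; rewrite [RHS]mxE.
have z : tlinear (fun _ : 'rV[A]_4 => 0 : A) by split=> [u v|a u]; ring.
move: X; apply: (tlinear_eq (lin Y k) z) => i.
rewrite nijC rvecN; apply/eqP; rewrite oppr_eq0; apply/eqP.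
by move: Y; apply: (tlinear_eq (lin _ k) z) => j; rewrite H mxE.
Qed.

End Tensoriality.

Section GraphFrame.
Variables (A : comNzRingType) (d : derivations A) (G : metric_data A) (P : 'M[A]_4).
Hypothesis PP : P *m P = 1%:M.
Hypothesis Pg : P *m gm G = - (gm G *m P^T).
Hypothesis N0 : forall X Y, nij d P X Y = 0.
Local Notation ip := (bil (gm G)).
Implicit Types X Y : 'rV[A]_4.

Lemma brk_plus X Y : X *m P = X -> Y *m P = Y -> brk d X Y *m P = brk d X Y.
Proof.
move=> XP YP; have := N0 X Y; rewrite /nij XP YP => N.
apply/rowP => k; apply/eqP; rewrite eq_sym -subr_eq0; apply/eqP/(halfK G).
have /rowP/(_ k) := N; rewrite !rvecE [RHS]mxE => <-; ring.
Qed.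

Lemma ip_act X Y : ip (X *m P) Y = - ip X (Y *m P).
Proof.
have -> : ip (X *m P) Y = bil (P *m gm G) X Y by rewrite !bil_mul !mulmxA.
by rewrite Pg bil_mxN !bil_mul trmx_mul !mulmxA.
Qed.

Lemma ip_plus X Y : X *m P = X -> Y *m P = Y -> ip X Y = 0.
Proof.
move=> XP YP; apply: (halfK G); have := ip_act X Y; rewrite XP YP => {1}->.
by rewrite addNr.
Qed.

Lemma ip_minus X Y : X *m P = - X -> Y *m P = - Y -> ip X Y = 0.
Proof.
move=> XP YP; apply: (halfK G); have := ip_act X Y; rewrite XP YP bilNl bilNr opprK.
by move=> E; rewrite -{1}E addNr.
Qed.

Variables (r0 r1 c0 c1 : 'I_4) (mi : A).
Let Q : 'M[A]_4 := 1%:M + P.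
Hypothesis miE : mi * (Q r0 c0 * Q r1 c1 - Q r0 c1 * Q r1 c0) = 1.

(* The frame of the +1-eigenspaces that is a graph over the columns c0, c1: the
   bracket of its members has no component there, hence vanishes. *)
Lemma graph_frame : exists e0 e1 f0 f1, [/\ null_frame G e0 e1 f0 f1,
  e0 *m P = e0 /\ e1 *m P = e1, f0 *m P = - f0 /\ f1 *m P = - f1 & brk d e0 e1 = 0].
Proof.
have QP : Q *m P = Q by rewrite mulmxDl mul1mx PP addrC.
(* Cramer's rule: [Q] is twice the projection onto the +1-eigenspace, and these combinations of two
   of its rows have the identity as their block in the columns [c0], [c1]. *)
pose e0 := mi *: (Q r1 c1 *: row r0 Q - Q r0 c1 *: row r1 Q).
pose e1 := mi *: (Q r0 c0 *: row r1 Q - Q r1 c0 *: row r0 Q).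
have rowP' r : row r Q *m P = row r Q by rewrite -row_mul QP.
have e0P : e0 *m P = e0 by rewrite -scalemxAl mulmxBl -!scalemxAl !rowP'.
have e1P : e1 *m P = e1 by rewrite -scalemxAl mulmxBl -!scalemxAl !rowP'.
have [e00 e01 e10 e11] : [/\ e0 0 c0 = 1, e0 0 c1 = 0, e1 0 c0 = 0 & e1 0 c1 = 1].
  have rE r c : row r Q 0 c = Q r c by rewrite mxE.
  rewrite /e0 /e1 !rvecE !rE; split; rewrite -?[RHS]miE; ring.
(* [v c] is the metric gradient of the coordinate [c]. Its projection [f c] to the -1-eigenspace has
   the same products with [T+], because [T+] is isotropic; so the [f c] are dual to the graph
   frame. *)
pose v c : 'rV[A]_4 := row c (gi G).
have ipv X c : ip X (v c) = X 0 c.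
  rewrite bil_mul /v rowE trmx_mul giT !mulmxA -(mulmxA X) gmK mulmx1 trmx_delta -colE.
  by rewrite mxE.
pose f c := half G *: (v c - v c *m P).
have fP c : f c *m P = - f c.
  by rewrite -scalemxAl mulmxBl -mulmxA PP mulmx1 -scalerN opprB.
have ipf X c : X *m P = X -> ip X (f c) = X 0 c.
  move=> XP; rewrite bilZr bilDr bilNr.
  have -> : ip X (v c *m P) = - ip X (v c) by rewrite -{2}XP ip_act opprK.
  by rewrite opprK half_double ipv.
have nf : null_frame G e0 e1 (f c0) (f c1).
  by split; first [exact: ip_plus | exact: ip_minus | rewrite ipf].
exists e0, e1, (f c0), (f c1); split=> //.
have VP := brk_plus e0P e1P.
have brkc c : Der d e0 (e1 0 c) = 0 -> Der d e1 (e0 0 c) = 0 -> brk d e0 e1 0 c = 0.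
  by move=> E1 E2; rewrite mxE E1 E2 subrr.
rewrite (frame_dec nf (brk d e0 e1)) !ipf // !(ip_plus VP) // !scale0r !addr0.
by rewrite !brkc ?e00 ?e01 ?e10 ?e11 ?Der0 ?Der1 // !scale0r addr0.
Qed.

End GraphFrame.

Section FrameExistence.
Variables (R : realType) (C : set 'rV[R]_4) (g P : 'rV[R]_4 -> 'M[R]_4).
Variables (o : 'rV[R]_4 -> R) (theta : 'rV[R]_4 -> 'rV[R]_4).
Hypothesis cd : chart_data C g P o theta.

Section InRegion.
Variable U : region R.
Hypothesis UC : region_set U `<=` C.
Local Notation A := (smooth_fun U).
Local Notation D := (smf_der U).
Local Notation G := (local_metric cd UC).
Local Notation PA := (local_para cd UC).

Lemma local_nij X Y : nij D PA X Y = 0.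
Proof.
have PP := local_paraK cd UC.
apply: (nij_eq0 PP) => i j; apply/rowP => k; rewrite [RHS]mxE.
have dP l : delta_mx 0 l *m PA = row l PA by rewrite rowE.
rewrite /nij !dP brk_delta addr0.
have rp l m : rep (fun x => P x l m) (PA l m) by move=> x Ux; rewrite mxE smfE.
have rd u l m : rep (pderive u (fun x => P x l m)) (D u (PA l m)) by exact: rep_d.
have E : \sum_m (PA i m * D m (PA j k) - PA j m * D m (PA i k)
      + D j (PA i m) * PA m k - D i (PA j m) * PA m k) = 0.
  apply: smooth_fun_ext => x Ux; rewrite smooth_fun0 //.
  rewrite -(cd_integrable cd (UC Ux) i j k); apply: esym.
  have r m := repB (repD (repB (repM (rp i m) (rd m j k)) (repM (rp j m) (rd m i k)))
     (repM (rd j i m) (rp m k))) (repM (rd i j m) (rp m k)).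
  exact: (rep_sum r Ux).
have dd V m n : Der D V ((delta_mx 0 m : 'rV[A]_4) 0 n) = 0.
  by rewrite mxE; case: (_ && _); rewrite ?Der0 ?Der1.
have rE (l : 'I_4) n : row l PA 0 n = PA l n by rewrite mxE.
have B1 : brk D (row i PA) (row j PA) 0 k =
    \sum_m PA i m * D m (PA j k) - \sum_m PA j m * D m (PA i k).
  rewrite [LHS]mxE !rE; congr (_ - _); apply: eq_bigr => m _; by rewrite rE.
have B2 : (brk D (row i PA) (delta_mx 0 j) *m PA) 0 k = - \sum_m D j (PA i m) * PA m k.
  rewrite [LHS]mxE -sumrN; apply: eq_bigr => m _.
  by rewrite [X in X * _]mxE dd sub0r Der_delta rE mulNr.
have B3 : (brk D (delta_mx 0 i) (row j PA) *m PA) 0 k = \sum_m D i (PA j m) * PA m k.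
  rewrite [LHS]mxE; apply: eq_bigr => m _.
  by rewrite [X in X * _]mxE dd subr0 Der_delta rE.
move: E; rewrite sumrB big_split sumrB /= => E.
have S (V1 V2 V3 : 'rV[A]_4) a1 a2 a3 : V1 0 k = a1 -> V2 0 k = a2 -> V3 0 k = a3 ->
    (V1 - V2 - V3) 0 k = a1 - a2 - a3 by move=> <- <- <-; rewrite !rvecE.
by apply: (etrans (S _ _ _ _ _ _ B1 B2 B3)); rewrite opprK.
Qed.

Variables r0 r1 c0 c1 : 'I_4.
Let Q x : 'M[R]_4 := 1%:M + P x.
Hypothesis minor : forall x, region_set U x ->
  Q x r0 c0 * Q x r1 c1 - Q x r0 c1 * Q x r1 c0 != 0.

Lemma local_frame : exists e0 e1 f0 f1, [/\ null_frame G e0 e1 f0 f1,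
  e0 *m PA = e0 /\ e1 *m PA = e1, f0 *m PA = - f0 /\ f1 *m PA = - f1 & brk D e0 e1 = 0].
Proof.
have sQ x (Ux : region_set U x) i j : sev Ux ((1%:M + PA) i j) = Q x i j.
  have : map_mx (sev Ux) (1%:M + PA) = Q x by rewrite map_mxD map_mx1 sev_lP.
  by move/matrixP/(_ i j) => <-; rewrite [RHS]mxE.
have [mi miE] : exists mi, mi * ((1%:M + PA) r0 c0 * (1%:M + PA) r1 c1
    - (1%:M + PA) r0 c1 * (1%:M + PA) r1 c0) = 1.
  apply: smooth_fun_inv => x Ux.
  rewrite (_ : _ x = Q x r0 c0 * Q x r1 c1 - Q x r0 c1 * Q x r1 c0); first exact: minor.
  by rewrite -!(sQ _ Ux) -!rmorphM -rmorphB.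
exact: (graph_frame (local_paraK cd UC) (local_para_skew cd UC) local_nij miE).
Qed.

End InRegion.

Lemma det_mx22 (K : comNzRingType) (M : 'M[K]_2) :
  \det M = M 0 0 * M 1 1 - M 0 1 * M 1 0.
Proof.
rewrite (expand_det_row _ 0) !big_ord_recl big_ord0 addr0 /cofactor !det_mx11 !mxE /=.
by rewrite expr0 mul1r expr1 mulN1r mulrN; congr (_ * M _ _ - M _ _ * M _ _); apply: val_inj.
Qed.

Lemma exists_frame p : C p -> exists (U : region R) (UC : region_set U `<=` C),
  region_set U p /\ exists e0 e1 f0 f1, [/\ null_frame (local_metric cd UC) e0 e1 f0 f1,
    e0 *m local_para cd UC = e0 /\ e1 *m local_para cd UC = e1,
    f0 *m local_para cd UC = - f0 /\ f1 *m local_para cd UC = - f1 & brk (smf_der U) e0 e1 = 0].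
Proof.
move=> Cp; pose Q x : 'M[R]_4 := 1%:M + P x.
(* The row space of [1 + P] is the +1-eigenspace; a 2 by 2 minor that is nonzero at [p] remains so
   nearby and defines the region. *)
have rQ : \rank (Q p) = 2%N.
  apply: (etrans _ (cd_rank_plus cd Cp)); apply/eqP; rewrite eqn_leq; apply/andP; split.
    apply/mxrankS/eigenspaceP.
    by rewrite mulmxDl mul1mx (cd_PP cd Cp) scale1r addrC.
  apply: mxrankS; set W := eigenspace _ _.
  have WP : W *m P p = W by have /eigenspaceP := submx_refl W; rewrite scale1r.
  have -> : W = (2^-1 *: W) *m Q p.
    rewrite -scalemxAl mulmxDr mulmx1 WP.
    by move: W {WP} => W; apply/matrixP => i j; rewrite [RHS]mxE [X in _ * X]mxE; field.
  exact: submxMl.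
have [r [c]] := rank_minor rQ.
have sE i j : mxsub r c (Q p) i j = Q p (r i) (c j) by rewrite mxE.
rewrite unitmxE det_mx22 !sE unitfE => m0.
pose m x := Q x (r 0) (c 0) * Q x (r 1) (c 1) - Q x (r 0) (c 1) * Q x (r 1) (c 0).
have sQ i j : smooth_on C (fun x => Q x i j).
  apply: (smooth_on_eq (cd_open cd) _ (smooth_onD (cd_open cd)
    (@smooth_on_cst R C ((1%:M : 'M[R]_4) i j)) (cd_P cd i j))).
  by move=> x _; rewrite [RHS]mxE.
have sm : smooth_on C m.
  have E x : C x -> Q x (r 0) (c 0) * Q x (r 1) (c 1)
      + (cst (-1) x) * (Q x (r 0) (c 1) * Q x (r 1) (c 0)) = m x.
    by move=> _; rewrite mulN1r.
  apply: (smooth_on_eq (cd_open cd) E); apply: smooth_onD; first exact: cd_open cd.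
    by apply: smooth_onM => //; exact: cd_open cd.
  apply: smooth_onM; [exact: cd_open cd | exact: smooth_on_cst |].
  by apply: smooth_onM => //; exact: cd_open cd.
have oU : open [set x | C x /\ m x != 0].
  rewrite openE => x /= [Cx mx].
  have cm : {for x, continuous m}.
    exact/differentiable_continuous/(smooth_on_differentiable sm Cx).
  have n1 : \forall y \near x, C y := open_nbhs_nbhs (conj (cd_open cd) Cx).
  have n2 : \forall y \near x, m y != 0 by apply: cvgr_neq0 cm mx.
  by apply: filterS2 n1 n2 => y.
have Up : [set x | C x /\ m x != 0] p by [].
exists (Region oU Up).
have UC : [set x | C x /\ m x != 0] `<=` C by move=> x [].
exists UC; split=> //.
exact: (@local_frame (Region oU Up) UC (r 0) (r 1) (c 0) (c 1) (fun x H => proj2 H)).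
Qed.

End FrameExistence.

(** * The equivalences in one chart *)

Section HalfTheorem.
Variables (R : realType) (C : set 'rV[R]_4) (g P : 'rV[R]_4 -> 'M[R]_4).
Variables (o : 'rV[R]_4 -> R) (theta : 'rV[R]_4 -> 'rV[R]_4).
Hypothesis cd : chart_data C g P o theta.
Local Notation WF p := (weyl_plus_op g o p (fund_form g P p)).
Local Notation dth p := (ext_deriv theta p).

(** The first and the last item concern [T+] alone and are read again for [-P]; the other three
    already involve both eigenbundles. *)
Lemma chart_pointwise p : C p ->
  [/\ vanish (P p) 1 (dth p) <-> vanish (P p) 1 (WF p),
   sd_part (o p) (g p) (dth p) = 0 <-> vanish (P p) 1 (dth p) /\ vanish (P p) (-1) (dth p),
   (forall B, self_dual (o p) (g p) B -> weyl_plus2 g P o p B = 0) <->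
      vanish (P p) 1 (WF p) /\ vanish (P p) (-1) (WF p),
   (exists c, WF p = c *: fund_form g P p) <->
      vanish (P p) 1 (WF p) /\ vanish (P p) (-1) (WF p)
   & forall X Y Z, X *m P p = X -> Y *m P p = Y -> Z *m P p = Z ->
     eval3 (codiff g (weyl_plus g o)) p X Y Z = eval3 (codiff g (weyl g)) p X Y Z].
Proof.
move=> Cp; have [U [UC [Up [e0 [e1 [f0 [f1 [nf [E0 E1] [F0 F1] ec]]]]]]]] := exists_frame cd Cp.
split.
- apply: (iff_trans (pt_vanish_dtheta nf E0 E1 F0 F1 ec Up)); apply: iff_sym.
  exact: (pt_vanish_W nf E0 E1 F0 F1 Up).
- exact: (pt_cond_a nf E0 E1 F0 F1 Up).
- exact: (pt_cond_b nf E0 E1 F0 F1 Up).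
- exact: (pt_cond_b' nf E0 E1 F0 F1 Up).
- exact: (pt_codiff_plus nf E0 E1 F0 F1 ec Up).
Qed.

(** Unlike [chart_pointwise], both sides quantify over the chart: one direction needs [psi] to
    vanish near the point, the other differentiates the two equations. *)
Lemma chart_codiff : (forall p, C p -> vanish (P p) 1 (WF p)) <->
  (forall p, C p -> forall X Y Z, X *m P p = X -> Y *m P p = Y -> Z *m P p = Z ->
     eval3 (codiff g (weyl g)) p X Y Z = 0).
Proof.
split=> H p Cp;
  have [U [UC [Up [e0 [e1 [f0 [f1 [nf [E0 E1] [F0 F1] ec]]]]]]]] := exists_frame cd Cp.
  apply: (pt_codiff_zero nf E0 E1 F0 F1 ec Up).
  apply: sev_inj => x Ux; rewrite rmorph0.
  by apply/(pt_vanish_W nf E0 E1 F0 F1 Ux); exact/H/UC.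
apply/(pt_vanish_W nf E0 E1 F0 F1 Up).
apply: (codiff_zero_psi nf E0 E1 F0 F1 ec).
by move=> x Ux; exact/H/UC.
Qed.

End HalfTheorem.

(** * Charts of a paraHermitian manifold *)

Section OppositeStructure.
Variables (R : realType) (C : set 'rV[R]_4) (g P : 'rV[R]_4 -> 'M[R]_4).
Variables (o : 'rV[R]_4 -> R) (theta : 'rV[R]_4 -> 'rV[R]_4).

Lemma pderiveN (f : 'rV[R]_4 -> R) i x : differentiable f x ->
  pderive i (fun y => - f y) x = - pderive i f x.
Proof. by move=> df; apply: deriveN; apply: diff_derivable. Qed.

Lemma raiseN (G A : 'M[R]_4) : raise G (- A) = - raise G A.
Proof. by rewrite /raise mulmxN mulNmx. Qed.

Lemma hodgeN s (G A : 'M[R]_4) : hodge s G (- A) = - hodge s G A.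
Proof.
apply/matrixP => i j; rewrite !mxE -mulrN -sumrN; congr (_ * _).
apply: eq_bigr => k _; rewrite -sumrN; apply: eq_bigr => l _.
by rewrite raiseN [X in _ * X]mxE mulrN.
Qed.

Lemma fund_formN x : fund_form g (fun y => - P y) x = - fund_form g P x.
Proof. by rewrite /fund_form /fundamental linearN mulmxN. Qed.

Lemma weyl_plus_opN x A : weyl_plus_op g o x (- A) = - weyl_plus_op g o x A.
Proof.
apply/matrixP => i j; rewrite !mxE -mulrN -sumrN; congr (_ * _).
apply: eq_bigr => k _; rewrite -sumrN; apply: eq_bigr => l _.
by rewrite raiseN [X in _ * X]mxE mulrN.
Qed.

Lemma vanish_opp (Q B : 'M[R]_4) : vanish (- Q) 1 B <-> vanish Q (-1) B.
Proof.
split=> H X Y XQ YQ; apply: H.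
- by rewrite mulmxN XQ scaleN1r opprK scale1r.
- by rewrite mulmxN YQ scaleN1r opprK scale1r.
- by rewrite -[LHS]opprK -mulmxN XQ scaleN1r scale1r.
- by rewrite -[LHS]opprK -mulmxN YQ scaleN1r scale1r.
Qed.

Lemma vanishN (Q : 'M[R]_4) s B : vanish Q s (- B) <-> vanish Q s B.
Proof.
have E X Y : bil (- B) X Y = - bil B X Y by exact: bil_mxN.
split=> H X Y XQ YQ; last by rewrite E H ?oppr0.
by apply: oppr_inj; rewrite -E H ?oppr0.
Qed.

(** [F] changes sign, and the Lee equation and self-duality are linear in [F], so [theta] and [o]
    stay the same. The integrability condition is quadratic in [P], and the two rank conditions are
    exchanged. *)
Lemma chart_data_opp : chart_data C g P o theta ->
  chart_data C g (fun x => - P x) o theta.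
Proof.
move=> cd; have dP i j x : C x -> differentiable (fun y => P y i j) x.
  exact: smooth_on_differentiable (cd_P cd i j).
have EP i j : (fun y => (- P y) i j) = (fun y => - P y i j).
  by apply/funext => y; rewrite mxE.
have Pm (x : 'rV[R]_4) i j : (- P x) i j = - P x i j by rewrite mxE.
have dF i j x : C x -> differentiable (fun y => fund_form g P y i j) x.
  move=> Cx; have Eq : (fun y => fund_form g P y i j) = (fun y => \sum_k g y i k * P y j k).
    by apply/funext => y; rewrite mxE; apply: eq_bigr => k _; rewrite [X in _ * X]mxE.
  rewrite Eq (_ : (fun y => _) = \sum_k (fun y => g y i k * P y j k)); last first.
    by apply/funext => y; rewrite fct_sumE.
  apply: differentiable_sum => k; apply: differentiableM => //; last exact: dP.
  exact: smooth_on_differentiable (cd_g cd i k) Cx.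
have EF i j : (fun y => fund_form g (fun z => - P z) y i j) = (fun y => - fund_form g P y i j).
  by apply/funext => y; rewrite fund_formN mxE.
have rk (a : R) x : \rank (eigenspace (- P x) a) = \rank (eigenspace (P x) (- a)).
  rewrite /eigenspace !mxrank_ker (_ : - P x - a%:M = - (P x - (- a)%:M)) ?mxrank_opp //.
  by rewrite opprB addrC raddfN.
split; try by case: cd.
- move=> i j; rewrite EP.
  apply: (smooth_on_eq (cd_open cd) _ (smooth_onM (cd_open cd)
    (@smooth_on_cst R C (-1)) (cd_P cd i j))) => x _ /=.
  by rewrite mulN1r.
- move=> x Cx; have NN (B : 'M[R]_4) : (- B) *m (- B) = B *m B.
    by rewrite mulmxN mulNmx opprK.
  have E : (- P x) *m (- P x) = 1%:M by rewrite NN; apply: (cd_PP cd Cx).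
  exact: E.
- move=> x Cx; have NN (B B' : 'M[R]_4) : B *m B' = - (B' *m B^T) ->
      (- B) *m B' = - (B' *m (- B)^T).
    by move=> BE; rewrite mulNmx BE (_ : (- B)^T = - B^T) ?linearN // mulmxN.
  exact: (NN _ _ (cd_gP cd Cx)).
- by move=> x Cx /=; rewrite rk (cd_rank_minus cd Cx).
- by move=> x Cx /=; rewrite rk opprK (cd_rank_plus cd Cx).
- move=> x Cx i j k /=; rewrite -[RHS](cd_integrable cd Cx i j k).
  apply: eq_bigr => m _; rewrite !EP !Pm !pderiveN; try exact: dP.
  ring.
- move=> x Cx; have [Fs Fh] := cd_self_dual cd Cx.
  by rewrite fund_formN; split; rewrite ?linearN /= ?Fs ?hodgeN ?Fh.
- move=> x Cx i j k; have L := cd_lee cd Cx i j k; cbv zeta in L |- *.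
  rewrite !EF !fund_formN !pderiveN; try exact: dF.
  have FN l m : (- fund_form g P x) l m = - fund_form g P x l m by rewrite mxE.
  by rewrite !FN; lra.
Qed.

End OppositeStructure.

(** * The part of type (0,2) of a vector-valued 2-form *)

Section Part02.
Variables (R : realType) (g : 'rV[R]_4 -> 'M[R]_4) (x : 'rV[R]_4) (P : 'M[R]_4).
Hypothesis gu : g x \in unitmx.
Hypothesis PP : P *m P = 1%:M.
Hypothesis Pg : P *m g x = - (g x *m P^T).
Variable b : 'I_4 -> 'I_4 -> 'I_4 -> 'rV[R]_4 -> R.
Local Notation ev := (eval3 b x).
Local Notation ip := (bil (g x)).

Let ev_tri X Y Z : ev X Y Z = tri (fun i j k => b i j k x) X Y Z.
Proof. by []. Qed.

Lemma ip_vector_form X Y Z : ip X (vector_form g b x Y Z) = ev X Y Z.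
Proof.
pose t : 'cV[R]_4 := \col_i ev (delta_mx 0 i) Y Z.
have -> : vector_form g b x Y Z = (invmx (g x) *m t)^T.
  by apply/rowP => l; rewrite !mxE; apply: eq_bigr => i _; rewrite [in RHS]mxE.
rewrite bil_mul trmxK -mulmxA mulKVmx // mxE.
move: X; apply: tlinear_eq.
- by have := tlinear_contraction (fun i => t i 0).
- split=> [u v|a u]; rewrite !ev_tri; [exact: triD1|exact: triZ1].
by move=> i; rewrite contraction_delta mxE.
Qed.

Lemma ip_part02 X Y Z : 4 * ip X (part02 P (vector_form g b x) Y Z) =
  ev X Y Z + ev X (Y *m P) (Z *m P) + ev (X *m P) (Y *m P) Z + ev (X *m P) Y (Z *m P).
Proof.
have act V : ip X (V *m P) = - ip (X *m P) V.
  have -> : ip (X *m P) V = bil (P *m g x) X V by rewrite !bil_mul !mulmxA.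
  by rewrite Pg bil_mxN opprK !bil_mul trmx_mul !mulmxA.
rewrite /part02 bilZr !(bilDr, bilNr) !act !ip_vector_form; by field.
Qed.

(** On eigenvectors with signs [s], [t], [u], the right-hand side of [ip_part02] is
    [1 + tu + st + su] times the value of the form: 4 if the signs agree, 0 otherwise. Only the
    components purely on [T+] or purely on [T-] survive. *)
Lemma part02_zeroP : (forall Y Z, part02 P (vector_form g b x) Y Z = 0) <->
  (forall X Y Z, X *m P = X -> Y *m P = Y -> Z *m P = Z -> ev X Y Z = 0) /\
  (forall X Y Z, X *m P = - X -> Y *m P = - Y -> Z *m P = - Z -> ev X Y Z = 0).
Proof.
split=> [H|[H1 H2] Y Z].
  have H' X Y Z : ev X Y Z + ev X (Y *m P) (Z *m P)
      + ev (X *m P) (Y *m P) Z + ev (X *m P) Y (Z *m P) = 0.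
    by rewrite -ip_part02 H; have := bilZr (g x) 0 0 X; rewrite scale0r mul0r => ->; rewrite mulr0.
  have N1 X Y Z : ev (- X) Y Z = - ev X Y Z by rewrite -scaleN1r ev_tri triZ1 mulN1r.
  have N2 X Y Z : ev X (- Y) Z = - ev X Y Z by rewrite -scaleN1r ev_tri triZ2 mulN1r.
  have N3 X Y Z : ev X Y (- Z) = - ev X Y Z by rewrite -scaleN1r ev_tri triZ3 mulN1r.
  split=> X Y Z XP YP ZP; have := H' X Y Z; rewrite XP YP ZP; first by lra.
  by rewrite !N1 !N2 !N3; lra.
have z X : ip X (part02 P (vector_form g b x) Y Z) = 0.
  have proj (s : R) (V : 'rV[R]_4) : s * s = 1 ->
      (V + s *: (V *m P)) *m P = s *: (V + s *: (V *m P)).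
    move=> ss; rewrite mulmxDl -scalemxAl -mulmxA PP mulmx1 scalerDr scalerA ss scale1r.
    by rewrite addrC.
  have p1 (V : 'rV[R]_4) : (V + 1 *: (V *m P)) *m P = V + 1 *: (V *m P).
    by rewrite proj ?mulr1 // scale1r.
  have m1 (V : 'rV[R]_4) : (V + (-1) *: (V *m P)) *m P = - (V + (-1) *: (V *m P)).
    by rewrite proj ?mulrNN ?mulr1 // scaleN1r.
  have := ip_part02 X Y Z.
  (* When the two expansions are added, the terms with an odd number of factors [P] cancel and those
     of [ip_part02] remain, doubled. *)
  have := H1 _ _ _ (p1 X) (p1 Y) (p1 Z); have := H2 _ _ _ (m1 X) (m1 Y) (m1 Z).
  rewrite !ev_tri !triE; lra.
apply/rowP => i; rewrite [RHS]mxE.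
set V := part02 _ _ _ _ in z *.
have gV : g x *m V^T = 0.
  apply/colP => j; rewrite [RHS]mxE -[RHS](z (delta_mx 0 j)) bil_mul -mulmxA -rowE.
  by rewrite [RHS]mxE.
have : V^T = 0 by rewrite -[LHS](mulKmx gu) gV mulmx0.
by move/matrixP/(_ i 0); rewrite !mxE.
Qed.

End Part02.

(** * From the manifold to the data of a chart *)

Section ChartOfManifold.
Variables (R : realType) (M : manifold4 R) (H : paraHermitian M).
Variables (o : orientation M) (theta : oneForm M).
Hypothesis F_self_dual : everywhere (fun (a : chart M) x =>
  self_dual (o a x) (metric H a x) (fund_form (metric H a) (para H a) x)).
Hypothesis theta_lee : everywhere (fun (a : chart M) x =>
  lee_at (metric H a) (para H a) (theta a) x).
Variable a : chart M.
Local Notation g := (metric H a).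
Local Notation P := (para H a).

Lemma derive_components (Y : 'rV[R]_4 -> 'rV[R]_4) (v x : 'rV[R]_4) k :
  (forall l, differentiable (fun y => Y y 0 l) x) ->
  ('D_v Y x) 0 k = \sum_m v 0 m * pderive m (fun y => Y y 0 k) x.
Proof.
move=> dY; rewrite derive_mx; last first.
  by apply/derivable_mxP => i j; rewrite [i]ord1; apply: diff_derivable.
rewrite mxE deriveE // [v in LHS]row_sum_delta linear_sum /=; apply: eq_bigr => m _.
by rewrite linearZ /= /pderive deriveE.
Qed.

Lemma chart_data_of : chart_data (cimg a) g P (o a) (theta a).
Proof.
have PP x : cimg a x -> P x *m P x = 1%:M by move=> Cx; exact: (@para_involutive _ _ H a x Cx).
split.
- exact: cimg_open.
- exact: metric_smooth.
- exact: para_smooth.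
- exact: form1_smooth.
- by move=> x Cx; exact: (@Defs.metric_sym _ _ H a x Cx).
- by move=> x Cx; exact: (@metric_nondegenerate _ _ H a x Cx).
- exact: PP.
- move=> x Cx; apply/eqP; rewrite -subr_eq0 opprK; apply/eqP/matrixP => i j.
  rewrite [RHS]mxE -bil_delta bil_mul mulmxDr mulmxDl.
  have /matrixP/(_ 0 0) := @metric_para _ _ H a x Cx (delta_mx 0 i) (delta_mx 0 j).
  rewrite [RHS]mxE trmx_mul !mulmxA => E; exact: E.
- by move=> x Cx; exact: (@para_rank_plus _ _ H a x Cx).
- by move=> x Cx; exact: (@para_rank_minus _ _ H a x Cx).
- move=> x Cx i j k.
  (* Coordinate fields are constant, hence admissible on the whole chart; in their Nijenhuis tensor
     every surviving bracket is a derivative of rows of [P]. *)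
  have sc (v : 'rV[R]_4) : smooth_vector_on (cimg a) (fun _ => v).
    by move=> l; exact: smooth_on_cst.
  have := @para_integrable _ _ H a _ _ (sc (delta_mx 0 i)) (sc (delta_mx 0 j)) x Cx.
  pose act i y : 'rV[R]_4 := delta_mx 0 i *m P y.
  have actE l m y : act l y 0 m = P y l m by rewrite /act -rowE mxE.
  have actf l m : (fun y => act l y 0 m) = (fun y => P y l m).
    by apply/funext => y; rewrite actE.
  have dA v l m : ('D_v (act l) x) 0 m = \sum_n v 0 n * pderive n (fun y => P y l m) x.
    rewrite derive_components; last first.
      by move=> q; rewrite actf; exact: (smooth_on_differentiable (@para_smooth _ _ H a l q) Cx).
    by rewrite actf.
  have dd u l m : ('D_(delta_mx 0 u) (act l) x) 0 m = pderive u (fun y => P y l m) x.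
    rewrite dA (bigD1 u) //= mxE !eqxx mul1r big1 ?addr0 // => n nu.
    by rewrite mxE (negbTE nu) andbF mul0r.
  rewrite /nijenhuis /lie_bracket.
  rewrite -![fun y => delta_mx 0 i *m P y]/(act i) -![fun y => delta_mx 0 j *m P y]/(act j).
  have DC (v w : 'rV[R]_4) : 'D_v (fun _ : 'rV[R]_4 => w) x = 0 by exact: derive_cst.
  rewrite !DC !subr0 !sub0r => N.
  have N' : 'D_(act i x) (act j) x - 'D_(act j x) (act i) x
      + 'D_(delta_mx 0 j) (act i) x *m P x - 'D_(delta_mx 0 i) (act j) x *m P x = 0.
    have q0 : (4^-1 : R) != 0 by rewrite invr_eq0 pnatr_eq0.
    by apply: (scalerI q0); rewrite scaler0 -[RHS]N mulNmx opprK addr0.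
  have /rowP/(_ k) := N'; rewrite !rvecE [RHS]mxE !dA.
  rewrite [X in _ + X - _ = _ -> _]mxE [X in _ - X = _ -> _]mxE => E.
  rewrite sumrB big_split sumrB /= -[RHS]E; congr (_ - _ + _ - _);
    by apply: eq_bigr => m _; rewrite ?actE ?dd.
- by move=> x Cx; exact: (F_self_dual Cx).
- by move=> x Cx; exact: (theta_lee Cx).
Qed.

End ChartOfManifold.

(** * Both eigenbundles in one chart *)

Section ChartConditions.
Variables (R : realType) (C : set 'rV[R]_4) (g P : 'rV[R]_4 -> 'M[R]_4).
Variables (o : 'rV[R]_4 -> R) (theta : 'rV[R]_4 -> 'rV[R]_4).
Hypothesis cd : chart_data C g P o theta.
Local Notation WF p := (weyl_plus_op g o p (fund_form g P p)).
Local Notation dth p := (ext_deriv theta p).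
Local Notation deltaW := (eval3 (codiff g (weyl g))).
Local Notation deltaWp := (eval3 (codiff g (weyl_plus g o))).
Let cd' := chart_data_opp cd.

Let oppP (Q : 'M[R]_4) (X : 'rV[R]_4) : X *m (- Q) = X <-> X *m Q = - X.
Proof.
by rewrite mulmxN; split=> [E|->]; rewrite ?opprK // -{2}E opprK.
Qed.

Lemma WF_opp p s : vanish (- P p) s (weyl_plus_op g o p (fund_form g (fun y => - P y) p)) <->
  vanish (- P p) s (WF p).
Proof. by rewrite fund_formN weyl_plus_opN; exact: vanishN. Qed.

Lemma chart_minus p : C p -> vanish (P p) (-1) (dth p) <-> vanish (P p) (-1) (WF p).
Proof.
move=> Cp; have [E _ _ _ _] := chart_pointwise cd' Cp.
apply: (iff_trans (iff_sym (vanish_opp _ _))); apply: (iff_trans E).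
by apply: (iff_trans (WF_opp _ _)); exact: vanish_opp.
Qed.

Lemma chart_codiff_plus_minus p : C p ->
  forall X Y Z, X *m P p = - X -> Y *m P p = - Y -> Z *m P p = - Z ->
  deltaWp p X Y Z = deltaW p X Y Z.
Proof.
move=> Cp X Y Z /oppP XP /oppP YP /oppP ZP.
by have [_ _ _ _ E] := chart_pointwise cd' Cp; exact: E.
Qed.

Lemma chart_codiff_minus : (forall p, C p -> vanish (P p) (-1) (WF p)) <->
  (forall p, C p -> forall X Y Z, X *m P p = - X -> Y *m P p = - Y -> Z *m P p = - Z ->
     deltaW p X Y Z = 0).
Proof.
have [E1 E2] := chart_codiff cd'; split=> H p Cp.
  move=> X Y Z /oppP XP /oppP YP /oppP ZP; apply: (E1 _ p Cp) => // q Cq.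
  by apply/WF_opp/vanish_opp/H.
apply/vanish_opp/WF_opp; apply: E2 => // q Cq X Y Z /oppP XP /oppP YP /oppP ZP.
exact: H.
Qed.

Lemma chart_cond_a p : C p -> sd_part (o p) (g p) (dth p) = 0 <->
  vanish (P p) 1 (WF p) /\ vanish (P p) (-1) (WF p).
Proof.
move=> Cp; have [E1 Ea _ _ _] := chart_pointwise cd Cp.
by apply: (iff_trans Ea); split=> -[/E1 ? /(chart_minus Cp) ?].
Qed.

Lemma chart_cond_c p : C p ->
  (forall Y Z, codiff_weyl_plus_minus g P o p Y Z = 0) <->
  (forall X Y Z, X *m P p = X -> Y *m P p = Y -> Z *m P p = Z -> deltaW p X Y Z = 0) /\
  (forall X Y Z, X *m P p = - X -> Y *m P p = - Y -> Z *m P p = - Z -> deltaW p X Y Z = 0).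
Proof.
move=> Cp; have [_ _ _ _ E] := chart_pointwise cd Cp.
have E' := chart_codiff_plus_minus Cp.
apply: (iff_trans (part02_zeroP (cd_gu cd Cp) (cd_PP cd Cp) (cd_gP cd Cp) _)).
split=> -[H1 H2]; split=> X Y Z XP YP ZP.
- by rewrite -E //; exact: H1.
- by rewrite -E' //; exact: H2.
- by rewrite E //; exact: H1.
- by rewrite E' //; exact: H2.
Qed.

End ChartConditions.

Theorem theorem1p1 (R : realType) (M : manifold4 R) (H : paraHermitian M)
    (o : orientation M) (theta : oneForm M)
    (F_self_dual : everywhere (fun (a : chart M) x =>
       self_dual (o a x) (metric H a x) (fund_form (metric H a) (para H a) x)))
    (theta_lee : everywhere (fun (a : chart M) x =>
       lee_at (metric H a) (para H a) (theta a) x)) :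
  let cond_a := everywhere (fun (a : chart M) x =>
    sd_part (o a x) (metric H a x) (ext_deriv (theta a) x) = 0) in
  let cond_b := everywhere (fun (a : chart M) x =>
    forall A : 'M[R]_4, self_dual (o a x) (metric H a x) A ->
    weyl_plus2 (metric H a) (para H a) (o a) x A = 0) in
  let cond_b' := everywhere (fun (a : chart M) x =>
    exists c : R,
      weyl_plus_op (metric H a) (o a) x (fund_form (metric H a) (para H a) x)
      = c *: fund_form (metric H a) (para H a) x) in
  let cond_c := everywhere (fun (a : chart M) x =>
    forall Y Z : 'rV[R]_4,
    codiff_weyl_plus_minus (metric H a) (para H a) (o a) x Y Z = 0) in
  let cond_c' := everywhere (fun (a : chart M) x =>
    (forall X Y Z : 'rV[R]_4,
       vector10 (para H a x) X -> vector10 (para H a x) Y ->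
       vector10 (para H a x) Z ->
       eval3 (codiff (metric H a) (weyl (metric H a))) x X Y Z = 0) /\
    (forall X Y Z : 'rV[R]_4,
       vector01 (para H a x) X -> vector01 (para H a x) Y ->
       vector01 (para H a x) Z ->
       eval3 (codiff (metric H a) (weyl (metric H a))) x X Y Z = 0)) in
  [/\ cond_a <-> cond_b, cond_b <-> cond_b', cond_b <-> cond_c
    & cond_c <-> cond_c'].
Proof.
move=> cond_a cond_b cond_b' cond_c cond_c'.
have cd a := chart_data_of F_self_dual theta_lee a.
(* The pivot to which all conditions are reduced: [W^+(F)] has no component in [Lambda^+_0]. *)
pose cond_W := everywhere (fun (a : chart M) x =>
  let WF := weyl_plus_op (metric H a) (o a) x (fund_form (metric H a) (para H a) x) in
  vanish (para H a x) 1 WF /\ vanish (para H a x) (-1) WF).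
have aW : cond_a <-> cond_W.
  by split=> h a x Cx; apply/(chart_cond_a (cd a) Cx); exact: h.
have bW : cond_b <-> cond_W.
  split=> h a x Cx; have [_ _ E _ _] := chart_pointwise (cd a) Cx; first exact/E/h.
  by apply/E; exact: h.
have bW' : cond_b' <-> cond_W.
  split=> h a x Cx; have [_ _ _ E _] := chart_pointwise (cd a) Cx; first exact/E/h.
  by apply/E; exact: h.
have cc' : cond_c <-> cond_c'.
  by split=> h a x Cx; apply/(chart_cond_c (cd a) Cx); exact: h.
have cW : cond_c' <-> cond_W.
  (* The point is generalized again in each branch, because these equivalences hold over a chart and
     not at a single point. *)
  split=> h a x Cx; split.
  - by move: x Cx; apply/(chart_codiff (cd a)) => x Cx; exact: (h a x Cx).1.
  - by move: x Cx; apply/(chart_codiff_minus (cd a)) => x Cx; exact: (h a x Cx).2.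
  - by move: x Cx; apply/(chart_codiff (cd a)) => x Cx; exact: (h a x Cx).1.
  - by move: x Cx; apply/(chart_codiff_minus (cd a)) => x Cx; exact: (h a x Cx).2.
by split; tauto.
Qed.
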